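(* Let $\mathbb{F}_{q_0}$ be a finite field of characteristic $p$, and let $L(t_1,t_2)=L(t_2)$ and $M(t_1,t_2)=M(t_1)$ be polynomials over $\mathbb{F}_{q_0}$, where $L$ depends only on the second variable and $M$ depends only on the first variable. If $L$ and $M$ are (both) linearized polynomials, assume in addition that $L'(0)M'(0)\neq 0$. Consider the map $$\varphi:\mathbb{A}^3_{\mathbb{F}_{q_0}}\to\mathbb{A}^3_{\mathbb{F}_{q_0}},\qquad (s,t_1,t_2)\mapsto (s,\ st_1+L(t_2),\ st_2+M(t_1)).$$ For each extension $\mathbb{F}_q/\mathbb{F}_{q_0}$ of finite fields, let $E_{\mathbb{F}_q}$ be the image of the induced map $\mathbb{A}^3(\mathbb{F}_q)\to\mathbb{A}^3(\mathbb{F}_q)$ on $\mathbb{F}_q$-points. Then $$|E_{\mathbb{F}_q}|\geq \frac{q^3}{4}-O(q^{5/2}),$$ where the implied constant depends only on the degrees of $L$ and $M$.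
   Context: A polynomial $f(x)\in\overline{\mathbb{F}_p}[x]$ is called linearized if it is of the form $f(x)=\sum a_i x^{p^i}+f(0)$ (a finite sum over integers $i\geq 0$). The bound $|E_{\mathbb{F}_q}|\geq \frac{q^3}{4}-O(q^{5/2})$ with implied constant depending only on the degrees of $L$ and $M$ means: there is a constant $A\geq 0$, depending only on $\deg L$ and $\deg M$ (in particular not on $q$), such that $|E_{\mathbb{F}_q}|\geq \frac{q^3}{4}-Aq^{5/2}$ for every finite extension $\mathbb{F}_q/\mathbb{F}_{q_0}$. *)

(* Defs.v *)
From HB Require Import structures.
From mathcomp Require Import all_boot all_order all_algebra.
From mathcomp Require Import reals exp.
Set Implicit Arguments.
Unset Strict Implicit.
Unset Printing Implicit Defensive.
Import GRing.Theory.
Local Open Scope ring_scope.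

(* Only meaningful when R has characteristic p.  If f has coefficients in a
   subfield, so has every a i: the predicate does not change under field
   extension, in particular on passing to the algebraic closure. *)
Definition linearized (R : nzRingType) (p : nat) (f : {poly R}) : Prop :=
  exists (n : nat) (a : nat -> R),
    f = (\sum_(i < n) a i *: 'X^(p ^ i)%N) + (f.[0])%:P.

(* The map A^3(B) -> A^3(B) on points in a k-algebra iota : k -> B.  L and M
   are univariate: L is evaluated at t2 and M at t1. *)
Definition phi (k B : comNzRingType) (iota : {rmorphism k -> B})
    (L M : {poly k}) (x : B * B * B) : B * B * B :=
  let: (s, t1, t2) := x in
  (s, s * t1 + (map_poly iota L).[t2], s * t2 + (map_poly iota M).[t1]).

Definition image_phi (F0 F : finFieldType) (iota : {rmorphism F0 -> F})
    (L M : {poly F0}) : {set F * F * F} :=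
  [set phi iota L M x | x : F * F * F].

(* Main.v *)
Require Import Defs.
From HB Require Import structures.
From mathcomp Require Import all_boot all_order all_fingroup all_algebra all_field.
From mathcomp Require Import reals exp.
From mathcomp Require Import ring lra zify.

(** For [s <> 0] let [psi s] be the map [(t1, t2) |-> (s t1 + L(t2), s t2 + M(t1))].
    Its image is large as soon as it has few collisions: each fibre size [m]
    satisfies [8 m <= 16 + m ^ 2], and summing this over the image bounds the
    image from below by the number of collisions from above ([fibre_ineq]).  If
    [(t1, t2)] and [(t1 + h, t2 + w)] collide, then
    [h (M(t1 + h) - M(t1)) = - s h w = w (L(t2 + w) - L(t2))], and these data
    determine [s].  So everything is governed by the numbers [Ndiff M c] of
    solutions of [h (M(x + h) - M(x)) = c] ([coll_le]).  It suffices that such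
    a number is at most [5/4 q + O(1)] for all but boundedly many [c]; the
    constant [5/4], weaker than the Weil bound, is what an elementary form of
    Stepanov's method gives.

    Stepanov's method ([stepanov]) is run for a family of curves [f = 0] with a
    parameter [gamma].  A pigeonhole argument gives a nonzero auxiliary
    polynomial [E(gamma, x, y, x', y')] of small degree such that
    [E(c, x, y, x ^ q, y ^ q)] vanishes to high order along the local branch of
    the curve at each of its rational points; the norm of this function down to
    [k[x]] then has many zeros, but small degree.  The norm must not vanish,
    and it suffices to see this for the norm from two independent copies
    [(x, y)] and [(x', y')] of the curve ([few_bad]).

    If [M] has a monomial whose degree is positive and not a power of [p], a
    monomial change of variables turns [h (M(x + h) - M(x)) = c] into
    [g ^ n = c^-1 B(v, g)].  This equation gives the parameter as a rational
    function of the second copy of the curve, and the double norm does not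
    vanish because the resulting equation in [y] is irreducible: its Newton
    polygons at two roots of [B(v, 0)] have slopes whose denominators generate
    the whole degree ([kummer_irr]).  The roots come from the edge of the
    Newton polygon of [M] ([orders_generic_degree], [orders_power_degree]).

    If [L] and [M] are both linearized, the fibres of [psi s] are cosets of one
    group, so that their size [m] is a power of [p], and the sharper
    inequalities [8 m <= 15 + m ^ 2] ([p] odd) and [6 m <= 8 + m ^ 2] ([p = 2])
    hold.  By Cauchy's inequality the collisions are bounded by the numbers of
    solutions of [x M(x) = x' M(x')] and of [x L(x) = x' L(x')].  This curve
    consists of lines and of one more curve, which Euler's identity for
    homogeneous components shows to be absolutely irreducible
    ([euler_irreducible]); Stepanov's method for a curve that does not involve
    [gamma] bounds its points ([const_count]).  For odd [p] the mean fibre size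
    is at most [1 + 2 + 5/4], and [(8 - 17/4) / 15] is exactly [1/4]. *)


Set Implicit Arguments.
Unset Strict Implicit.
Unset Printing Implicit Defensive.
Import GRing.Theory.
Local Open Scope ring_scope.

(** * Filtrations of rings, and the norm modulo a monic polynomial *)

Import Pdiv.CommonRing Pdiv.RingMonic.

(** A degree function without subtraction: [fil d a] reads as [deg a <= d]. Only
    the closure properties are kept, so that one estimate serves for total degrees,
    weighted degrees and degrees in a single variable. *)
Record filtration (A : comNzRingType) := Filtration {
  fil :> nat -> A -> Prop;
  fil0 : forall d, fil d 0;
  filN1 : fil 0 (-1);
  filD : forall d a b, fil d a -> fil d b -> fil d (a + b);
  filM : forall d e a b, fil d a -> fil e b -> fil (d + e) (a * b);
  filW : forall d e a, (d <= e)%N -> fil d a -> fil e a }.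

Section FiltrationTheory.
Variables (A : comNzRingType) (F : filtration A).

Lemma filN d a : F d a -> F d (- a).
Proof. by move=> h; rewrite -mulN1r; apply: (@filM _ F 0 d) => //; apply: filN1. Qed.

Lemma fil1 d : F d 1.
Proof.
apply: (@filW _ F 0) => //; rewrite -[1](opprK 1); apply: filN; exact: filN1.
Qed.

Lemma fil_sum d (I : Type) (r : seq I) (P : pred I) (G : I -> A) :
  (forall i, P i -> F d (G i)) -> F d (\sum_(i <- r | P i) G i).
Proof.
by move=> h; elim/big_ind: _ => //; [apply: fil0 | apply: filD].
Qed.

Lemma fil_exp d a n : F d a -> F (d * n)%N (a ^+ n).
Proof.
move=> h; elim: n => [|n IH]; first by rewrite muln0 expr0; apply: fil1.
by rewrite exprS mulnS; apply: filM.
Qed.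

Lemma fil_prod (I : Type) (r : seq I) (d : I -> nat) (G : I -> A) :
  (forall i, F (d i) (G i)) -> F (\sum_(i <- r) d i)%N (\prod_(i <- r) G i).
Proof.
move=> h; elim: r => [|i r IH]; first by rewrite !big_nil; apply: fil1.
by rewrite !big_cons; apply: filM.
Qed.

Lemma fil_nat d n : F d n%:R.
Proof.
elim: n => [|n IH]; first exact: fil0.
by rewrite -natr1; apply: filD => //; apply: fil1.
Qed.
End FiltrationTheory.

(** All elements have degree zero, the base case of the weighted degrees below. *)
Definition fil_triv (A : comNzRingType) : filtration A.
Proof. by exists (fun _ _ => True). Defined.

Section WeightFiltration.
Variables (A : comNzRingType) (F : filtration A) (D : nat).

Definition wfil_pred d (p : {poly A}) :=
  forall j, if (D * j <= d)%N then F (d - D * j)%N p`_j else p`_j = 0.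

Fact wfil0 d : wfil_pred d 0.
Proof. by move=> j; rewrite coef0; case: ifP => // _; apply: fil0. Qed.

Fact wfilN1 : wfil_pred 0 (-1).
Proof.
move=> j; rewrite coefN coef1; case: ifP => h.
  by case: j h => [|j] h; [rewrite muln0 subn0 /=; apply: filN1 |
     rewrite /= oppr0; apply: fil0].
by case: j h => [|j]; rewrite ?muln0 //= oppr0.
Qed.

Fact wfilD d a b : wfil_pred d a -> wfil_pred d b -> wfil_pred d (a + b).
Proof.
move=> ha hb j; rewrite coefD; move: (ha j) (hb j).
by case: ifP => // _; [apply: filD | move=> -> ->; rewrite addr0].
Qed.

Fact wfilW d e a : (d <= e)%N -> wfil_pred d a -> wfil_pred e a.
Proof.
move=> le_de ha j; move: (ha j); case: (leqP (D * j) d) => h.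
  by rewrite (leq_trans h le_de); apply: filW; rewrite leq_sub2r.
by move=> ->; case: ifP => // _; apply: fil0.
Qed.

Fact wfilM d e a b : wfil_pred d a -> wfil_pred e b -> wfil_pred (d + e)%N (a * b).
Proof.
move=> ha hb k; rewrite coefM.
have hij (i : 'I_k.+1) : (D * k = D * i + D * (k - i))%N.
  by rewrite -mulnDr subnKC // -ltnS.
case: ifP => h.
  apply: fil_sum => i _; move: (ha i) (hb (k - i)%N).
  case: leqP => h1; last by move=> -> _; rewrite mul0r; apply: fil0.
  case: leqP => h2; last by move=> _ ->; rewrite mulr0; apply: fil0.
  move=> {}ha {}hb; have -> : (d + e - D * k = (d - D * i) + (e - D * (k - i)))%N.
    by rewrite (hij i); lia.
  exact: filM.
rewrite big1 // => i _; move: (ha i) (hb (k - i)%N).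
case: leqP => h1; last by move=> -> _; rewrite mul0r.
case: leqP => h2; last by move=> _ ->; rewrite mulr0.
by move/negbT: h; rewrite (hij i) -ltnNge => h; exfalso; lia.
Qed.

(** The weighted degree on [A[X]] for which [X] has weight [D]. *)
Definition wfil : filtration {poly A} :=
  Filtration wfil0 wfilN1 wfilD wfilM wfilW.

Lemma wfilC d a : F d a -> wfil d a%:P.
Proof.
move=> h j; rewrite coefC; case: j => [|j] /=; first by rewrite muln0 leq0n subn0.
by case: ifP => // _; apply: fil0.
Qed.

Lemma wfilX : wfil D 'X.
Proof.
move=> j; rewrite coefX; case: ifP => h.
  by case: j h => [|[|j]] h /=; [apply: fil0 | apply: fil1 | apply: fil0].
by case: j h => [|[|j]]; rewrite /= ?muln0 ?muln1 ?leqnn.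
Qed.

Lemma wfil_coef d (p : {poly A}) j : wfil d p -> F d p`_j.
Proof.
move/(_ j); case: ifP => [_ | _ ->]; [apply: filW; exact: leq_subr | exact: fil0].
Qed.

End WeightFiltration.

Section Norm.
Variables (A : comNzRingType) (n : nat).
Implicit Types f P : {poly A}.

(** Multiplication by [P] on [A[X]/(f)], in the basis of the powers of [X]. *)
Definition mulmodmx f P : 'M[A]_n := \matrix_(i, j) (rmodp (P * 'X^i) f)`_j.
(** The norm of [P] from [A[X]/(f)] to [A]. As a determinant it is defined over any
    commutative ring and commutes with ring morphisms. *)
Definition norm f P : A := \det (mulmodmx f P).

Lemma polyE_ord (r : {poly A}) : (size r <= n)%N -> r = \sum_(j < n) (r`_j)%:P * 'X^j.
Proof.
move=> h; rewrite -{1}(coefK r) poly_def (big_ord_widen n (fun j => r`_j *: 'X^j)) //.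
rewrite big_mkcond; apply: eq_bigr => i _; rewrite mul_polyC.
by case: ltnP => // hi; rewrite nth_default // scale0r.
Qed.

Lemma rmodp_mulmodmx f P i : f \is monic -> size f = n.+1 ->
  rmodp (P * 'X^i) f = \sum_(j < n) ((rmodp (P * 'X^i) f)`_j)%:P * 'X^j.
Proof.
move=> fm sf; apply: polyE_ord.
by rewrite -ltnS -sf ltn_rmodp monic_neq0.
Qed.

(** Cramer's rule: the adjugate matrix expresses the norm in the ideal [(P, f)]. *)
Lemma norm_ideal f P : f \is monic -> size f = n.+1 -> (0 < n)%N ->
  exists u w, (norm f P)%:P = u * P + w * f.
Proof.
move=> fm sf n0.
set B := mulmodmx f P; set i0 := Ordinal n0.
pose u := \sum_i (\adj B i0 i)%:P * 'X^i.
suff h : rmodp ((norm f P)%:P - u * P) f = 0.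
  have := rdivp_eq fm ((norm f P)%:P - u * P); rewrite h addr0 => e.
  exists u, (rdivp ((norm f P)%:P - u * P) f); rewrite -e; ring.
rewrite rmodpB // [u * P]mulr_suml rmodp_sum //.
under eq_bigr => i _.
  rewrite -mulrA mul_polyC rmodpZ // [_ * P]mulrC rmodp_mulmodmx //.
  over.
have -> : \sum_i \adj B i0 i *: (\sum_(j < n) ((rmodp (P * 'X^i) f)`_j)%:P * 'X^j)
   = \sum_(j < n) ((\adj B *m B) i0 j)%:P * 'X^j.
  under eq_bigr => i _ do rewrite scaler_sumr.
  rewrite exchange_big; apply: eq_bigr => j _; rewrite mxE rmorph_sum mulr_suml.
  by apply: eq_bigr => i _; rewrite [B i j]mxE rmorphM /= -mul_polyC mulrA.
rewrite mul_adj_mx (bigD1 i0) //= big1 ?addr0; last first.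
  by move=> j hj; rewrite mxE eq_sym (negPf hj) mul0r.
rewrite !mxE eqxx mulr1n expr0 mulr1 rmodp_small ?subrr // sf.
by rewrite size_polyC; case: (_ != 0).
Qed.

(** The determinant is multiplicative and the norm of the constant [N] is [N ^+ n];
    modulo [f], [N] is a multiple of [P]. *)
Lemma norm_eq0_power f P N u w : f \is monic -> size f = n.+1 ->
  N%:P = u * P + w * f -> norm f P = 0 -> N ^+ n = 0.
Proof.
move=> fm sf e z.
suff h : mulmodmx f u *m mulmodmx f P = N%:M.
  by rewrite -det_scalar -h det_mulmx -/(norm f P) z mulr0.
apply/matrixP => i k; rewrite !mxE.
under eq_bigr => j _ do rewrite [mulmodmx f u i j]mxE [mulmodmx f P j k]mxE -coefZ -rmodpZ //.
rewrite -(coef_sum) -rmodp_sum //.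
have -> : \sum_(j < n) (rmodp (u * 'X^i) f)`_j *: (P * 'X^j) = rmodp (u * 'X^i) f * P.
  rewrite [in RHS]rmodp_mulmodmx // mulr_suml; apply: eq_bigr => j _.
  by rewrite -mul_polyC; ring.
rewrite rmodp_mulml // -mulrA ['X^i * P]mulrC mulrA.
have -> : u * P = N%:P - w * f by rewrite e; ring.
rewrite mulrBl rmodpB // -mulrA [f * _]mulrC mulrA rmodp_mull // subr0.
rewrite rmodp_small; last by rewrite sf mul_polyC (leq_ltn_trans (size_scale_leq _ _)) // size_polyXn ltnS ltn_ord.
by rewrite mul_polyC coefZ coefXn mulr_natr eq_sym.
Qed.

(** When the coefficients of the monic [f] obey the weights, Euclidean division does
    not raise the weight. *)
Lemma wfil_rmodp (F : filtration A) D f P w :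
  f \is monic -> size f = n.+1 -> wfil F D (D * n)%N f -> wfil F D w P ->
  wfil F D w (rmodp P f).
Proof.
move=> fm sf hf; have [m] := ubnP (size P); elim: m P => // m IH P.
rewrite ltnS => hs hP.
have [h|h] := leqP (size f) (size P); last by rewrite rmodp_small.
have nz : P != 0 by rewrite -size_poly_gt0 (leq_trans _ h) // sf.
set d := ((size P).-1 - n)%N.
have e1 : ((size P).-1 = d + n)%N by rewrite /d subnK // -ltnS -sf (leq_trans h) // leqSpred.
set Q := (lead_coef P)%:P * 'X^d * f.
have lcP : lead_coef P != 0 by rewrite lead_coef_eq0.
have -> : rmodp P f = rmodp (P - Q) f.
  by rewrite rmodpB // /Q rmodp_mull // subr0.
have hQ : wfil F D w Q.
  move: (hP (size P).-1); rewrite -lead_coefE.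
  case: ifP => [hw hc|_ z]; last by rewrite z eqxx in lcP.
  have -> : (w = (w - D * (size P).-1) + (D * d + D * n))%N by rewrite e1; lia.
  rewrite /Q -mulrA; apply: filM; first exact: wfilC.
  by apply: filM => //; apply: fil_exp; apply: wfilX.
apply: IH; last by apply: filD => //; apply: filN.
have sQ : (size Q <= size P)%N.
  rewrite /Q -mulrA mul_polyC (leq_trans (size_scale_leq _ _)) //.
  by rewrite size_monicM ?monicXn ?monic_neq0 // size_polyXn sf -[size P]prednK ?size_poly_gt0 // e1 /= addnS.
have cQ : Q`_(size P).-1 = lead_coef P.
  by rewrite /Q -mulrA coefCM coefXnM e1 ltnNge leq_addr /= addKn
    -[n]/(n.+1.-1) -sf -lead_coefE (monicP fm) mulr1.
rewrite (leq_trans _ hs) // ltn_neqAle (leq_trans (size_polyD _ _)) ?size_polyN ?geq_max ?leqnn ?sQ // andbT.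
apply/eqP => sz; have : lead_coef (P - Q) = 0.
  by rewrite lead_coefE sz coefB cQ -lead_coefE subrr.
by move/eqP; rewrite lead_coef_eq0 => /eqP z; move: nz; rewrite -size_poly_gt0 -sz z size_poly0.
Qed.

(** In the Leibniz formula the entry [(i, j)] has weight at most [w + D i - D j], and
    the terms [D i] and [D j] cancel over a permutation. *)
Lemma fil_norm (F : filtration A) D f P w :
  f \is monic -> size f = n.+1 -> wfil F D (D * n)%N f -> wfil F D w P ->
  F (w * n)%N (norm f P).
Proof.
move=> fm sf hf hP; rewrite /norm /determinant; apply: fil_sum => s _.
have hN m : F 0 ((-1) ^+ m).
  by elim: m => [|m IH]; rewrite ?expr0 ?exprS; [apply: fil1 | apply: (@filM _ F 0 0) => //; apply: filN1].
rewrite -[(w * n)%N]add0n; apply: filM; first exact: hN.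
have hX (i : nat) : wfil F D (w + D * i)%N (rmodp (P * 'X^i) f).
  by apply: wfil_rmodp => //; apply: filM => //; apply: fil_exp; apply: wfilX.
have [ok|nok] := boolP [forall i : 'I_n, D * s i <= w + D * i]%N.
  have -> : (w * n = \sum_(i < n) (w + D * i - D * s i))%N.
    have : (\sum_(i < n) (w + D * i - D * s i) + \sum_(i < n) (D * s i) = w * n + \sum_(i < n) (D * i))%N.
      rewrite -big_split /=.
      under eq_bigr => i _ do rewrite subnK ?(forallP ok) //.
      by rewrite big_split /= sum_nat_const card_ord mulnC.
    rewrite -(reindex_inj (@perm_inj _ s) (P := xpredT) (F := fun i : 'I_n => (D * i)%N)) /= => h.
    by move/eqP: h; rewrite eqn_add2r => /eqP.
  apply: fil_prod => i; rewrite mxE; have := hX i (s i).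
  by rewrite (forallP ok).
have [i hi] : exists i : 'I_n, ~~ (D * s i <= w + D * i)%N.
  by apply/existsP; rewrite -negb_forall.
rewrite (bigD1 i) //= mxE; have := hX i (s i).
by rewrite (negPf hi) => ->; rewrite mul0r; apply: fil0.
Qed.
End Norm.

Lemma map_rmodp (A B : comNzRingType) (phi : {rmorphism A -> B}) (f P : {poly A}) :
  f \is monic -> map_poly phi (rmodp P f) = rmodp (map_poly phi P) (map_poly phi f).
Proof.
move=> fm; have fm' : map_poly phi f \is monic by apply: monic_map.
rewrite {2}(rdivp_eq fm P) rmorphD rmorphM /= rmodp_addl_mul_small //.
rewrite [X in (_ < X)%N]size_map_poly_id0; last by rewrite (monicP fm) rmorph1 oner_eq0.
apply: leq_ltn_trans (ltn_rmodpN0 P (monic_neq0 fm)).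
exact: size_poly.
Qed.

Lemma map_norm (A B : comNzRingType) (phi : {rmorphism A -> B}) n (f P : {poly A}) :
  f \is monic -> phi (norm n f P) = norm n (map_poly phi f) (map_poly phi P).
Proof.
move=> fm; rewrite /norm -det_map_mx; congr (\det _); apply/matrixP => i j.
by rewrite !mxE -coef_map map_rmodp // rmorphM /= map_polyXn.
Qed.

(** A singular matrix has a kernel over the fraction field, hence over the domain. *)
Lemma norm_eq0 (A : idomainType) n (f P : {poly A}) :
  f \is monic -> size f = n.+1 -> norm n f P = 0 ->
  exists Q w : {poly A}, [/\ Q != 0, (size Q <= n)%N & Q * P = w * f].
Proof.
move=> fm sf /eqP/det0P [v nzv h].
have [i hi] : exists i, v 0 i != 0.
  by apply/existsP; apply: contraNT nzv; rewrite negb_exists => /forallP h0;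
     apply/eqP/rowP => i; rewrite mxE; apply/eqP; move: (h0 i); rewrite negbK.
pose Q := \poly_(j < n) (if insub j is Some j' then v 0 j' else 0).
have EQ : Q = \sum_(j < n) (v 0 j)%:P * 'X^j.
  by rewrite /Q poly_def; apply: eq_bigr => j _; rewrite valK mul_polyC.
have e : rmodp (Q * P) f = 0.
  rewrite EQ mulr_suml rmodp_sum //; transitivity (\sum_(k < n) ((v *m mulmodmx n f P) 0 k)%:P * 'X^k).
    under eq_bigr => j _ do rewrite -mulrA mul_polyC rmodpZ // [_ * P]mulrC (rmodp_mulmodmx (n := n)) // scaler_sumr.
    rewrite exchange_big; apply: eq_bigr => k _; rewrite mxE rmorph_sum mulr_suml.
    by apply: eq_bigr => j _; rewrite mxE rmorphM -mul_polyC mulrA.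
  by rewrite big1 // => k _; rewrite h mxE mul0r.
exists Q, (rdivp (Q * P) f); split.
- apply: contraNneq hi => Q0; have := congr1 (fun p : {poly A} => p`_i) Q0.
  by rewrite coef0 coef_poly ltn_ord valK => ->.
- exact: size_poly.
- by rewrite {1}(rdivp_eq fm (Q * P)) e addr0.
Qed.

(** * Zeros of a norm and points of a curve *)

Section Multiplicity.
Variables (k : finFieldType) (n : nat).
Implicit Types f P : {poly {poly k}}.

Lemma horner_rmodp_dvd (pi : {poly k}) f P (Y : {poly k}) : f \is monic ->
  pi %| f.[Y] -> pi %| P.[Y] -> pi %| (Pdiv.CommonRing.rmodp P f).[Y].
Proof.
move=> fm hf; rewrite {1}(Pdiv.RingMonic.rdivp_eq fm P) hornerD hornerM dvdp_addr //.
exact: dvdp_mull.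
Qed.

(** Distinct branches through points above [x0] give, by a Vandermonde argument,
    independent factors of the norm, one for each branch. *)
Lemma norm_multiplicity f P (x0 : k) (ys : seq k) (Yf : k -> {poly k}) (m : nat) :
  f \is monic -> size f = n.+1 -> (n <= #|k|)%N -> uniq ys -> (size ys <= n)%N ->
  (forall y, y \in ys -> [/\ (Yf y).[x0] = y, ('X - x0%:P) ^+ m %| f.[Yf y]
       & ('X - x0%:P) ^+ m %| P.[Yf y]]) ->
  ('X - x0%:P) ^+ (m * size ys) %| norm n f P.
Proof.
move=> fm sf nk uy sy hY; set pi := 'X - x0%:P; set r := size ys.
pose zs := ys ++ take (n - r) [seq z <- enum k | z \notin ys].
have szs : size zs = n.
  rewrite size_cat size_takel ?subnKC //.
  have := count_predC (mem ys) (enum k); rewrite -cardE => e.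
  rewrite size_filter leq_subLR (leq_trans nk) // -e leq_add2r.
  rewrite -size_filter; apply: uniq_leq_size; first by rewrite filter_uniq // enum_uniq.
  by move=> z; rewrite mem_filter => /andP [].
have uzs : uniq zs.
  rewrite cat_uniq uy /=; apply/andP; split; last by apply: take_uniq; rewrite filter_uniq ?enum_uniq.
  by apply/hasPn => z /mem_take; rewrite mem_filter => /andP [].
pose col (i : 'I_n) : {poly k} := if (i < r)%N then Yf (nth 0 zs i) else (nth 0 zs i)%:P.
have nth_ys (i : 'I_n) : (i < r)%N -> nth 0 zs i \in ys.
  by move=> h; rewrite nth_cat h mem_nth.
have colx i : (col i).[x0] = nth 0 zs i.
  by rewrite /col; case: ifP => h; [case: (hY _ (nth_ys i h)) | rewrite hornerC].
pose V := Vandermonde n (\row_i col i).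
pose s := \row_(i < n) (if (i < r)%N then pi ^+ m else 1).
pose B := mulmodmx n f P.
have BV a i : (B *m V) a i = (Pdiv.CommonRing.rmodp (P * 'X^a) f).[col i].
  rewrite (@rmodp_mulmodmx _ n) // mxE horner_sum; apply: eq_bigr => j _.
  by rewrite !mxE hornerM hornerC hornerXn.
pose W := \matrix_(a, i) ((B *m V) a i %/ s 0 i).
have EW : B *m V = W *m diag_mx s.
  apply/matrixP => a i; rewrite mul_mx_diag [in RHS]mxE [W a i]mxE divpK // [s 0 i]mxE.
  case: ifP => h; last by rewrite dvd1p.
  have [_ h1 h2] := hY _ (nth_ys i h).
  rewrite BV /col h; apply: horner_rmodp_dvd => //.
  by rewrite hornerM dvdp_mulr.
have ds : \det (diag_mx s) = pi ^+ (m * r).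
  rewrite det_diag (eq_bigr (fun i : 'I_n => if (i < r)%N then pi ^+ m else 1)); last by move=> i _; rewrite mxE.
  rewrite -big_mkcond /= prodr_const -exprM; congr (_ ^+ (_ * _)).
  have winj : injective (widen_ord sy) by move=> i j /(congr1 val) /= h; apply: val_inj.
  rewrite -[RHS](card_ord r) -(card_codom winj).
  apply: eq_card => i; rewrite unfold_in; apply/idP/codomP => [h|[j ->]]; last exact: (ltn_ord j).
  by exists (Ordinal h); apply: val_inj.
have : pi ^+ (m * r) %| \det B * \det V.
  by rewrite -det_mulmx EW det_mulmx ds dvdp_mull.
rewrite Gauss_dvdpl // coprimep_expl // coprimep_sym coprimep_XsubC /root /V det_Vandermonde.
rewrite horner_prod prodf_seq_neq0; apply/allP => i _; apply/implyP => _.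
rewrite horner_prod prodf_seq_neq0; apply/allP => j _; apply/implyP => ij.
rewrite hornerD hornerN !mxE !colx subr_eq0 nth_uniq ?szs //.
by rewrite gtn_eqF.
Qed.

Lemma prod_XsubC_dvd (s : seq k) (e : k -> nat) (N : {poly k}) : uniq s ->
  (forall x, x \in s -> ('X - x%:P) ^+ e x %| N) ->
  \prod_(x <- s) ('X - x%:P) ^+ e x %| N.
Proof.
elim: s => [|x s IH] /=; first by rewrite big_nil dvd1p.
case/andP => xs us h; rewrite big_cons Gauss_dvdp.
  rewrite h ?mem_head // IH // => y ys; apply: h; by rewrite inE ys orbT.
rewrite coprimep_expl // coprimep_sym coprimep_XsubC /root horner_prod prodf_seq_neq0.
apply/allP => y ys /=; rewrite horner_exp hornerXsubC expf_neq0 // subr_eq0.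
by apply: contraNneq xs => ->.
Qed.

Definition degf (K : comNzRingType) : filtration {poly K} := wfil (fil_triv K) 1.

Lemma degfP (K : comNzRingType) d (p : {poly K}) : degf K d p <-> (size p <= d.+1)%N.
Proof.
split=> [h|h j].
  apply/leq_sizeP => j hj; move: (h j); rewrite mul1n leqNgt hj //.
by rewrite mul1n; case: leqP => // hj; rewrite nth_default // (leq_trans h).
Qed.

(** The norm of [P] vanishes at [x] to an order at least [m] times the number of
    points above [x], and its degree is at most [w n]. *)
Lemma point_bound f P D w m (pts : k -> seq k) (Yf : k -> k -> {poly k}) :
  f \is monic -> size f = n.+1 -> (n <= #|k|)%N ->
  wfil (degf k) D (D * n)%N f -> wfil (degf k) D w P -> norm n f P != 0 -> (0 < m)%N ->
  (forall x, uniq (pts x)) ->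
  (forall x y, y \in pts x -> [/\ (Yf x y).[x] = y, ('X - x%:P) ^+ m %| f.[Yf x y]
       & ('X - x%:P) ^+ m %| P.[Yf x y]]) ->
  (m * \sum_x size (pts x) <= w * n)%N.
Proof.
move=> fm sf nk hf hP nz m0 upts hY.
have /degfP sN := fil_norm fm sf hf hP.
have spts x : (size (pts x) <= n)%N.
  pose fx := map_poly (horner_eval x) f.
  have fxm : fx \is monic by apply: monic_map.
  have sfx : size fx = n.+1.
    by rewrite -sf size_map_poly_id0 // (monicP fm) rmorph1 oner_eq0.
  rewrite -ltnS -sfx; apply: max_poly_roots => //; first exact: monic_neq0.
  apply/allP => y hy; have [e1 e2 _] := hY x y hy.
  have -> : root fx y = ((f.[Yf x y]).[x] == 0).
    by rewrite /root -{1}e1 -[(Yf x y).[x]]/(horner_eval x _) horner_map.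
  have : 'X - x%:P %| f.[Yf x y].
    by apply: dvdp_trans e2; rewrite -[m]prednK // exprS dvdp_mulr.
  by rewrite dvdp_XsubCl.
have dv : \prod_(x <- enum k) ('X - x%:P) ^+ (m * size (pts x)) %| norm n f P.
  apply: prod_XsubC_dvd; first exact: enum_uniq.
  by move=> x _; apply: norm_multiplicity (hY x).
have := leq_trans (dvdp_leq nz dv) sN.
have -> : size (\prod_(x <- enum k) ('X - x%:P) ^+ (m * size (pts x))) = (\sum_x m * size (pts x)).+1.
  rewrite -[\sum_x _]big_enum /=; elim: (enum k) => [|x s IH].
    by rewrite !big_nil size_poly1.
  rewrite !big_cons size_monicM ?monic_exp ?monicXsubC //; last first.
    by rewrite monic_neq0 // monic_prod // => y _; rewrite monic_exp ?monicXsubC.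
  by rewrite IH size_exp_XsubC addnS.
by rewrite ltnS big_distrr.
Qed.
End Multiplicity.

(** * Taylor expansion and the local branches of a curve *)

Section Evaluation.
Variables (A S : comNzRingType) (j : {rmorphism A -> S}).

(** Substitution for the variable of [A[X]], the coefficients being carried to [S]. *)
Definition evx (X : S) : {poly A} -> S := horner_eval X \o map_poly j.
HB.instance Definition _ X := GRing.RMorphism.copy (evx X) (horner_eval X \o map_poly j).
Definition ev2 (X Y : S) : {poly {poly A}} -> S := horner_eval Y \o map_poly (evx X).
HB.instance Definition _ X Y := GRing.RMorphism.copy (ev2 X Y) (horner_eval Y \o map_poly (evx X)).

Lemma evxX X : evx X 'X = X.
Proof. by rewrite /evx /= map_polyX /horner_eval hornerX. Qed.
Lemma evxC X a : evx X a%:P = j a.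
Proof. by rewrite /evx /= map_polyC /horner_eval hornerC. Qed.
Lemma ev2Y X Y : ev2 X Y 'X = Y.
Proof. by rewrite /ev2 /= map_polyX /horner_eval hornerX. Qed.
Lemma ev2C X Y a : ev2 X Y a%:P = evx X a.
Proof. by rewrite /ev2 /= map_polyC /horner_eval hornerC. Qed.
End Evaluation.

Lemma ev2_morph (A S S' : comNzRingType) (j : {rmorphism A -> S}) (g : {rmorphism S -> S'})
  (j' : {rmorphism A -> S'}) X Y f : (forall a, g (j a) = j' a) ->
  g (ev2 j X Y f) = ev2 j' (g X) (g Y) f.
Proof.
move=> h; rewrite /ev2 /= /horner_eval -horner_map -map_poly_comp; congr (_.[_]).
apply: eq_map_poly => p; rewrite /= /evx /= /horner_eval -horner_map -map_poly_comp; congr (_.[_]).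
by apply: eq_map_poly => a /=.
Qed.

Lemma ev2_id (A : comNzRingType) (f : {poly {poly A}}) : ev2 (polyC \o polyC) 'X%:P 'X f = f.
Proof.
rewrite /ev2 /= /horner_eval -[RHS](comp_polyXr f) /comp_poly; congr (_.[_]).
apply: eq_map_poly => p; rewrite /evx /= /horner_eval map_poly_comp horner_map; congr (_%:P).
by rewrite -[RHS](comp_polyXr p) /comp_poly.
Qed.

Section Taylor.
Variables (S : comNzRingType) (F : filtration S).

Lemma taylor_exp (y h : S) wy wh i : F wy y -> F wh h ->
  exists r, F (i * (wy + wh))%N r /\ (y + h) ^+ i = y ^+ i + h * r.
Proof.
move=> hy hh; elim: i => [|i [r [hr e]]]; first by exists 0; split; [apply: fil0 | rewrite !expr0; ring].
exists (y ^+ i + r * (y + h)); split; last by rewrite exprSr e exprSr; ring.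
apply: filD; first by apply: filW (fil_exp i hy); rewrite mulnC; nia.
have -> : (i.+1 * (wy + wh) = i * (wy + wh) + (wy + wh))%N by nia.
by apply: filM => //; apply: filD; [apply: filW hy | apply: filW hh]; lia.
Qed.

Lemma taylor_exp2 (y h : S) wy wh i : F wy y -> F wh h ->
  exists r, F (i * (wy + wh))%N r /\ (y + h) ^+ i = y ^+ i + h * (i%:R * y ^+ i.-1) + h ^+ 2 * r.
Proof.
move=> hy hh; elim: i => [|i [r [hr e]]]; first by exists 0; split; [apply: fil0 | rewrite !expr0; ring].
exists (i%:R * y ^+ i.-1 + r * (y + h)); split; last first.
  rewrite [(y + h) ^+ i.+1]exprSr e [y ^+ i.+1]exprSr /=.
  have -> : i.+1%:R * y ^+ i = y ^+ i + i%:R * y ^+ i.-1 * y :> S.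
    by case: (i) => [|m]; rewrite ?mul0r -?natr1 ?mulrDl /= ?mul1r; [ring | rewrite exprSr; ring].
  ring.
apply: filD.
  rewrite -[(i.+1 * _)%N]add0n; apply: filM; first exact: fil_nat.
  by apply: filW (fil_exp i.-1 hy); rewrite mulnC; case: (i) => [|m] /=; nia.
have -> : (i.+1 * (wy + wh) = i * (wy + wh) + (wy + wh))%N by nia.
by apply: filM => //; apply: filD; [apply: filW hy | apply: filW hh]; lia.
Qed.

(** Taylor's formula to first order, with a degree bound for the remainder; the
    binomial expansion keeps it valid in every characteristic. *)
Lemma taylor1 (P : {poly S}) (y h : S) w wy wh : (forall i, F w P`_i) -> F wy y -> F wh h ->
  exists r, F (w + size P * (wy + wh))%N r /\ P.[y + h] = P.[y] + h * r.
Proof.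
move=> hP hy hh.
have /fin_all_exists [r hr] : forall i : 'I_(size P), exists r, F (i * (wy + wh))%N r /\ (y + h) ^+ i = y ^+ i + h * r.
  by move=> i; apply: taylor_exp.
exists (\sum_(i < size P) P`_i * r i); split.
  apply: fil_sum => i _; apply: filM => //; have [h1 _] := hr i; apply: filW h1.
  by rewrite leq_mul2r ltnW ?orbT.
rewrite !horner_coef mulr_sumr -big_split; apply: eq_bigr => i _ /=.
by have [_ ->] := hr i; ring.
Qed.

Lemma taylor2 (P : {poly S}) (y h : S) w wy wh : (forall i, F w P`_i) -> F wy y -> F wh h ->
  exists r, F (w + size P * (wy + wh))%N r /\ P.[y + h] = P.[y] + h * P^`().[y] + h ^+ 2 * r.
Proof.
move=> hP hy hh.
have /fin_all_exists [r hr] : forall i : 'I_(size P), exists r, F (i * (wy + wh))%N r /\ (y + h) ^+ i = y ^+ i + h * (i%:R * y ^+ i.-1) + h ^+ 2 * r.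
  by move=> i; apply: taylor_exp2.
exists (\sum_(i < size P) P`_i * r i); split.
  apply: fil_sum => i _; apply: filM => //; have [h1 _] := hr i; apply: filW h1.
  by rewrite leq_mul2r ltnW ?orbT.
have -> : P^`().[y] = \sum_(i < size P) P`_i * (i%:R * y ^+ i.-1).
  rewrite -{1}(coefK P) poly_def linear_sum horner_sum; apply: eq_bigr => i _.
  by rewrite /= derivZ derivXn hornerZ hornerMn hornerXn mulr_natl.
rewrite !horner_coef !mulr_sumr -!big_split; apply: eq_bigr => i _ /=.
by have [_ ->] := hr i; ring.
Qed.
End Taylor.

Definition totdeg2 (k : comNzRingType) : filtration {poly {poly k}} := wfil (degf k) 1.
Definition totdeg3 (k : comNzRingType) : filtration {poly {poly {poly k}}} := wfil (totdeg2 k) 1.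
(** The degree in the coefficients, the outer variable having weight zero. *)
Definition cof (A : comNzRingType) (F : filtration A) : filtration {poly A} := wfil F 0.

Lemma cofP (A : comNzRingType) (F : filtration A) d p : cof F d p <-> forall i, F d p`_i.
Proof.
by split=> h i; move: (h i); rewrite ?mul0n /= ?subn0.
Qed.

Lemma totdeg3_deriv (k : comNzRingType) d (g : {poly {poly {poly k}}}) : totdeg3 k d g -> totdeg3 k d g^`().
Proof.
move=> h i; rewrite coef_deriv mul1n; move: (h i.+1); rewrite !mul1n.
case: (leqP i.+1 d) => hi.
  rewrite (ltnW hi) => hg; rewrite -mulr_natr -[(d - i)%N]addn0.
  by apply: filM; [apply: filW hg; lia | apply: fil_nat].
by move=> ->; rewrite mul0rn; case: ifP => // _; apply: fil0.
Qed.

Definition emb3 (k : comNzRingType) : {rmorphism {poly k} -> {poly {poly {poly {poly k}}}}} :=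
  polyC \o (polyC \o polyC).

Section LocalParam.
Variables (k : comNzRingType) (n e : nat) (f : {poly {poly {poly k}}}).
Hypotheses (sf : (size f <= n.+1)%N) (hf : totdeg3 k e f).
Hypothesis sxf : forall i : nat, (size (f`_i)%R <= e.+1)%N.
Notation R3 := {poly {poly {poly k}}}.
Notation S := {poly R3}.
Local Notation j := (emb3 k).
Let x' : S := 'X%:P%:P.
Let y' : S := 'X%:P.
Let al : S := 'X.
Let de : S := (f^`())%:P.
Let F := cof (totdeg3 k).

Lemma ev2_gen (g : R3) : ev2 j x' y' g = g%:P.
Proof.
have -> : ev2 j x' y' g = ev2 j ('X%:P)%:P ('X)%:P g by [].
by rewrite -(@ev2_morph _ _ _ (polyC \o polyC) polyC) ?ev2_id.
Qed.

Lemma F_polyC d (g : R3) : totdeg3 k d g -> F d g%:P.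
Proof. exact: wfilC. Qed.

Lemma F_x : F 1 x'.
Proof. by apply/wfilC/wfilC; apply: wfilX. Qed.
Lemma F_y : F 1 y'.
Proof. by apply/wfilC; apply: wfilX. Qed.
Lemma F_al : F 0 al.
Proof. exact: wfilX. Qed.

Lemma F_de : F e de.
Proof. exact/F_polyC/totdeg3_deriv. Qed.

Lemma F_j d (a : {poly k}) : (size a <= d.+1)%N -> F d (j a).
Proof. by move=> h; apply/wfilC/wfilC/wfilC; apply/degfP. Qed.

Lemma fil_horner (P : {poly S}) w wy y : (forall i, F w P`_i) -> F wy y ->
  F (w + wy * size P)%N P.[y].
Proof.
move=> hP hy; rewrite horner_coef; apply: fil_sum => i _; apply: filM => //.
by apply: filW (fil_exp i hy); rewrite leq_mul2l ltnW ?orbT.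
Qed.

Lemma totdeg3_coef2 d (g : R3) i m : totdeg3 k d g -> (size ((g`_i)`_m)%R <= d.+1)%N.
Proof. by move=> hg; have := wfil_coef m (wfil_coef i hg); rewrite -/(degf k) => /degfP. Qed.

Lemma coef_evx_F (g : R3) w wx X d : totdeg3 k d g -> (forall i : nat, (size (g`_i)%R <= e.+1)%N) -> (d + wx * e.+1 <= w)%N ->
  F wx X -> forall i, F w (map_poly (evx j X) g)`_i.
Proof.
move=> hg sg hw hX i; rewrite coef_map /= /evx /= /horner_eval.
apply: (filW _ (fil_horner (w := d) _ hX)).
  apply: leq_trans hw; rewrite leq_add2l leq_mul2l; apply/orP; right.
  exact: leq_trans (size_poly _ _) (sg i).
move=> m; rewrite coef_map; apply: F_j.
exact: totdeg3_coef2.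
Qed.

Lemma ev2_taylor_x (g : R3) d X h Y wx wh wy :
  totdeg3 k d g -> (size g <= n.+1)%N -> (forall i : nat, (size (g`_i)%R <= e.+1)%N) -> F wx X -> F wh h -> F wy Y ->
  exists r, F (d + e.+1 * (wx + wh) + wy * n.+1)%N r /\ ev2 j (X + h) Y g = ev2 j X Y g + h * r.
Proof.
move=> hg sg sxg hX hh hY.
have hr (i : 'I_n.+1) : exists r, F (d + e.+1 * (wx + wh))%N r /\ evx j (X + h) g`_i = evx j X g`_i + h * r.
  have [|r [hr er]] := @taylor1 _ F (map_poly j g`_i) X h d wx wh _ hX hh.
    by move=> m; rewrite coef_map; apply: F_j; apply: totdeg3_coef2.
  exists r; split; last exact: er.
  by apply: filW hr; rewrite leq_add2l leq_mul2r; apply/orP; right; apply: leq_trans (size_poly _ _) (sxg i).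
have [r {}hr] := fin_all_exists hr.
exists (\sum_(i < n.+1) r i * Y ^+ i); split.
  apply: fil_sum => i _; apply: filM; first by case: (hr i).
  by apply: filW (fil_exp i hY); rewrite leq_mul2l ltnW ?orbT.
have E Z : ev2 j Z Y g = \sum_(i < n.+1) evx j Z g`_i * Y ^+ i.
  rewrite /ev2 /= /horner_eval (@horner_coef_wide _ n.+1) ?(leq_trans (size_poly _ _)) //.
  by apply: eq_bigr => i _; rewrite coef_map.
rewrite !E mulr_sumr -big_split; apply: eq_bigr => i _ /=.
by have [_ ->] := hr i; ring.
Qed.

Lemma ev2_taylor_y (g : R3) d X h Y wx wh wy :
  totdeg3 k d g -> (size g <= n.+1)%N -> (forall i : nat, (size (g`_i)%R <= e.+1)%N) -> F wx X -> F wh h -> F wy Y ->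
  exists r, F (d + wx * e.+1 + n.+1 * (wy + wh))%N r /\
  ev2 j X (Y + h) g = ev2 j X Y g + h * r.
Proof.
move=> hg sg sxg hX hh hY.
have [|r [hr er]] := @taylor1 _ F (map_poly (evx j X) g) Y h (d + wx * e.+1)%N wy wh _ hY hh.
  by apply: coef_evx_F hg sxg _ hX.
exists r; split => //; apply: filW hr.
by rewrite leq_add2l leq_mul2r; apply/orP; right; apply: leq_trans (size_poly _ _) sg.
Qed.

Lemma ev2_taylor_y2 (g : R3) d X h Y wx wh wy :
  totdeg3 k d g -> (size g <= n.+1)%N -> (forall i : nat, (size (g`_i)%R <= e.+1)%N) -> F wx X -> F wh h -> F wy Y ->
  exists r, F (d + wx * e.+1 + n.+1 * (wy + wh))%N r /\
  ev2 j X (Y + h) g = ev2 j X Y g + h * ev2 j X Y g^`() + h ^+ 2 * r.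
Proof.
move=> hg sg sxg hX hh hY.
have [|r [hr er]] := @taylor2 _ F (map_poly (evx j X) g) Y h (d + wx * e.+1)%N wy wh _ hY hh.
  by apply: coef_evx_F hg sxg _ hX.
exists r; split; last by rewrite /ev2 /= /horner_eval er deriv_map.
apply: filW hr.
by rewrite leq_add2l leq_mul2r; apply/orP; right; apply: leq_trans (size_poly _ _) sg.
Qed.

Let X := x' + al * de ^+ 2.

(** A degree bound for the [m]-th approximation of a branch. It is built from
    the degrees alone, so the final constants do not involve the field. *)
Fixpoint branch_weight (m : nat) : nat := if m is m'.+1 then
   let W := branch_weight m' in
   (W + ((e + e.+1 * (1 + e * 2) + (1 + e + W) * n.+1) + e + W + (e + 1 * e.+1 + n.+1 * (1 + e + W)) + W)
      + (W + W + (e + (1 + e * 2) * e.+1 + n.+1 * (1 + e + W + (e + W)))))%N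
  else (e + e.+1 * (1 + e * 2) + 1 * n.+1)%N.

Lemma F_X : F (1 + e * 2)%N X.
Proof.
apply: filD; first by apply: filW F_x; lia.
by rewrite -[(1 + _)%N]/(0 + (1 + e * 2))%N; apply: filM F_al _; apply: filW (fil_exp 2 F_de); lia.
Qed.

(** Newton's iteration, free of denominators. With [de] the derivative of [f] in [y],
    the point [(x + al de ^ 2, y + de (al Z))] stays on the curve up to
    [de ^ 2 al ^ m.+1]: linearizing at this point costs one factor [de], and the
    two factors [de] in the increment of [x] pay for it. *)
Lemma local_param m : exists Z g : S, [/\ F (branch_weight m) Z, F (branch_weight m) g &
  ev2 j X (y' + de * (al * Z)) f = f%:P + de ^+ 2 * al ^+ m.+1 * g].
Proof.
have hdd : F (e * 2)%N (al * de ^+ 2).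
  by rewrite -[(e * 2)%N]add0n; apply: filM F_al _; exact: (fil_exp 2 F_de).
elim: m => [|m [Z [g [hZ hg eq]]]].
  have [r [hr er]] := ev2_taylor_x hf sf sxf F_x hdd F_y.
  exists 0, r; split => //; first exact: fil0.
  by rewrite !mulr0 addr0 er ev2_gen expr1; ring.
set W := branch_weight m in hZ hg *.
have sf' : (size f^`() <= n.+1)%N.
  apply: leq_trans sf; case: (eqVneq f 0) => [->|nz]; first by rewrite deriv0.
  exact/ltnW/lt_size_deriv.
have sxf' (i : nat) : (size ((f^`())`_i)%R <= e.+1)%N.
  rewrite coef_deriv; apply: leq_trans (sxf i.+1); rewrite -scaler_nat; exact: size_scale_leq.
set Y := y' + de * (al * Z) in eq *.
have hY : F (1 + e + W)%N Y.
  apply: filD; first by apply: filW F_y; lia.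
  rewrite -addnA addnC -addnA; apply: filM F_de _; rewrite addnC -[(1 + W)%N]/(0 + (1 + W))%N; apply: filM F_al _.
  by apply: filW hZ; lia.
set h := - (de * (al ^+ m.+1 * g)).
have hal i : F 0 (al ^+ i) by apply: filW (fil_exp i F_al).
have hh : F (e + W)%N h.
  by apply: filN; apply: filM F_de _; rewrite -[W]add0n; apply: filM.
have [r2 [hr2 er2]] := ev2_taylor_y2 hf sf sxf F_X hh hY.
have [r3 [hr3 er3]] := ev2_taylor_x (totdeg3_deriv hf) sf' sxf' F_x hdd hY.
have hdz : F (e + W)%N (de * (al * Z)).
  by apply: filM F_de _; rewrite -[W]add0n; apply: filM F_al _.
have [r4 [hr4 er4]] := ev2_taylor_y (totdeg3_deriv hf) sf' sxf' F_x hdz F_y.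
set s := de * r3 + Z * r4.
exists (Z - al ^+ m * g), (- (g * s) + al ^+ m * (g ^+ 2 * r2)); split.
- apply: filD; first by apply: filW hZ; rewrite /= -/W; lia.
  by apply: filN; apply: (@filW _ F (0 + W)%N); [rewrite /= -/W; lia | apply: filM].
- apply: filD.
    apply: filN; apply: (@filW _ F (W + ((e + e.+1 * (1 + e * 2) + (1 + e + W) * n.+1) + e + W + (e + 1 * e.+1 + n.+1 * (1 + e + W))))%N).
      by rewrite /= -/W; lia.
    apply: filM => //; apply: filD.
      by apply: (@filW _ F (e + (e + e.+1 * (1 + e * 2) + (1 + e + W) * n.+1))%N); [lia | apply: filM F_de hr3].
    apply: (@filW _ F (W + (e + 1 * e.+1 + n.+1 * (1 + (e + W))))%N); last by apply: filM.
    by lia.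
  apply: (@filW _ F (0 + (W * 2 + (e + (1 + e * 2) * e.+1 + n.+1 * (1 + e + W + (e + W)))))%N); last first.
    by apply: filM => //; apply: filM => //; apply: fil_exp.
  by rewrite /= -/W; lia.
have -> : y' + de * (al * (Z - al ^+ m * g)) = Y + h by rewrite /Y /h exprS; ring.
rewrite er2 eq er3 er4 ev2_gen -/de.
have -> : de + de * (al * Z) * r4 + al * de ^+ 2 * r3 = de * (1 + al * s) by rewrite /s; ring.
rewrite /h [al ^+ m.+2]exprS [al ^+ m.+1]exprS; ring.
Qed.
End LocalParam.

(** * The auxiliary polynomial *)

Lemma rmodp_polyC_mul (A : comNzRingType) (c : A) (p f : {poly A}) : f \is monic ->
  Pdiv.CommonRing.rmodp (c%:P * p) f = c%:P * Pdiv.CommonRing.rmodp p f.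
Proof. by move=> fm; rewrite !mul_polyC Pdiv.RingMonic.rmodpZ. Qed.

Lemma coef_linear_exp (A : comNzRingType) (c d : A) a s :
  ((c%:P + 'X * d%:P) ^+ a)`_s = ('C(a, s)%:R * c ^+ (a - s) * d ^+ s) *+ (s <= a)%N.
Proof.
have ET (v : 'I_a.+1) : ((c%:P ^+ (a - v) * ('X * d%:P) ^+ v) *+ 'C(a, v))`_s =
     ('C(a, v)%:R * c ^+ (a - v) * d ^+ v) *+ ((s : nat) == v).
  have -> : c%:P ^+ (a - v) * ('X * d%:P) ^+ v = (c ^+ (a - v) * d ^+ v)%:P * 'X ^+ v.
    by rewrite polyCM !polyC_exp exprMn; ring.
  rewrite coefMn coefCM coefXn; case: (_ == _); rewrite ?mulr1 ?mulr0 ?mul0rn ?mulr0n //.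
  by rewrite mulr1n -mulrA mulr_natl.
rewrite exprDn coef_sum (eq_bigr _ (fun v _ => ET v)).
have [sa|sa] := leqP s a; last first.
  rewrite big1 ?mulr0n // => v _; rewrite gtn_eqF ?mulr0n //; exact: leq_trans (ltn_ord v) sa.
rewrite (bigD1 (Ordinal (sa : s < a.+1)%N)) //= eqxx mulr1n big1 ?addr0 //.
by move=> v; rewrite -val_eqE /= eq_sym => /negPf ->; rewrite mulr0n.
Qed.

Definition emb4 (k : comNzRingType) : {rmorphism k -> {poly {poly {poly {poly k}}}}} :=
  polyC \o (polyC \o (polyC \o polyC)).

Section AuxiliaryPolynomial.
Variables (k : finFieldType) (T l n m : nat).

(** Exponents of [gamma], [x], [y], [x'] and [y'], in this order. *)
Definition idx : finType := ('I_T * 'I_l * 'I_n * 'I_m * 'I_n)%type.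
Definition aux := {ffun idx -> k}.

Definition monE (S : comNzRingType) (g x y x' y' : S) (u : idx) : S :=
  let: (t, a, i, b, j) := u in g ^+ t * x ^+ a * y ^+ i * x' ^+ b * y' ^+ j.

(** The auxiliary polynomial evaluated at arbitrary elements of a ring. *)
Definition evE (S : comNzRingType) (c : k -> S) (g x y x' y' : S) (E : aux) : S :=
  \sum_u c (E u) * monE g x y x' y' u.

Lemma evE_morph (S S' : comNzRingType) (h : {rmorphism S -> S'}) (c : k -> S) (c' : k -> S')
  g x y x' y' E : (forall a, h (c a) = c' a) ->
  h (evE c g x y x' y' E) = evE c' (h g) (h x) (h y) (h x') (h y') E.
Proof.
move=> hc; rewrite /evE rmorph_sum; apply: eq_bigr => -[[[[t a] i] b] j] _.
by rewrite rmorphM /= hc !rmorphM !rmorphXn.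
Qed.

Lemma evEB (S : comNzRingType) (c : {rmorphism k -> S}) g x y x' y' (E E' : aux) :
  evE c g x y x' y' [ffun u => E u - E' u] = evE c g x y x' y' E - evE c g x y x' y' E'.
Proof.
rewrite /evE -sumrB; apply: eq_bigr => u _.
by rewrite ffunE rmorphB mulrBl.
Qed.

Notation R3 := {poly {poly {poly k}}}.
Notation S := {poly R3}.
Variables (e M W : nat) (f : R3) (Z : S).
Hypotheses (fm : f \is monic) (sf : size f = n.+1) (hf : totdeg3 k e f).
Hypothesis hf2 : forall i : nat, totdeg2 k e (f`_i).
Hypothesis hZ : cof (totdeg3 k) W Z.
Local Notation x' := ('X%:P%:P : S).
Local Notation y' := ('X%:P : S).
Local Notation de := ((f^`())%:P : S).
Local Notation X := (x' + 'X * de ^+ 2).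
Local Notation Y := (y' + de * ('X * Z)).
Local Notation gam := ('X%:P%:P%:P : S).
Local Notation c4 := (emb4 k).
Let F := cof (totdeg3 k).

Let W2 := (M * (e * 2) + n * (1 + e + W) + n)%N.
Let W' := (W2 * e.+1)%N.

Lemma red_kappa (q : R3) : totdeg3 k W2 q ->
  forall j i : nat, (size ((Pdiv.CommonRing.rmodp q f)`_j)%R <= W'.+1)%N /\
   (size (((Pdiv.CommonRing.rmodp q f)`_j)`_i)%R <= W'.+1)%N.
Proof.
move=> hq.
have h1 : wfil (totdeg2 k) e (e * n)%N f.
  move=> j; case: ifP => h.
    have [jn|jn|->] := ltngtP j n.
    - by apply: filW (hf2 j); rewrite -mulnBr -{1}[e]muln1 leq_mul2l subn_gt0 jn orbT.
    - by rewrite nth_default ?sf //; apply: fil0.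
    - by rewrite -[n]/(n.+1.-1) -sf -lead_coefE (monicP fm); apply: fil1.
  rewrite nth_default // sf ltnNge; apply/negP => jn; move/negP: h; apply.
  by rewrite leq_mul2l jn orbT.
have h2 : wfil (totdeg2 k) e W' q.
  move=> j; move: (hq j); rewrite mul1n; case: leqP => hj h.
    have -> : (e * j <= W')%N by rewrite /W'; nia.
    by apply: filW h; rewrite /W'; nia.
  by rewrite h; case: ifP => // _; apply: fil0.
have h3 := wfil_rmodp fm sf h1 h2.
move=> j i; have /= h4 := wfil_coef j h3; split; last first.
  have /= := wfil_coef i h4. by move/degfP.
apply/leq_sizeP => i' hi'; move: (h4 i'); rewrite mul1n leqNgt hi' //.
Qed.

Lemma coef_monE (u : idx) (r : nat) : (r < M)%N -> exists q : nat -> R3,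
   (forall s, totdeg3 k W2 (q s)) /\
   (monE gam X Y x' y' u)`_r = let: (t, a, i, b, j) := u in
     \sum_(s < r.+1) (('X ^+ t)%:P * 'X ^+ (b + (a - s)))%:P * q s.
Proof.
move: u => [[[[t a] i] b] j] hr; cbv beta iota delta [monE].
have hY : F (1 + e + W)%N Y.
  apply: filD; first by apply: filW (F_y k); lia.
  rewrite -addnA addnC -addnA; apply: filM; first exact: (F_de hf).
  rewrite addnC -[(1 + W)%N]/(0 + (1 + W))%N; apply: filM; first exact: F_al.
  by apply: filW hZ; lia.
exists (fun s => (('C(a, s))%:R * (f^`()) ^+ 2 ^+ s * (Y ^+ i)`_(r - s) * 'X ^+ j) *+ (s <= minn a r)%N).
split=> [s|].
  case: (leqP s (minn a r)) => hs; last by rewrite mulr0n; exact: (fil0 (totdeg3 k)).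
  rewrite mulr1n; apply: filM; last first.
    apply: filW (fil_exp j (wfilX (totdeg2 k) 1)); rewrite mul1n; exact/ltnW.
  apply: filM; last first.
    have /cofP := fil_exp i hY; move/(_ (r - s)%N); apply: filW.
    by rewrite mulnC leq_mul2r ltnW ?orbT.
  rewrite -[(M * _)%N]add0n; apply: filM; first exact: fil_nat.
  have hd := totdeg3_deriv hf; apply: filW (fil_exp s (fil_exp 2 hd)).
  rewrite mulnC leq_mul2r; apply/orP; right; rewrite ltnW //; lia.
have -> : gam ^+ t * X ^+ a * Y ^+ i * x' ^+ b * y' ^+ j =
   (('X ^+ t)%:P * 'X ^+ b)%:P%:P * ('X ^+ j)%:P * (X ^+ a * Y ^+ i).
  by rewrite !(rmorphM, rmorphXn) /=; ring.
rewrite -rmorphM /= coefCM coefM mulr_sumr; apply: eq_bigr => s _.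
have -> : (X ^+ a)`_s = ('C(a, s)%:R * 'X%:P ^+ (a - s) * f^`() ^+ 2 ^+ s) *+ (s <= a)%N.
  by rewrite -[(f^`())%:P ^+ 2]polyC_exp coef_linear_exp.
have -> : (s <= minn a r)%N = (s <= a)%N by rewrite leq_min andb_idr // => _; rewrite -ltnS ltn_ord.
case: (s <= a)%N; rewrite ?mulr0n ?mul0r ?mulr0 // !mulr1n exprD !(rmorphM, rmorphXn) /=; ring.
Qed.

Let X1 := (l + m + W'.+1)%N.
Let T1 := (T + W'.+1)%N.

Lemma rmodp_monE (u : idx) (r : nat) : (r < M)%N ->
  let P := Pdiv.CommonRing.rmodp ((monE gam X Y x' y' u)`_r) f in
  forall j i : nat, (size (P`_j)%R <= X1)%N /\ (size ((P`_j)`_i)%R <= T1)%N.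
Proof.
move=> hr; case: u => [[[[t a] i0] b] j0] P j i.
have [q [hq e1]] := coef_monE (t, a, i0, b, j0) hr.
have EP : P = \sum_(s < r.+1) (('X ^+ t)%:P * 'X ^+ (b + (a - s)))%:P * Pdiv.CommonRing.rmodp (q s) f.
  rewrite /P e1 Pdiv.RingMonic.rmodp_sum //; apply: eq_bigr => s _.
  exact: rmodp_polyC_mul.
rewrite EP !coef_sum; split.
  apply: leq_trans (size_sum _ _ _) _; apply/bigmax_leqP => s _.
  rewrite coefCM -mulrA mul_polyC (leq_trans (size_scale_leq _ _)) // mulrC.
  apply: leq_trans (size_polyMleq _ _) _.
  rewrite size_polyXn; have [h _] := red_kappa (hq s) j 0.
  have aux1 z a1 b1 s1 w : (z <= w.+1 -> a1 < l -> b1 < m ->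
    (z + (b1 + (a1 - s1)).+1).-1 <= l + m + w.+1)%N by clear; lia.
  exact: aux1.
apply: leq_trans (size_sum _ _ _) _; apply/bigmax_leqP => s _.
rewrite coefCM -mulrA coefCM mulrC.
apply: leq_trans (size_polyMleq _ _) _; rewrite size_polyXn.
rewrite coefXnM; have [_ h] := red_kappa (hq s) j (i - (b + (a - s))).
have aux2 z t1 w : (z <= w.+1 -> t1 < T -> (z + t1.+1).-1 <= T + w.+1)%N by clear; lia.
by apply: aux2 => //; case: ifP => // _; rewrite size_poly0.
Qed.

(** Vanishing to order [M] along the generic branch, modulo [f], is a linear system
    in the coefficients of [E]. There are fewer equations than unknowns, so two
    choices of coefficients give the same values and their difference is the solution. *)
Lemma exists_aux : (M * (n * (X1 * T1)) < T * l * n * m * n)%N ->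
  exists2 E : aux, (exists u, E u != 0) & forall r, (r < M)%N ->
    Pdiv.CommonRing.rmodp ((evE c4 gam X Y x' y' E)`_r) f = 0.
Proof.
move=> hcard.
pose red (E : aux) r := Pdiv.CommonRing.rmodp ((evE c4 gam X Y x' y' E)`_r) f.
pose cond (E : aux) : {ffun 'I_M * ('I_n * ('I_X1 * 'I_T1)) -> k} :=
  [ffun v : ('I_M * ('I_n * ('I_X1 * 'I_T1)))%type => (((red E v.1)`_v.2.1)`_v.2.2.1)`_v.2.2.2].
have redB (E E' : aux) r : red [ffun u => E u - E' u] r = red E r - red E' r.
  by rewrite /red evEB coefB Pdiv.RingMonic.rmodpB.
have redE E r : red E r = \sum_u (E u)%:P%:P *: Pdiv.CommonRing.rmodp ((monE gam X Y x' y' u)`_r) f.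
  rewrite /red /evE coef_sum Pdiv.RingMonic.rmodp_sum //; apply: eq_bigr => u _.
  by rewrite coefCM mul_polyC Pdiv.RingMonic.rmodpZ.
have redP E r : Pdiv.CommonRing.rmodp ((evE c4 gam X Y x' y' E)`_r) f = red E r by [].
have sred E r : (size (red E r) <= n)%N.
  by rewrite -ltnS -sf; apply: Pdiv.CommonRing.ltn_rmodpN0; exact: monic_neq0.
have s1 E r : (r < M)%N -> forall j i : nat,
    (size ((red E r)`_j)%R <= X1)%N /\ (size (((red E r)`_j)`_i)%R <= T1)%N.
  move=> hr j i; rewrite redE; clear redE redP redB sred cond red.
  rewrite !coef_sum; split; apply: leq_trans (size_sum _ _ _) _; apply/bigmax_leqP => u _;
    have := rmodp_monE u hr; move: (Pdiv.CommonRing.rmodp _ _) => Q /(_ j i) [h1 h2].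
    by rewrite coefZ mul_polyC (leq_trans (size_scale_leq _ _)).
  by rewrite coefZ coefCM mul_polyC (leq_trans (size_scale_leq _ _)).
have condE E (r : 'I_M) (j : 'I_n) (x : 'I_X1) (t : 'I_T1) :
    cond E (r, (j, (x, t))) = (((red E r)`_j)`_x)`_t by rewrite ffunE.
clearbody cond; clear redE.
have /injectivePn [E [E' nE e0]] : ~~ injectiveb cond.
  apply/negP => /injectiveP inj; have := leq_card _ inj.
  rewrite !card_ffun !card_prod !card_ord leq_exp2l; last exact: card_finNzRing_gt1.
  by rewrite leqNgt; move: hcard; rewrite /X1 /T1 => ->.
exists [ffun u => E u - E' u].
  have [u hu] : exists u, E u != E' u.
    by apply/existsP; apply: contraNT nE; rewrite negb_exists => /forallP h; apply/eqP/ffunP => u; apply/eqP; move: (h u); rewrite negbK.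
  by exists u; rewrite ffunE subr_eq0.
move=> r hr; rewrite redP; clear redP; clearbody red; clearbody X1 T1.
have c0 (j : 'I_n) (x : 'I_X1) (t : 'I_T1) :
    (((red [ffun u => E u - E' u] r)`_j)`_x)`_t = 0.
  rewrite redB !coefB; have := condE E (Ordinal hr) j x t; rewrite e0 condE /= => ->.
  by rewrite subrr.
move: (sred [ffun u => E u - E' u] r) (s1 [ffun u => E u - E' u] r hr) c0.
move: (red _ r) => P {}sred {}s1 c0; clear redB condE e0.
apply/polyP => j; rewrite coef0; have [hj|hj] := ltnP j n; last by rewrite nth_default // (leq_trans sred).
apply/polyP => i; rewrite coef0; have [hi|hi] := ltnP i X1; last first.
  by rewrite nth_default // (leq_trans _ hi) //; have [] := s1 j i.
apply/polyP => t; rewrite coef0; have [ht|ht] := ltnP t T1; last first.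
  by rewrite nth_default // (leq_trans _ ht) //; have [] := s1 j i.
exact: (c0 (Ordinal hj) (Ordinal hi) (Ordinal ht)).
Qed.
End AuxiliaryPolynomial.

(** * Stepanov's bound for a family of curves *)

Section Frobenius.
Variables (k : finFieldType) (S : comNzRingType) (j : {rmorphism k -> S}).

(** [S] has the characteristic of [k], whatever its size. *)
Lemma frobB (x y : S) : (x - y) ^+ #|k| = x ^+ #|k| - y ^+ #|k|.
Proof.
have [p pp pc] := finPcharP k.
have cq : [pchar S].-nat #|k|.
  rewrite (card_pprimeChar pc) pnatX pnatE //; apply/orP; left.
  exact: (rmorph_pchar j pc).
have D (a b : S) : (a + b) ^+ #|k| = a ^+ #|k| + b ^+ #|k| by apply: exprDn_pchar.
have N (a : S) : (- a) ^+ #|k| = - a ^+ #|k|.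
  have := D (- a) a; rewrite addNr expr0n gtn_eqF; last exact: ltnW (card_finNzRing_gt1 k).
  by move=> h; apply/eqP; rewrite -addr_eq0 -h.
by rewrite D N.
Qed.
End Frobenius.

Section Specialization.
Variables (k : finFieldType).
Notation R3 := {poly {poly {poly k}}}.
Implicit Types (f : R3).
Let q := #|k|.

Definition fspec (c : k) f : {poly {poly k}} := map_poly (map_poly (horner_eval c)) f.
Definition fpt (c x y : k) : R3 -> k := ev2 (horner_eval c) x y.
HB.instance Definition _ c x y := GRing.RMorphism.copy (fpt c x y) (ev2 (horner_eval c) x y).
(** Only the points where the curve is smooth over the [x]-line carry a branch. *)
Definition pts (c : k) f (x : k) : seq k :=
  [seq y <- enum k | (fpt c x y f == 0) && (fpt c x y f^`() != 0)].
(** On rational points [x' = x ^ q] and [y' = y ^ q] agree with [x] and [y]. *)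
Definition Phi T l n m (c : k) (E : aux k T l n m) : {poly {poly k}} :=
  evE (polyC \o polyC) c%:P%:P 'X%:P 'X ('X ^+ q)%:P ('X ^+ q) E.

Lemma fspec_horner c f (Y : {poly k}) : (fspec c f).[Y] = ev2 (polyC \o horner_eval c) 'X Y f.
Proof.
rewrite /ev2 /= /horner_eval /fspec; congr (_.[_]); apply: eq_map_poly => p.
rewrite /evx /= /horner_eval map_poly_comp -[LHS](comp_polyXr _) /comp_poly.
by [].
Qed.

Variables (n e M W : nat) (f : R3) (Z g : {poly R3}).
Hypotheses (fm : f \is monic) (M0 : (0 < M)%N) (Mq : (M <= q)%N).
Variables (T l m : nat) (E : aux k T l n m).
Notation S := {poly R3}.
Local Notation x' := ('X%:P%:P : S).
Local Notation y' := ('X%:P : S).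
Local Notation de := ((f^`())%:P : S).
Local Notation X := (x' + 'X * de ^+ 2).
Local Notation Y := (y' + de * ('X * Z)).
Local Notation gam := ('X%:P%:P%:P : S).
Hypothesis Zg : ev2 (emb3 k) X Y f = f%:P + de ^+ 2 * 'X ^+ M * g.
Hypothesis hE : forall r, (r < M)%N ->
    Pdiv.CommonRing.rmodp ((evE (emb4 k) gam X Y x' y' E)`_r) f = 0.

Lemma evE_congr (c : k) (pi Y0 X1 X2 Y1 Y2 : {poly k}) : pi %| X1 - X2 -> pi %| Y1 - Y2 ->
  pi %| evE polyC c%:P 'X Y0 X1 Y1 E - evE polyC c%:P 'X Y0 X2 Y2 E.
Proof.
move=> hX hY; rewrite /evE -sumrB; elim/big_ind: _ => [|a b|[[[[t a] i] b] j] _]; [exact: dvdp0 | exact: dvdp_add |].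
rewrite /= -mulrBr dvdp_mull //.
have -> : c%:P ^+ t * 'X ^+ a * Y0 ^+ i * X1 ^+ b * Y1 ^+ j - c%:P ^+ t * 'X ^+ a * Y0 ^+ i * X2 ^+ b * Y2 ^+ j
 = c%:P ^+ t * 'X ^+ a * Y0 ^+ i * (X1 ^+ b * (Y1 ^+ j - Y2 ^+ j) + (X1 ^+ b - X2 ^+ b) * Y2 ^+ j) by ring.
rewrite dvdp_mull // dvdp_add //; first by rewrite dvdp_mull // subrXX dvdp_mulr.
by rewrite dvdp_mulr // subrXX dvdp_mulr.
Qed.

(** Specializing the generic branch at a smooth point: [de] becomes a nonzero scalar,
    and [al] is chosen so that the abscissa is [x].  The functions [x ^ q] and
    [y ^ q] are constant along the branch up to order [q], which exceeds [M]. *)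
Lemma branch (c x0 y0 : k) : y0 \in pts c f x0 -> exists Yf : {poly k},
  [/\ Yf.[x0] = y0, ('X - x0%:P) ^+ M %| (fspec c f).[Yf] & ('X - x0%:P) ^+ M %| (Phi c E).[Yf]].
Proof.
rewrite mem_filter => /andP [/andP [/eqP f0 d0] _].
set d := fpt c x0 y0 f^`() in d0.
pose A := (d ^- 2)%:P * ('X - x0%:P).
pose h : {rmorphism S -> {poly k}} := evx (polyC \o fpt c x0 y0) A.
have hal : h 'X = A by rewrite /h /= evxX.
have hC a : h a%:P = (fpt c x0 y0 a)%:P by rewrite /h /= evxC.
have hx' : h x' = x0%:P by rewrite hC /fpt /= ev2C evxX.
have hy' : h y' = y0%:P by rewrite hC /fpt /= ev2Y.
have hde : h de = d%:P by rewrite hC.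
have hX : h X = 'X.
  rewrite rmorphD rmorphM rmorphXn /= hx' hal hde /A -polyC_exp mulrC mulrA -polyCM.
  by rewrite divff ?expf_neq0 // mul1r addrC subrK.
set Yf := h Y.
have eY : Yf = y0%:P + d%:P * (A * h Z) by rewrite /Yf rmorphD !rmorphM /= hy' hde hal.
have dvA B : 'X - x0%:P %| A * B by rewrite /A -mulrA dvdp_mull // dvdp_mulr.
have Yx0 : Yf.[x0] = y0.
  by rewrite eY hornerD !hornerM hornerC hornerXsubC subrr !(mul0r, mulr0) addr0.
have dvAM B : ('X - x0%:P) ^+ M %| A ^+ M * B.
  by rewrite /A exprMn -mulrA dvdp_mull // dvdp_mulr.
exists Yf; split => //.
  have -> : (fspec c f).[Yf] = A ^+ M * h (de ^+ 2 * g); last exact: dvAM.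
  transitivity (h (ev2 (emb3 k) X Y f)).
    rewrite fspec_horner (@ev2_morph _ _ _ (emb3 k) h (polyC \o horner_eval c)) ?hX // => a.
    by rewrite [emb3 k a]/(a%:P%:P%:P) hC /fpt /= ev2C evxC.
  rewrite Zg (_ : de ^+ 2 * 'X ^+ M * g = 'X ^+ M * (de ^+ 2 * g)); last by rewrite mulrCA mulrA.
  by rewrite (rmorphD h) hC f0 add0r (rmorphM h) (rmorphXn h) hal.
have -> : (Phi c E).[Yf] = evE polyC c%:P 'X Yf ('X ^+ q) (Yf ^+ q) E.
  rewrite -[LHS]/(horner_eval Yf _) /Phi (evE_morph (h := horner_eval Yf) (c' := polyC)) => [|a]; last by exact: hornerC.
  by congr (evE _ _ _ _ _ _ _); [exact: hornerC | exact: hornerC | exact: hornerX | exact: hornerC | exact: hornerXn].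
have -> : evE polyC c%:P 'X Yf ('X ^+ q) (Yf ^+ q) E =
  evE polyC c%:P 'X Yf x0%:P y0%:P E + (evE polyC c%:P 'X Yf ('X ^+ q) (Yf ^+ q) E - evE polyC c%:P 'X Yf x0%:P y0%:P E).
  by rewrite addrC subrK.
have xq (x : k) : x = x ^+ q by rewrite expf_card.
rewrite dvdp_add //; last first.
  apply: evE_congr.
    rewrite {2}(xq x0) polyC_exp -(frobB polyC); exact: dvdp_exp2l.
  rewrite (xq y0) polyC_exp -(frobB polyC).
  apply: dvdp_trans (dvdp_exp2l _ Mq) _; apply: dvdp_exp2r.
  by rewrite eY addrAC subrr add0r dvdp_mull.
set P := evE (emb4 k) gam X Y x' y' E.
have -> : evE polyC c%:P 'X Yf x0%:P y0%:P E = h P.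
  have hgam : h gam = c%:P.
    by rewrite hC /fpt /= ev2C evxC; congr (_%:P); exact: hornerX.
  rewrite /P (evE_morph (h := h) (c' := polyC)) => [|a]; last first.
    by rewrite [emb4 k a]/(a%:P%:P%:P%:P) hC /fpt /= ev2C evxC; congr (_%:P); exact: hornerC.
  by rewrite hX hx' hy' hgam.
have -> : h P = (map_poly (polyC \o fpt c x0 y0) P).[A] by [].
set P' := map_poly _ P.
have P'0 : take_poly M P' = 0.
  apply/polyP => r; rewrite coef_take_poly coef0; case: ifP => // hr.
  rewrite coef_map /=; have := Pdiv.RingMonic.rdivp_eq fm P`_r; rewrite /P hE // addr0 => ->.
  by rewrite rmorphM /= f0 mulr0.
rewrite -(poly_take_drop M P') P'0 add0r hornerM hornerXn mulrC; exact: dvAM.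
Qed.
End Specialization.

Section Core.
Variables (n D : nat).

Definition stM := (8 * n ^ 2 * D)%N.
Definition ste := (2 * D + n)%N.
Definition stK : nat :=
  ((stM * (ste * 2) + n * (1 + ste + branch_weight n ste stM.-1) + n) * ste.+1).+1.
Definition stm := (9 * n * D)%N.
Definition stl := (64 * (stm + stK))%N.
Definition stT := (64 * stK)%N.

(** The unknowns outnumber the equations because [8 * 65 ^ 2 < 9 * 64 ^ 2]. *)
Lemma params_ineq : (0 < n)%N -> (0 < D)%N ->
  (stM * (n * ((stl + stm + stK) * (stT + stK))) < stT * stl * n * stm * n)%N.
Proof.
move=> n0 D0.
have K0 : (0 < stK)%N by [].
have e1 : (stl + stm + stK = 65 * (stm + stK))%N by rewrite /stl; lia.
have e2 : (stT + stK = 65 * stK)%N by rewrite /stT; lia.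
rewrite e1 e2 /stT /stl /stM /stm.
set K := stK in K0 *; set A := (9 * n * D + K)%N.
have hA : (0 < A)%N by rewrite /A; lia.
have -> : (8 * n ^ 2 * D * (n * (65 * A * (65 * K))) = (8 * 65 * 65) * (n ^ 2 * D * n * A * K))%N by ring.
have -> : (64 * K * (64 * A) * n * (9 * n * D) * n = (64 * 64 * 9) * (n ^ 2 * D * n * A * K))%N by ring.
have h : (0 < n ^ 2 * D * n * A * K)%N by rewrite !muln_gt0 ?expn_gt0 n0 D0 hA K0.
rewrite ltn_mul2r h /=; by [].
Qed.

(** Multiplicity [8 n ^ 2 D] and degree [10 n D q] of the auxiliary function give the
    ratio [5/4] when compared through the norm. *)
Theorem stepanov (k : finFieldType) (f : {poly {poly {poly k}}}) :
  (0 < n)%N -> (0 < D)%N -> f \is monic -> size f = n.+1 ->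
  (forall i : nat, (i < n)%N -> (size (f`_i)%R <= D.+1)%N) ->
  (forall i j : nat, (size ((f`_i)`_j)%R <= D.+1)%N) ->
  (n <= #|k|)%N -> (stM <= #|k|)%N ->
  exists2 E : aux k stT stl n stm, (exists u, E u != 0) &
    forall c, norm n (fspec c f) (Phi c E) != 0 ->
      (4 * \sum_x size (pts c f x) <= 5 * #|k| + stl + 1)%N.
Proof.
move=> n0 D0 fm sf hsx hsg nk Mk.
have M0 : (0 < stM)%N by rewrite /stM !muln_gt0 ?expn_gt0 n0 D0.
have szx i : (size (f`_i)%R <= D.+1)%N.
  have [h|h|->] := ltngtP i n; [exact: hsx | by rewrite nth_default ?size_poly0 // sf |].
  by rewrite -[n]/(n.+1.-1) -sf -lead_coefE (monicP fm) size_poly1.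
have ht2 i : totdeg2 k (2 * D)%N f`_i.
  move=> j; rewrite mul1n; case: leqP => hj.
    have [h|h] := leqP j D; first by apply/degfP; apply: leq_trans (hsg i j) _; lia.
    by rewrite nth_default ?(leq_trans (szx i)) //; apply: fil0.
  by rewrite nth_default // (leq_trans (szx i)) //; lia.
have hf : totdeg3 k ste f.
  move=> i; rewrite mul1n /ste; case: leqP => hi.
    have [h|h] := leqP i n; first by apply: filW (ht2 i); lia.
    by rewrite nth_default ?sf //; apply: fil0.
  by rewrite nth_default // sf; lia.
have sxf i : (size (f`_i)%R <= ste.+1)%N by apply: leq_trans (szx i) _; rewrite /ste; lia.
have sfl : (size f <= n.+1)%N by rewrite sf.
have [Z [g [hZ _ Zg]]] := local_param sfl hf sxf stM.-1.
rewrite prednK // in Zg.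
have hf2 i : totdeg2 k ste f`_i by apply: filW (ht2 i); rewrite /ste; lia.
have [E nzE hE] := exists_aux fm sf hf hf2 hZ (params_ineq n0 D0).
exists E => // c nz.
have fcm : fspec c f \is monic by apply: monic_map.
have sfc : size (fspec c f) = n.+1.
  by rewrite -sf size_map_poly_id0 // (monicP fm) rmorph1 oner_eq0.
have /fin_all_exists [Yf hYf] (v : k * k) : exists Yf : {poly k}, v.2 \in pts c f v.1 ->
  [/\ Yf.[v.1] = v.2, ('X - v.1%:P) ^+ stM %| (fspec c f).[Yf] & ('X - v.1%:P) ^+ stM %| (Phi c E).[Yf]].
  have [h|h] := boolP (v.2 \in pts c f v.1); last by exists 0.
  by have [Yf hY] := branch fm Mk Zg hE h; exists Yf.
have hfc : wfil (degf k) D (D * n)%N (fspec c f).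
  move=> i; case: ifP => hi; last first.
    by rewrite nth_default // sfc ltnNge; apply/negP => h; move: hi; rewrite leq_mul2l h orbT.
  apply/degfP; rewrite coef_map /=; apply: leq_trans (size_poly _ _) _.
  have [h|h|->] := ltngtP i n; first last.
  - by rewrite -[n in f`_n]/(n.+1.-1) -sf -lead_coefE (monicP fm) size_poly1.
  - by rewrite nth_default ?size_poly0 // sf.
  by apply: leq_trans (hsx i h) _; rewrite ltnS -mulnBr -{1}[D]muln1 leq_mul2l subn_gt0 h orbT.
have hPhi : wfil (degf k) D (stl + D * n + #|k| * (stm + D * n))%N (Phi c E).
  apply: fil_sum => -[[[[t a] i] b] j] _.
  have hX : wfil (degf k) D 1 'X%:P by apply/wfilC/wfilX.
  have hXq : wfil (degf k) D #|k| ('X ^+ #|k|)%:P.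
    by apply/wfilC; rewrite -[X in degf k X]mul1n; apply/fil_exp/wfilX.
  have hYq : wfil (degf k) D (D * #|k|)%N ('X ^+ #|k|) by apply/fil_exp/wfilX.
  have hc : wfil (degf k) D 0 (c%:P%:P) by apply/wfilC/degfP; rewrite size_polyC; case: (_ != _).
  have hEu : wfil (degf k) D 0 ((E (t, a, i, b, j))%:P%:P) by apply/wfilC/degfP; rewrite size_polyC; case: (_ != _).
  apply: (@filW _ _ (0 + (0 * t + 1 * a + D * i + #|k| * b + (D * #|k|) * j))%N).
    move: (ltn_ord a) (ltn_ord i) (ltn_ord b) (ltn_ord j).
    move: (nat_of_ord a) (nat_of_ord i) (nat_of_ord b) (nat_of_ord j) => a' i' b' j' h1 h2 h3 h4.
    have : (#|k| * b' + D * #|k| * j' <= #|k| * (stm + D * n))%N.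
      by rewrite mulnDr leq_add // ?leq_mul2l ?(ltnW h3) ?orbT // mulnA [(#|k| * D)%N]mulnC leq_mul2l (ltnW h4) orbT.
    have : (D * i' <= D * n)%N by rewrite leq_mul2l (ltnW h2) orbT.
    have aux0 x0 y0 u0 v0 s0 z0 w0 : (x0 < s0 -> u0 <= z0 -> y0 + v0 <= w0 ->
      0 + (0 * t + 1 * x0 + u0 + y0 + v0) <= s0 + z0 + w0)%N by clear; lia.
    by move=> hi hbj; apply: aux0.
  do 5?apply: filM => //; apply: fil_exp => //; exact: wfilX.
have := @point_bound k n (fspec c f) (Phi c E) D _ stM (pts c f) (fun x y => Yf (x, y)) fcm sfc nk hfc hPhi nz M0.
move=> /(_ (fun x => filter_uniq _ (enum_uniq _)) (fun x y hy => hYf (x, y) hy)).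
move: (\sum_x _)%N => N; rewrite /stM /stm.
move: stl #|k| => l q hN.
have h1 : (8 * n ^ 2 * D * N <= l * (n ^ 2 * D) + n ^ 2 * D + 10 * (n ^ 2 * D) * q)%N.
  apply: leq_trans hN _; have -> : ((l + D * n + q * (9 * n * D + D * n)) * n = l * n + n ^ 2 * D + 10 * (n ^ 2 * D) * q)%N by ring.
  by rewrite !leq_add2r leq_mul2l -{1}[n]muln1 -mulnA leq_mul2l muln_gt0 n0 D0 !orbT.
have h0 : (0 < n ^ 2 * D)%N by rewrite !muln_gt0 ?expn_gt0 n0.
have h2 : (n ^ 2 * D * (8 * N) <= n ^ 2 * D * (l + 1 + 10 * q))%N.
  by move: h1; clear; rewrite [(n ^ 2 * D * (l + _ + _))%N](_ : _ = l * (n ^ 2 * D) + n ^ 2 * D + 10 * (n ^ 2 * D) * q)%N; [rewrite [(n ^ 2 * D * _)%N](_ : _ = 8 * n ^ 2 * D * N)%N //; ring | ring].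
by move: h2; rewrite leq_pmul2l //; clear; lia.
Qed.
End Core.

(** * The double norm and the exceptional parameters *)

Section FrobMorph.
Variables (k : finFieldType) (S : comNzRingType) (j : {rmorphism k -> S}).
(** The [q]-th power map is a morphism of every [k]-algebra. *)
Definition frobq of {rmorphism k -> S} := fun z : S => z ^+ #|k|.
Fact frobq_zmod : zmod_morphism (frobq j).
Proof. by move=> x y; apply: frobB j x y. Qed.
Fact frobq_monoid : monoid_morphism (frobq j).
Proof. by split=> [|x y]; rewrite /frobq ?expr1n ?exprMn. Qed.
HB.instance Definition _ := GRing.isZmodMorphism.Build S S (frobq j) frobq_zmod.
HB.instance Definition _ := GRing.isMonoidMorphism.Build S S (frobq j) frobq_monoid.
End FrobMorph.

Lemma ev2_comp (A B S : comNzRingType) (j : {rmorphism A -> B}) (X : B) (J : {rmorphism B -> S}) (Y : S) f :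
  evx J Y (map_poly (evx j X) f) = ev2 (J \o j) (J X) Y f.
Proof.
rewrite /ev2 /evx /= /horner_eval -map_poly_comp; congr (_.[_]); apply: eq_map_poly => p /=.
by rewrite -horner_map -map_poly_comp.
Qed.

Lemma eq_ev2 (A S : comNzRingType) (j j' : {rmorphism A -> S}) X Y f :
  (forall a, j a = j' a) -> ev2 j X Y f = ev2 j' X Y f.
Proof.
by move=> h; rewrite -[LHS]/(idfun (ev2 j X Y f)) (ev2_morph (g := idfun) (j' := j')).
Qed.

(** Base [q] digits: substituting [x ^ q] for [x'] is injective on polynomials of
    degree less than [q] in [x]. *)
Lemma horner_subX (k : idomainType) (q : nat) (p : {poly {poly k}}) :
  (forall i : nat, (size (p`_i)%R <= q)%N) -> p.['X ^+ q] = 0 -> p = 0.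
Proof.
move=> hs h0; apply/polyP => i; rewrite coef0; apply/polyP => r; rewrite coef0.
have [hr|hr] := leqP q r; first by rewrite nth_default // (leq_trans (hs i)).
have q0 : (0 < q)%N by apply: leq_trans hr.
have := congr1 (fun w : {poly k} => w`_(q * i + r)) h0; rewrite coef0 horner_coef coef_sum.
have [hi|hi] := leqP (size p) i; first by move=> _; rewrite [p`_i]nth_default // coef0.
rewrite (bigD1 (Ordinal hi)) //= big1 ?addr0.
  by rewrite -exprM coefMXn ltnNge leq_addr /= addKn.
move=> i' ne; rewrite -exprM coefMXn; case: ltnP => // h.
have : (i' < i)%N.
  rewrite ltn_neqAle ne /= -(leq_pmul2l q0) leqNgt; apply/negP => h'.
  have : (q * i.+1 <= q * i')%N by rewrite leq_mul2l -(ltn_pmul2l q0) h' orbT.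
  by move: h hr; rewrite mulnS; clear; lia.
move=> lt; rewrite nth_default // (leq_trans (hs i')) //.
have : (q * i'.+1 <= q * i)%N by rewrite leq_mul2l lt orbT.
by move: h hr; rewrite mulnS; clear; lia.
Qed.

Section Double.
Variables (k : finFieldType) (U : idomainType) (cU : {rmorphism k -> U}) (X X' : U).
Notation UG := {poly U}.
Notation S4 := {poly UG}.
Notation S5 := {poly S4}.
Notation R3 := {poly {poly {poly k}}}.

(** In this section [x] and [x'] live in an arbitrary domain [U]. The tower above it adds
    [gamma], then [y'], then [y]. *)
Definition jG : {rmorphism {poly k} -> UG} := map_poly cU.
Definition jP : {rmorphism {poly k} -> S4} := polyC \o jG.
Definition c5 : {rmorphism k -> S5} := polyC \o (polyC \o (polyC \o cU)).
Definition fy : {rmorphism R3 -> S5} := map_poly (evx jP X%:P%:P).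
Definition fy' : {rmorphism R3 -> S4} := map_poly (evx jG X'%:P).

Section WithE.
Variables (n D T l m : nat) (E : aux k T l n m) (f : R3).
Hypotheses (n0 : (0 < n)%N) (fm : f \is monic) (sf : size f = n.+1).
Hypothesis hsx : forall i : nat, (i < n)%N -> (size (f`_i)%R <= D.+1)%N.
Hypothesis hsg : forall i j : nat, (i < n)%N -> (size ((f`_i)`_j)%R <= D.+1)%N.

Definition aux_nested : S5 := evE c5 'X%:P%:P X%:P%:P%:P 'X X'%:P%:P%:P 'X%:P E.
Definition R1 : S4 := norm n (fy f) aux_nested.
(** The norm of the auxiliary polynomial with respect to both copies of the curve. It
    is a polynomial in [gamma] over [U]. *)
Definition N2 : UG := norm n (fy' f) R1.

Lemma fy_monic : fy f \is monic.
Proof. exact: monic_map. Qed.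
Lemma fy'_monic : fy' f \is monic.
Proof. exact: monic_map. Qed.
Lemma size_fy : size (fy f) = n.+1.
Proof. by rewrite -sf size_map_poly_id0 // (monicP fm) rmorph1 oner_eq0. Qed.
Lemma size_fy' : size (fy' f) = n.+1.
Proof. by rewrite -sf size_map_poly_id0 // (monicP fm) rmorph1 oner_eq0. Qed.

Lemma wfil_monic (A : comNzRingType) (F : filtration A) (g : {poly A}) d :
  size g = n.+1 -> g \is monic -> (forall i : nat, (i < n)%N -> F d g`_i) -> wfil F d (d * n)%N g.
Proof.
move=> sg gm h i; case: ifP => hi.
  have [lt|gt|->] := ltngtP i n.
  - by apply: filW (h i lt); rewrite -mulnBr -{1}[d]muln1 leq_mul2l subn_gt0 lt orbT.
  - by rewrite nth_default ?sg //; apply: fil0.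
  - by rewrite -[n]/(n.+1.-1) -sg -lead_coefE (monicP gm); apply: fil1.
rewrite nth_default // sg ltnNge; apply/negP => h'; move/negP: hi; apply.
by rewrite leq_mul2l h' orbT.
Qed.

Definition Gam := ((T + D * n + D * n) * n * n)%N.

Lemma degC_fil (A : comNzRingType) d (p : {poly A}) : (size p <= d.+1)%N -> degf A d p.
Proof. by move/degfP. Qed.

Lemma fil_evx (A : idomainType) (S : comNzRingType) (F : filtration S) (j : {rmorphism A -> S}) (x : S) d (p : {poly A}) :
  (forall i : nat, F d (j p`_i)) -> F 0 x -> F d (evx j x p).
Proof.
move=> h hx; rewrite /evx /= /horner_eval horner_coef; apply: fil_sum => i _.
rewrite coef_map -[d]addn0; apply: filM; first exact: h.
by have := fil_exp i hx; rewrite mul0n.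
Qed.

Lemma fil_evx1 (A : idomainType) (S : comNzRingType) (F : filtration S) (j : {rmorphism A -> S}) (x : S) d (p : {poly A}) :
  (forall i : nat, F 0 (j p`_i)) -> F 1 x -> (size p <= d.+1)%N -> F d (evx j x p).
Proof.
move=> h hx hs; rewrite /evx /= /horner_eval horner_coef; apply: fil_sum => i _.
rewrite coef_map; apply: (@filW _ F (0 + i)%N).
  by rewrite add0n -ltnS (leq_trans (ltn_ord i)) // (leq_trans (size_poly _ _)).
by apply: filM; [exact: h | have := fil_exp i hx; rewrite mul1n].
Qed.

Lemma N2_gamma : (size N2 <= Gam.+1)%N.
Proof.
pose FG := degf U; pose F4 := wfil FG D; pose F5 := wfil F4 D.
have hj i j : (i < n)%N -> FG D (jG (f`_i)`_j).
  by move=> hi; apply/degfP; apply: leq_trans (size_poly _ _) (hsg _ hi).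
have hf' : wfil FG D (D * n)%N (fy' f).
  apply: wfil_monic; [exact: size_fy' | exact: fy'_monic |] => i hi.
  rewrite coef_map; apply: fil_evx => [j|]; first exact: hj.
  by apply: (degC_fil (d := 0)); rewrite size_polyC; case: (_ != 0).
have hf : wfil F4 D (D * n)%N (fy f).
  apply: wfil_monic; [exact: size_fy | exact: fy_monic |] => i hi.
  rewrite coef_map; apply: fil_evx => [j|]; first by apply: wfilC; exact: hj.
  by apply: wfilC; apply: (degC_fil (d := 0)); rewrite size_polyC; case: (_ != 0).
have hE : F5 (T + D * n + D * n)%N aux_nested.
  apply: fil_sum => -[[[[t a] i] b] j] _.
  have c0 (z : U) : F5 0 (z%:P%:P%:P).
    by do 2!apply: wfilC; apply: (degC_fil (d := 0)); rewrite size_polyC; case: (_ != 0).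
  have hg : F5 1 'X%:P%:P by do 2!apply: wfilC; apply: wfilX.
  have hy' : F5 D 'X%:P by apply: wfilC; apply: wfilX.
  have hy : F5 D 'X by apply: wfilX.
  apply: (@filW _ _ (0 + (1 * t + 0 * a + D * i + 0 * b + D * j))%N).
    have h1 : (D * i <= D * n)%N by rewrite leq_mul2l (ltnW (ltn_ord i)) orbT.
    have h2 : (D * j <= D * n)%N by rewrite leq_mul2l (ltnW (ltn_ord j)) orbT.
    have h3 := ltnW (ltn_ord t).
    have aux0 x u v z w : (x <= z -> u <= w -> v <= w -> 0 + (1 * x + 0 * a + u + 0 * b + v) <= z + w + w)%N by clear; lia.
    exact: aux0.
  apply: filM; first exact: c0.
  have hx' : F5 0 X'%:P%:P%:P by exact: c0.
  have hx : F5 0 X%:P%:P%:P by exact: c0.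
  exact: (filM (filM (filM (filM (fil_exp t hg) (fil_exp a hx)) (fil_exp i hy)) (fil_exp b hx')) (fil_exp j hy')).
have h1 := fil_norm fy_monic size_fy hf hE.
by have /degfP := fil_norm fy'_monic size_fy' hf' h1.
Qed.

Definition Xde := ((l + D * n) * n * n)%N.

Lemma N2_fil (FX : filtration U) i : (forall a d, FX d (cU a)) -> FX 1 X -> FX 0 X' -> FX Xde N2`_i.
Proof.
move=> cX hX hX'.
pose FG := wfil FX 0; pose F4 := wfil FG 0; pose F5 := wfil F4 D.
have hj d i0 j0 : FG d (jG (f`_i0)`_j0).
  by apply/cofP => r; rewrite coef_map; apply: cX.
have hf' : wfil FG 0 (0 * n)%N (fy' f).
  apply: wfil_monic; [exact: size_fy' | exact: fy'_monic |] => i0 hi.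
  by rewrite coef_map; apply: fil_evx => [j0|]; [exact: hj | apply: wfilC].
have hf : wfil F4 D (D * n)%N (fy f).
  apply: wfil_monic; [exact: size_fy | exact: fy_monic |] => i0 hi.
  rewrite coef_map; apply: fil_evx1 => [r||]; last exact: hsx.
    by apply: wfilC; exact: hj.
  by do 2!apply: wfilC.
have hE : F5 (l + D * n)%N aux_nested.
  apply: fil_sum => -[[[[t a] i0] b] j0] _.
  have c0 (z : U) d : FX d z -> F5 d (z%:P%:P%:P) by move=> h; do 3!apply: wfilC.
  have hg : F5 0 'X%:P%:P by do 2!apply: wfilC; apply: wfilX.
  have hy' : F5 0 'X%:P by apply: wfilC; apply: wfilX.
  have hy : F5 D 'X by apply: wfilX.
  apply: (@filW _ _ (0 + (0 * t + 1 * a + D * i0 + 0 * b + 0 * j0))%N).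
    have h1 : (D * i0 <= D * n)%N by rewrite leq_mul2l (ltnW (ltn_ord i0)) orbT.
    have h3 := ltnW (ltn_ord a).
    have aux0 x u z w : (x <= z -> u <= w -> 0 + (0 * t + 1 * x + u + 0 * b + 0 * j0) <= z + w)%N by clear; lia.
    exact: aux0.
  apply: filM; first by apply: c0; apply: cX.
  have hx' := c0 _ _ hX'.
  have hx := c0 _ _ hX.
  exact: (filM (filM (filM (filM (fil_exp t hg) (fil_exp a hx)) (fil_exp i0 hy)) (fil_exp b hx')) (fil_exp j0 hy')).
have h1 := fil_norm fy_monic size_fy hf hE.
have h2 := fil_norm fy'_monic size_fy' hf' h1.
exact: (wfil_coef i h2).
Qed.

(** The two norms lie in ideals; sending [(x', y')] to [(x ^ q, y ^ q)] turns the second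
    copy of the equation into the [q]-th power of the first. *)
Lemma N2_ideal (V : comNzRingType) (chU : {rmorphism U -> V}) (c : k) (Y : V) :
  chU X' = chU X ^+ #|k| ->
  exists u w : V, chU N2.[cU c] =
    u * evE (chU \o cU) (chU (cU c)) (chU X) Y (chU X ^+ #|k|) (Y ^+ #|k|) E
    + w * ev2 ((chU \o cU) \o horner_eval c) (chU X) Y f.
Proof.
pose q := #|k| => hX'.
pose chG : {rmorphism UG -> V} := evx chU (chU (cU c)).
pose ch4 : {rmorphism S4 -> V} := evx chG (Y ^+ q).
pose ch5 : {rmorphism S5 -> V} := evx ch4 Y.
have hG z : chG z%:P = chU z by rewrite /chG /= evxC.
have h4 z : ch4 z%:P = chG z by rewrite /ch4 /= evxC.
have h5 z : ch5 z%:P = ch4 z by rewrite /ch5 /= evxC.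
have hGg : chG 'X = chU (cU c) by rewrite /chG /= evxX.
have h4y : ch4 'X = Y ^+ q by rewrite /ch4 /= evxX.
have h5y : ch5 'X = Y by rewrite /ch5 /= evxX.
pose cV : {rmorphism k -> V} := chU \o cU.
pose jc : {rmorphism {poly k} -> V} := cV \o horner_eval c.
have jcE p : chG (jG p) = jc p.
  rewrite /chG /jG /= /evx /= /horner_eval -map_poly_comp.
  by rewrite -[chU (cU c)]/(cV c) horner_map.
set fV := ev2 _ (chU X) Y f.
have ef : ch5 (fy f) = fV.
  transitivity (ev2 (ch4 \o jP) (ch4 X%:P%:P) Y f); first exact: (ev2_comp jP _ ch4).
  rewrite h4 hG; by apply: eq_ev2 => a; rewrite -jcE -h4.
have ef' : ch4 (fy' f) = fV ^+ q.
  transitivity (ev2 (chG \o jG) (chG X'%:P) (Y ^+ q) f); first exact: (ev2_comp jG _ chG).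
  rewrite hG hX' -[RHS]/(frobq cV fV) /fV (ev2_morph (g := frobq cV) (j' := jc)).
    by apply: eq_ev2 => a; rewrite -jcE.
  move=> a; transitivity (cV a.[c] ^+ q); first by [].
  by rewrite -rmorphXn /q expf_card.
set PV := evE _ _ _ _ _ _ _.
have eE : ch5 aux_nested = PV.
  rewrite /aux_nested (evE_morph (h := ch5) (c' := cV)) => [|a]; last by rewrite [c5 a]/((cU a)%:P%:P%:P) h5 h4 hG.
  by rewrite h5y h5 h4 hGg h5 h4 hG h5 h4 hG h5 h4y hX'.
have [u1 [w1 e1]] := norm_ideal R1 fy'_monic size_fy' n0.
have [u2 [w2 e2]] := norm_ideal aux_nested fy_monic size_fy n0.
have eN : chU N2.[cU c] = ch4 (N2%:P).
  by rewrite h4 /chG /= /evx /= /horner_eval horner_map.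
have e3 : ch4 R1 = ch5 u2 * PV + ch5 w2 * fV.
  transitivity (ch5 (norm n (fy f) aux_nested)%:P); first exact: esym (h5 _).
  by rewrite e2 (rmorphD ch5) (rmorphM ch5 u2) (rmorphM ch5 w2) ef eE.
have e4 : ch4 N2%:P = ch4 u1 * ch4 R1 + ch4 w1 * fV ^+ q.
  transitivity (ch4 (u1 * R1 + w1 * fy' f)); first by rewrite -e1.
  by rewrite (rmorphD ch4) (rmorphM ch4 u1) (rmorphM ch4 w1) ef'.
exists (ch4 u1 * ch5 u2), (ch4 u1 * ch5 w2 + ch4 w1 * fV ^+ q.-1).
rewrite eN e4 e3.
have -> : fV ^+ q = fV ^+ q.-1 * fV.
  by rewrite -exprSr prednK // /q; apply: ltnW (card_finNzRing_gt1 k).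
by rewrite mulrDr mulrDl !mulrA addrA.
Qed.

End WithE.
End Double.

Section DoubleFrob.
Variable k : finFieldType.
Notation U := {poly {poly k}}.
Notation UG := {poly U}.
Notation S4 := {poly UG}.
Notation S5 := {poly S4}.
Notation R3 := {poly {poly {poly k}}}.
Definition cU2 : {rmorphism k -> U} := polyC \o polyC.
Notation cU := cU2.
Notation jG := (jG cU2).
Notation jP := (jP cU2).
Notation c5 := (c5 cU2).
Notation fy := (fy cU2 'X%:P).
Notation fy' := (fy' cU2 'X).

Variables (n D T l m : nat) (E : aux k T l n m) (f : R3).
Hypotheses (n0 : (0 < n)%N) (fm : f \is monic) (sf : size f = n.+1).
Hypothesis hsx : forall i : nat, (i < n)%N -> (size (f`_i)%R <= D.+1)%N.
Hypothesis hsg : forall i j : nat, (i < n)%N -> (size ((f`_i)`_j)%R <= D.+1)%N.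
Notation N2 := (N2 cU2 'X%:P 'X E f).
Notation aux_nested := (aux_nested cU2 'X%:P 'X E).
Notation R1 := (R1 cU2 'X%:P 'X E f).
Notation Gam := (Gam n D T).
Notation fy_monic := (fy_monic cU2 'X%:P fm).
Notation fy'_monic := (fy'_monic cU2 'X fm).
Notation size_fy := (size_fy cU2 'X%:P fm sf).
Notation size_fy' := (size_fy' cU2 'X fm sf).

Lemma N2_x i j : (size ((N2`_i)`_j)%R <= (Xde n D l).+1)%N.
Proof.
have h : cof (degf k) (Xde n D l) (N2`_i).
  apply: (N2_fil E fm sf hsx).
  - by move=> a d; apply: wfilC; apply/degfP; rewrite size_polyC; case: (_ != 0).
  - by apply: wfilC; apply: wfilX.
  - by apply: wfilX.
by have /degfP := wfil_coef j h.
Qed.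

Lemma Phi_ideal (c : k) : exists u w : U,
   ((N2.[c%:P%:P]).['X ^+ #|k|])%:P = u * Phi c E + w * fspec c f.
Proof.
pose q := #|k|.
pose chU : {rmorphism U -> U} := evx polyC ('X ^+ q)%:P.
have hU (a : k) : chU (cU a) = a%:P%:P by rewrite /chU /= evxC.
have hUx' : chU 'X = ('X ^+ q)%:P by rewrite /chU /= evxX.
have hUx : chU 'X%:P = 'X%:P by rewrite /chU /= evxC.
have hX : chU 'X = chU 'X%:P ^+ q by rewrite hUx' hUx polyC_exp.
have [u [w e]] := @N2_ideal _ _ cU 'X%:P 'X _ _ _ _ E _ n0 fm sf _ chU c 'X hX.
exists u, w.
have -> : Phi c E = evE (chU \o cU) (chU (cU c)) (chU 'X%:P) 'X (chU 'X%:P ^+ q) ('X ^+ q) E.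
  rewrite hU hUx -polyC_exp -[RHS]/(idfun _) (evE_morph (h := idfun) (c' := cU)) //.
have -> : fspec c f = ev2 ((chU \o cU) \o horner_eval c) (chU 'X%:P) 'X f.
  rewrite hUx; transitivity (ev2 (cU \o horner_eval c) 'X%:P 'X f); last first.
    by apply: eq_ev2 => a; rewrite -[RHS]/(chU (cU _)) hU.
  rewrite -[LHS](comp_polyXr _) /comp_poly /fspec -map_poly_comp /ev2 /= /horner_eval.
  congr (_.[_]); apply: eq_map_poly => p /=; rewrite /evx /= /horner_eval.
  rewrite -[X in X%:P](comp_polyXr _) /comp_poly -map_poly_comp -horner_map -map_poly_comp.
  by congr (_.[_]).
rewrite -e /chU /= /evx /= /horner_eval horner_map //.
Qed.

(** If the norm of [Phi c E] vanishes, then [N2] vanishes at [gamma = c], [x' = x ^ q];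
    by the digit argument it vanishes at [gamma = c], which has few solutions [c]. *)
Lemma few_bad : N2 != 0 -> (Xde n D l < #|k|)%N ->
  (#|[set c | norm n (fspec c f) (Phi c E) == 0%R]| <= Gam)%N.
Proof.
move=> nz hX.
have sub : [set c | norm n (fspec c f) (Phi c E) == 0] \subset [set c | root N2 c%:P%:P].
  apply/subsetP => c; rewrite !inE => /eqP h0; apply/negPn/negP => hr.
  have [u [w e]] := Phi_ideal c.
  have fcm : fspec c f \is monic by apply: monic_map.
  have sfc : size (fspec c f) = n.+1.
    by rewrite -sf size_map_poly_id0 // (monicP fm) rmorph1 oner_eq0.
  have /eqP := norm_eq0_power fcm sfc e h0; rewrite expf_eq0 n0 /= => /eqP /horner_subX z.
  move: hr; rewrite /root z ?eqxx // => i.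
  apply: leq_trans hX; rewrite horner_coef coef_sum.
  apply: leq_trans (size_sum _ _ _) _; apply/bigmax_leqP => r _.
  rewrite -!polyC_exp !coefMC mulrC mul_polyC (leq_trans (size_scale_leq _ _)) //.
  exact: N2_x.
apply: leq_trans (subset_leq_card sub) _; rewrite cardE.
have -> : size (enum [set c | root N2 c%:P%:P]) = size [seq (c%:P%:P : U) | c <- enum [set c | root N2 c%:P%:P]].
  by rewrite size_map.
rewrite -ltnS; apply: leq_trans (N2_gamma cU ('X%:P) ('X) E fm sf hsg); apply: max_poly_roots => //.
  by apply/allP => _ /mapP [c hc ->]; move: hc; rewrite mem_enum inE.
by rewrite map_inj_uniq ?enum_uniq // => a b /polyC_inj /polyC_inj.
Qed.
End DoubleFrob.

(** * Nonvanishing of the double norm for Kummer families *)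

Lemma frac_num (R : idomainType) (x : {fraction R}) :
  exists a b : R, b != 0 /\ x * FracField.tofrac b = FracField.tofrac a.
Proof.
elim/quotW: x => r; exists (\n_r), (\d_r); split; first exact: denom_ratioP.
rewrite -[X in X = _]/(FracField.mul (\pi_(FracField.type R) r)%qT (FracField.tofrac \d_r)).
rewrite !piE; apply/eqmodP; rewrite /= FracField.equivfE.
rewrite !numden_Ratio ?(oner_eq0, mulf_neq0, denom_ratioP) //.
by rewrite !mulr1 mulrC.
Qed.

Lemma frac_clear (R : idomainType) (p : {poly {fraction R}}) :
  exists (a : R) (p0 : {poly R}), a != 0 /\
    map_poly (@FracField.tofrac R) p0 = (FracField.tofrac a)%:P * p.
Proof.
elim/poly_ind: p => [|p c [a [p0 [a0 e]]]].
  by exists 1, 0; rewrite oner_neq0 mulr0 rmorph0.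
have [c1 [b [b0 ec]]] := frac_num c.
exists (a * b), (b%:P * p0 * 'X + (a * c1)%:P); split; first by rewrite mulf_neq0.
rewrite rmorphD !rmorphM /= map_polyX !map_polyC /= e -ec !rmorphM /=; ring.
Qed.

(** Over a field, a vanishing norm means a nontrivial common factor with [f]. *)
Lemma norm_common_factor (A : comNzRingType) (K : fieldType) (h : {rmorphism A -> K}) n (f E : {poly A}) :
  f \is monic -> size f = n.+1 -> (size E <= n)%N -> (exists i, h E`_i != 0) ->
  h (norm n f E) = 0 ->
  exists d w : {poly K}, [/\ map_poly h f = d * w, (1 < size d)%N & (size d <= n)%N].
Proof.
move=> m1 s1 sE [i hi] z.
rewrite map_norm // in z.
have m1' : map_poly h f \is monic by apply: monic_map.
have s1' : size (map_poly h f) = n.+1.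
  by rewrite -s1 size_map_poly_id0 // (monicP m1) rmorph1 oner_eq0.
have [Q2 [w2 [Q20 sQ2 eQ2]]] := norm_eq0 m1' s1' z.
have E20 : map_poly h E != 0.
  by apply: contraNneq hi => e0; rewrite -coef_map e0 coef0.
have sE2 : (size (map_poly h E) <= n)%N by apply: leq_trans (size_poly _ _) sE.
move: (map_poly h f) (map_poly h E) m1' s1' eQ2 E20 sE2 => f1 E2 m1' s1' eQ2 E20 sE2.
pose d := gcdp f1 E2.
have df1 : d %| f1 by apply: dvdp_gcdl.
have d0 : d != 0 by rewrite gcdp_eq0 (negPf E20) andbF.
exists d, (f1 %/ d); split.
- by rewrite mulrC divpK.
- rewrite ltn_neqAle size_poly_gt0 d0 andbT eq_sym -/(coprimep f1 E2); apply/negP => cp.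
  have : f1 %| Q2 * E2 by rewrite eQ2 dvdp_mull.
  rewrite Gauss_dvdpl // => /(dvdp_leq Q20); rewrite s1' => h0.
  by have := leq_trans h0 sQ2; rewrite ltnn.
- by apply: leq_trans sE2; apply: dvdp_leq => //; apply: dvdp_gcdr.
Qed.

Section KummerDouble.
Variables (U : idomainType) (n : nat) (b b' : {poly U}).
Hypotheses (n0 : (0 < n)%N) (sb : (size b <= n)%N) (sb' : (size b' <= n)%N) (b'0 : b'`_0 != 0).
Notation R := {poly U}.
Notation Om := {fraction R}.
Notation A := {poly {poly U}}.

Definition cA : {rmorphism U -> A} := polyC \o polyC.
Definition kummer_xy : {poly A} := 'X^n - 'X%:P%:P * map_poly cA b.
Definition kummer_xy1 : A := 'X^n - 'X%:P * map_poly polyC b'.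
(** The curve equation after [gamma] is eliminated through the second copy, with the
    denominator [b'] cleared. *)
Definition kummer_cleared : {poly R} := b'%:P * 'X^n - ('X^n)%:P * map_poly polyC b.
Hypothesis irrG : forall (d w : {poly R}) (lam : R), lam != 0 -> lam%:P * kummer_cleared = d * w ->
  (1 < size d)%N -> (n < size d)%N.

Definition tfU : {rmorphism U -> Om} := @FracField.tofrac R \o polyC.
(** The value of [gamma] on the second copy [y' ^ n = gamma b']. *)
Definition kg : Om := FracField.tofrac ('X^n) / FracField.tofrac b'.
Definition xiG : {rmorphism {poly U} -> Om} := evx tfU kg.
Definition xi : {rmorphism A -> Om} := evx xiG (FracField.tofrac 'X).

Lemma b'n0 : b' != 0.
Proof. by apply: contraNneq b'0 => ->; rewrite coef0. Qed.
Lemma tb'0 : FracField.tofrac b' != 0 :> Om.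
Proof. by rewrite tofrac_eq0 b'n0. Qed.

Lemma kgb : kg * FracField.tofrac b' = FracField.tofrac 'X^n.
Proof. exact: (mulfVK tb'0 _). Qed.

Lemma kgX : kg * FracField.tofrac b' = FracField.tofrac 'X ^+ n.
Proof. by rewrite -rmorphXn; exact: kgb. Qed.

Lemma xi_aux (K : comNzRingType) (g x c : K) T : - (g * x) * c ^+ T.+1 + g * c * (x * c ^+ T) = 0.
Proof. by rewrite exprS; ring. Qed.

Lemma xi_den (Q : A) : exists T (r : R), xi Q * FracField.tofrac b' ^+ T = FracField.tofrac r.
Proof.
have HD x y : (exists T (r : R), x * FracField.tofrac b' ^+ T = FracField.tofrac r) ->
  (exists T (r : R), y * FracField.tofrac b' ^+ T = FracField.tofrac r) ->
  exists T (r : R), (x + y) * FracField.tofrac b' ^+ T = FracField.tofrac r.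
  move=> [T1 [r1 e1]] [T2 [r2 e2]]; exists (T1 + T2)%N, (r1 * b' ^+ T2 + r2 * b' ^+ T1).
  by rewrite rmorphD !rmorphM !rmorphXn /= -e1 -e2 exprD; ring.
have HM x y : (exists T (r : R), x * FracField.tofrac b' ^+ T = FracField.tofrac r) ->
  (exists T (r : R), y * FracField.tofrac b' ^+ T = FracField.tofrac r) ->
  exists T (r : R), (x * y) * FracField.tofrac b' ^+ T = FracField.tofrac r.
  move=> [T1 [r1 e1]] [T2 [r2 e2]]; exists (T1 + T2)%N, (r1 * r2).
  by rewrite !rmorphM /= -e1 -e2 exprD; ring.
elim/poly_ind: Q => [|Q p IH]; first by exists 0, 0; rewrite !rmorph0 mul0r.
rewrite rmorphD rmorphM; apply: (HD).
  apply: (HM) => //; exists 0, 'X; by rewrite expr0 mulr1 /xi /= evxX.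
have -> : xi p%:P = xiG p by rewrite /xi /= evxC.
elim/poly_ind: p => [|p u IHp]; first by exists 0, 0; rewrite !rmorph0 mul0r.
rewrite rmorphD rmorphM; apply: (HD).
  apply: (HM) => //; exists 1%N, 'X^n; rewrite /xiG /= evxX expr1; exact: kgb.
by exists 0, u%:P; rewrite expr0 mulr1 /xiG /= evxC.
Qed.

Lemma xi_polyC (Q : R) : xi (map_poly polyC Q) = FracField.tofrac Q.
Proof.
rewrite /xi /= /evx /= /horner_eval -map_poly_comp.
have -> : map_poly (xiG \o polyC) Q = map_poly (@FracField.tofrac R) (map_poly polyC Q).
  by rewrite -map_poly_comp; apply: eq_map_poly => u; rewrite /= /xiG /= evxC.
by rewrite horner_map -[X in _ = FracField.tofrac X](comp_polyXr Q).
Qed.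

(** Both [gamma] and the relation of the second copy are used up by the substitution:
    on polynomials of degree less than [n] in [y'] it is injective. Separating the
    part free of [gamma], the lowest term in [y'] is excluded because [b'] has a
    nonzero constant term. *)
Lemma xi_inj (Q : A) : (size Q <= n)%N -> Q != 0 -> xi Q != 0.
Proof.
have [m] : exists m, forall j : nat, (size (Q`_j)%R <= m)%N.
  by exists (\max_(j < size Q) size (Q`_j)%R) => j; have [h|h] := ltnP j (size Q);
   [exact: (leq_bigmax (Ordinal h)) | rewrite nth_default // size_poly0].
elim: m Q => [|m IH] Q hm sQ nz.
  case/negP: nz; apply/eqP/polyP => j; rewrite coef0; apply/eqP.
  by rewrite -size_poly_leq0.
pose Q0 : R := map_poly (horner_eval 0) Q.
pose Q1 : A := map_poly (fun p : {poly U} => drop_poly 1 p) Q.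
have c1 j : Q1`_j = drop_poly 1 Q`_j.
  by rewrite coef_map_id0 // drop_poly0r.
have EQ : Q = map_poly polyC Q0 + 'X%:P * Q1.
  apply/polyP => j; rewrite coefD coef_map coefCM c1 coef_map /= /horner_eval.
  apply/polyP => i; rewrite coefD coefC coefXM coef_drop_poly horner_coef0.
  by case: i => [|i]; rewrite /= ?addr0 ?add0r ?addn1.
have xg : xi 'X%:P = kg by rewrite /xi /= evxC /xiG /= evxX.
have kg0 : kg != 0 by rewrite mulf_neq0 ?invr_eq0 ?tofrac_eq0 ?b'n0 // -size_poly_eq0 size_polyXn.
have E : xi Q = FracField.tofrac Q0 + kg * xi Q1.
  by rewrite {1}EQ rmorphD rmorphM xg xi_polyC.
have [Q00|Q0n] := eqVneq Q0 0.
  rewrite E Q00 rmorph0 add0r; apply: mulf_neq0; first exact: kg0.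
  apply: IH.
  - by move=> j; rewrite c1 size_drop_poly leq_subLR add1n hm.
  - exact: leq_trans (size_poly _ _) sQ.
  - by apply: contraNneq nz => Q10; rewrite EQ Q00 Q10 rmorph0 mulr0 addr0.
apply/eqP => z; have [T [r er]] := xi_den Q1.
have h : Q0 * b' ^+ T.+1 + 'X^n * r = 0.
  apply/eqP; rewrite -(tofrac_eq0 (_ : R)) rmorphD !rmorphM !rmorphXn /= -er.
  have -> : FracField.tofrac Q0 = - (kg * xi Q1) by apply/eqP; rewrite -addr_eq0 -E z.
  apply/eqP; rewrite -kgX; exact: xi_aux.
have sQ0 : (size Q0 <= n)%N by apply: leq_trans (size_poly _ _) sQ.
have [i hi] : exists i, Q0`_i != 0 /\ forall j : nat, (j < i)%N -> Q0`_j = 0.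
  have ex : exists i, Q0`_i != 0 by exists (size Q0).-1; rewrite -lead_coefE lead_coef_eq0.
  case: (ex_minnP ex) => i hi mi; exists i; split => // j ji.
  by apply/eqP; apply: contraTT ji => /mi; rewrite -leqNgt.
case: hi => hi hj.
have ilt : (i < n)%N.
  by rewrite ltnNge; apply: contraNN hi => ni; rewrite nth_default // (leq_trans sQ0).
have := congr1 (fun w : R => w`_i) h; rewrite coefD coef0 coefXnM ilt addr0 coefM.
rewrite (bigD1 ord_max) //= subnn big1 => [|j jn]; last first.
  by rewrite hj ?mul0r // ltn_neqAle -ltnS ltn_ord andbT; exact: jn.
rewrite addr0 => /eqP; rewrite mulf_eq0 (negPf hi) /=.
by rewrite -horner_coef0 horner_exp horner_coef0 expf_eq0 /= (negPf b'0).
Qed.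

Lemma kummer_xy_monic : kummer_xy \is monic /\ size kummer_xy = n.+1.
Proof.
have h : (size ('X%:P%:P * map_poly cA b : {poly A})%R < n.+1)%N.
  rewrite mul_polyC ltnS (leq_trans (size_scale_leq _ _)) //.
  exact: leq_trans (size_poly _ _) sb.
split; last by rewrite /kummer_xy size_polyDl ?size_polyN size_polyXn.
by rewrite monicE /kummer_xy lead_coefDl ?lead_coefXn // size_polyN size_polyXn.
Qed.

Lemma kummer_xy1_monic : kummer_xy1 \is monic /\ size kummer_xy1 = n.+1.
Proof.
have h : (size ('X%:P * map_poly polyC b' : A)%R < n.+1)%N.
  rewrite mul_polyC ltnS (leq_trans (size_scale_leq _ _)) //.
  exact: leq_trans (size_poly _ _) sb'.
split; last by rewrite /kummer_xy1 size_polyDl ?size_polyN size_polyXn.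
by rewrite monicE /kummer_xy1 lead_coefDl ?lead_coefXn // size_polyN size_polyXn.
Qed.

Lemma eG_aux (K : comNzRingType) (c g x : K) (X P F : {poly K}) :
  F = X - g%:P * P -> g * c = x -> c%:P * X - x%:P * P = c%:P * F.
Proof. by move=> -> <-; rewrite polyCM; ring. Qed.

Lemma eG_aux2 (K : comNzRingType) (x y c d w : K) : x * y * (c * (d * w)) = x * d * (c * (y * w)).
Proof. by ring. Qed.

(** Were the double norm zero, the auxiliary polynomial and the cleared equation would
    have a common factor of degree less than [n], against irreducibility. *)
Theorem kummer_norm (aux_nested : {poly A}) : aux_nested != 0 -> (size aux_nested <= n)%N ->
  (forall i : nat, (size (aux_nested`_i)%R <= n)%N) -> norm n kummer_xy1 (norm n kummer_xy aux_nested) != 0.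
Proof.
move=> nz sE sEi; apply/eqP => z.
have [m1 s1] := kummer_xy_monic; have [m2 s2] := kummer_xy1_monic.
have [Q [w [Q0 sQ eQ]]] := norm_eq0 m2 s2 z.
have xg : xi 'X%:P = kg by rewrite /xi /= evxC /xiG /= evxX.
have xf2 : xi kummer_xy1 = 0.
  rewrite /kummer_xy1 rmorphB rmorphM xg xi_polyC rmorphXn /kg mulfVK ?tb'0 // rmorphXn.
  by have -> : xi 'X = FracField.tofrac 'X; [rewrite /xi /= evxX | rewrite subrr].
have nzc : exists i, xi aux_nested`_i != 0.
  by exists (size aux_nested).-1; apply: xi_inj (sEi _) _; rewrite -lead_coefE lead_coef_eq0.
have xR1 : xi (norm n kummer_xy aux_nested) = 0.
  have := congr1 xi eQ; rewrite !rmorphM /= xf2 mulr0 => /eqP.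
  by rewrite mulf_eq0 (negPf (xi_inj sQ Q0)) => /eqP.
have [d [w3 [e3 sd1 sd]]] := norm_common_factor m1 s1 sE nzc xR1.
have [a1 [dd [a10 ed]]] := frac_clear d.
have [a2 [ww [a20 ew]]] := frac_clear w3.
have sdd : size dd = size d.
  rewrite -(size_map_inj_poly (f := @FracField.tofrac R) _ (rmorph0 _)); last first.
    by move=> x y /eqP; rewrite tofrac_eq => /eqP.
  by rewrite ed mul_polyC size_scale // tofrac_eq0.
have eG : (a1 * a2)%:P * kummer_cleared = dd * (b'%:P * ww).
  apply: (map_inj_poly (f := @FracField.tofrac R) _ (rmorph0 _)).
    by move=> x y /eqP; rewrite tofrac_eq => /eqP.
  rewrite !rmorphM /= ed ew !map_polyC /= [in LHS]/kummer_cleared rmorphB !rmorphM /= map_polyXn !map_polyC /= -map_poly_comp.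
  have -> : map_poly (@FracField.tofrac R \o polyC) b = map_poly tfU b by [].
  have ef1 : map_poly xi kummer_xy = 'X^n - kg%:P * map_poly tfU b.
    rewrite /kummer_xy rmorphB rmorphM /= map_polyXn map_polyC /= xg -map_poly_comp; congr (_ - _ * _).
    by apply: eq_map_poly => u; rewrite /= /xi /= evxC /xiG /= evxC.
  have -> : (FracField.tofrac b')%:P * 'X^n - (FracField.tofrac 'X^n)%:P * map_poly tfU b = (FracField.tofrac b')%:P * map_poly xi kummer_xy.
    exact: (eG_aux ef1 kgb).
  by rewrite e3; exact: eG_aux2.
have a12 : a1 * a2 != 0 by rewrite mulf_neq0.
by have := irrG a12 eG; rewrite sdd => /(_ sd1); rewrite ltnNge sd.
Qed.
End KummerDouble.

(** * Slopes of Newton polygons *)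

Section Newton.
Variables (D0 : idomainType) (n V : nat).
Hypothesis n0 : (0 < n)%N.
Notation P2 := {poly {poly D0}}.
Definition cc2 : {rmorphism D0 -> P2} := polyC \o polyC.
Definition slope_subst_t : {rmorphism {poly D0} -> P2} := evx cc2 'X^n.
(** The substitution [y -> y t ^ V], [t -> t ^ n] makes the Newton polygon of slope
    [V / n] horizontal. *)
Definition slope_subst : {rmorphism P2 -> P2} := evx slope_subst_t ('X%:P * 'X^V).

(** Each monomial goes to a single monomial, so no cancellation can occur. *)
Lemma slope_subst_coef P s i : (slope_subst P)`_s`_i = (if (V * i <= s) && (n %| s - V * i) then ((P`_i)`_((s - V * i) %/ n)%N)%R else 0%R)%N.
Proof.
have aux_nested p : slope_subst_t p = \sum_(r < size p) (p`_r)%:P%:P * 'X^(n * r).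
  rewrite /slope_subst_t /= /evx /= /horner_eval horner_coef size_map_inj_poly ?rmorph0 //; last first.
    by move=> x y /polyC_inj /polyC_inj.
  by apply: eq_bigr => r _; rewrite coef_map /= -exprM.
have Ecn p t : (slope_subst_t p)`_t = (if (n %| t)%N then p`_(t %/ n)%N else 0)%:P.
  rewrite aux_nested coef_sum; have [/dvdnP [u ->]|nd] := boolP (n %| t)%N.
    rewrite mulnK //; have [hu|hu] := ltnP u (size p).
      rewrite (bigD1 (Ordinal hu)) //= big1 ?addr0 => [|r ne].
        by rewrite coefCM coefXn mulnC eqxx mulr1.
      rewrite coefCM coefXn mulnC eqn_pmul2l //; case: eqP => [e|_]; last by rewrite mulr0.
      by case/eqP: ne; apply: val_inj; rewrite /= e.
    rewrite nth_default // big1 ?polyC0 // => r _.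
    rewrite coefCM coefXn mulnC eqn_pmul2l //; case: eqP => [e|_]; last by rewrite mulr0.
    by move: (ltn_ord r) hu; rewrite e; lia.
  rewrite polyC0 big1 // => r _; rewrite coefCM coefXn; case: eqP => [e|_]; last by rewrite mulr0.
  by rewrite e dvdn_mulr in nd.
have -> : slope_subst P = \sum_(j < size P) slope_subst_t P`_j * (('X^j)%:P * 'X^(V * j)).
  rewrite /slope_subst /= /evx /= /horner_eval (@horner_coef_wide _ (size P)) ?size_poly //.
  apply: eq_bigr => j _; rewrite coef_map /= exprMn_comm; last exact: commr_polyXn.
  by rewrite -polyC_exp -exprM.
have Et j : ((slope_subst_t P`_j * (('X^j)%:P * 'X^(V * j)))`_s)`_i =
   (if (j == i) && (V * j <= s) && (n %| s - V * j) then ((P`_j)`_((s - V * j) %/ n)%N)%R else 0%R)%N.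
  rewrite mulrA coefMXn; case: leqP => h.
    rewrite coefMC Ecn coefCM coefXn eq_sym.
    by case: eqP => [->|_] /=; rewrite ?mulr1 ?mulr0.
  by rewrite coef0; case: eqP.
rewrite !coef_sum; have [hi|hi] := ltnP i (size P).
  rewrite (bigD1 (Ordinal hi)) //= Et eqxx /= big1 ?addr0 // => j ne.
  by rewrite Et; case: eqP => // e; case/eqP: ne; apply: val_inj.
rewrite big1 => [|j _]; first by rewrite [P`_i]nth_default // coef0; case: ifP.
rewrite Et; case: eqP => // e; by move: (ltn_ord j) hi; rewrite e; lia.
Qed.

Lemma low_coef (A : idomainType) (p : {poly A}) : p != 0 ->
  exists2 a, p`_a != 0 & forall s : nat, (s < a)%N -> p`_s = 0.
Proof.
move=> nz; have ex : exists i, p`_i != 0 by exists (size p).-1; rewrite -lead_coefE lead_coef_eq0.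
case: (ex_minnP ex) => i hi mi; exists i => // j ji.
by apply/eqP; apply: contraTT ji => /mi; rewrite -leqNgt.
Qed.

Lemma low_mul (A : idomainType) (p q : {poly A}) a b :
  (forall s : nat, (s < a)%N -> p`_s = 0) -> (forall s : nat, (s < b)%N -> q`_s = 0) ->
  (p * q)`_(a + b) = p`_a * q`_b /\ forall s : nat, (s < a + b)%N -> (p * q)`_s = 0.
Proof.
move=> ha hb; split=> [|s hs]; rewrite coefM.
  have la : (a < (a + b).+1)%N by rewrite ltnS leq_addr.
  rewrite (bigD1 (Ordinal la)) //= addKn big1 ?addr0 // => j ne.
  have [h|h|e] := ltngtP j a; [by rewrite ha ?mul0r | rewrite hb ?mulr0 // | by case/eqP: ne; apply: val_inj].
  by move: (ltn_ord j) h; clear; lia.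
apply: big1 => j _; have [h|h] := ltnP j a; first by rewrite ha ?mul0r.
by rewrite hb ?mulr0 //; move: (ltn_ord j) h hs; clear; lia.
Qed.

Lemma slope_subst_inj P : P != 0 -> slope_subst P != 0.
Proof.
apply: contraNneq => z; apply/eqP/polyP => i; rewrite coef0; apply/polyP => r; rewrite coef0.
have := slope_subst_coef P (r * n + V * i)%N i.
by rewrite z !coef0 leq_addl addnK dvdn_mull //= mulnK.
Qed.

Lemma slope_subst_size P s : (size ((slope_subst P)`_s)%R <= size P)%N.
Proof.
apply/leq_sizeP => j hj; rewrite slope_subst_coef.
by case: ifP => // _; rewrite [P`_j]nth_default // coef0.
Qed.

(** After the substitution the lowest form of [H] has degree [n] in [y] and a nonzero
    constant term, hence so has, in its own degree, the lowest form of a factor [d].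
    Its two extreme monomials have the same exponent of [t]: one exponent is divisible
    by [n], the other is congruent to [V] times the degree. *)
Lemma newton_slope (H d w : P2) (lam : {poly D0}) :
  lam != 0 -> lam%:P * H = d * w -> size H = n.+1 ->
  (H`_0)`_V != 0 -> (H`_n)`_0 != 0 ->
  (forall i r : nat, (H`_i)`_r != 0 -> (V * n <= n * r + V * i)%N) ->
  (n %| V * (size d).-1)%N.
Proof.
move=> l0 e sH h0 hn hr.
have H0 : H != 0 by rewrite -size_poly_eq0 sH.
have lH0 : lam%:P * H != 0 by rewrite mulf_neq0 ?polyC_eq0.
have /andP [d0 w0] : (d != 0) && (w != 0) by move: lH0; rewrite e mulf_eq0 negb_or.
have [a ha ha'] := low_coef (slope_subst_inj d0).
have [b hb hb'] := low_coef (slope_subst_inj w0).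
have lC0 : lam%:P != 0 :> P2 by rewrite polyC_eq0.
have [c hc hc'] := low_coef (slope_subst_inj lC0).
have Hl s : (s < V * n)%N -> (slope_subst H)`_s = 0.
  move=> hs; apply/polyP => i; rewrite coef0 slope_subst_coef; case: ifP => // /andP [le dv].
  apply/eqP; apply: contraTT hs => /hr; rewrite -leqNgt => h.
  by apply: leq_trans h _; rewrite [(n * _)%N]mulnC divnK // subnK.
have [e1 l1] := low_mul hc' Hl.
have [e2 l2] := low_mul ha' hb'.
rewrite -rmorphM e rmorphM in e1 l1.
have F0 : (slope_subst H)`_(V * n) `_0 != 0 by rewrite slope_subst_coef muln0 subn0 dvdn_mull //= mulnK.
have Fn : (slope_subst H)`_(V * n) `_n != 0 by rewrite slope_subst_coef leqnn subnn dvdn0 div0n.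
have F : (slope_subst H)`_(V * n) != 0 by apply: contraNneq F0 => ->; rewrite coef0.
have eq_ab : (a + b = c + V * n)%N.
  have [h|h|//] := ltngtP (a + b)%N (c + V * n)%N.
    by have /eqP := l1 _ h; rewrite e2 mulf_eq0 (negPf ha) (negPf hb).
  by have /eqP := l2 _ h; rewrite e1 mulf_eq0 (negPf hc) (negPf F).
have ef : (slope_subst lam%:P)`_c * (slope_subst H)`_(V * n) = (slope_subst d)`_a * (slope_subst w)`_b.
  by rewrite -e1 -eq_ab e2.
have sc : (size ((slope_subst lam%:P)`_c)%R <= 1)%N by apply: leq_trans (slope_subst_size _ _) (size_polyC_leq1 _).
have sFn : (n < size ((slope_subst H)`_(V * n)%N)%R)%N.
  by rewrite ltnNge; apply: contraNN Fn => h; rewrite nth_default.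
have sd0 : (slope_subst d)`_a`_0 != 0.
  have c0 : (slope_subst lam%:P)`_c`_0 != 0.
    by have := hc; rewrite {1}(size1_polyC sc) polyC_eq0.
  have : ((slope_subst lam%:P)`_c * (slope_subst H)`_(V * n))`_0 != 0 by rewrite coef0M mulf_neq0.
  by rewrite ef coef0M mulf_eq0 negb_or => /andP [].
have sde : size (slope_subst d)`_a = size d.
  have hs1 : size ((slope_subst lam%:P)`_c * (slope_subst H)`_(V * n)) = (size (slope_subst H)`_(V * n)).
    by rewrite (size1_polyC sc) mul_polyC size_scale // -polyC_eq0 -(size1_polyC sc).
  have hs2 := size_mul ha hb; rewrite -ef hs1 in hs2.
  have hs3 := size_mul d0 w0; rewrite -e mul_polyC size_scale // sH in hs3.
  have aux (sf sa sb sd sw : nat) : (sf = (sa + sb).-1 -> n.+1 = (sd + sw).-1 -> n < sf ->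
     sa <= sd -> sb <= sw -> sa = sd)%N by clear; lia.
  exact: (aux _ _ _ _ _ hs2 hs3 sFn (slope_subst_size d a) (slope_subst_size w b)).
have sdn : (slope_subst d)`_a`_(size d).-1 != 0 by rewrite -sde -lead_coefE lead_coef_eq0.
move: sd0 sdn; rewrite !slope_subst_coef muln0 subn0 /=; case: ifP; rewrite ?eqxx // => na _; case: ifP; rewrite ?eqxx // => /andP [le nb] _.
by move: nb; rewrite (dvdn_subr le na).
Qed.
End Newton.

(** * Irreducibility of Kummer equations *)

Section Lift.
Variables (A : comNzRingType) (D : idomainType) (tau : {rmorphism A -> {poly D}}) (N : nat).
Definition pC : {rmorphism {poly D} -> {poly {poly D}}} := map_poly polyC.
(** Adjoins the variable as [X s ^ N] with a fresh [X], over the coefficients [tau]. *)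
Definition lift : {rmorphism {poly A} -> {poly {poly D}}} := evx (pC \o tau) ('X%:P * 'X^N).

Lemma liftC a : lift a%:P = pC (tau a).
Proof. exact: evxC. Qed.
Lemma liftX : lift 'X = 'X%:P * 'X^N.
Proof. exact: evxX. Qed.

Lemma lift_coef Q t j : ((lift Q)`_t)`_j = (tau Q`_j * 'X^(N * j))`_t.
Proof.
have -> : lift Q = \sum_(i < size Q) pC (tau Q`_i) * (('X^i)%:P * 'X^(N * i)).
  rewrite /lift /= /evx /= /horner_eval (@horner_coef_wide _ (size Q)) ?size_poly //.
  apply: eq_bigr => i _; rewrite coef_map /= exprMn_comm; last exact: commr_polyXn.
  by rewrite -polyC_exp -exprM.
have Et i : ((pC (tau Q`_i) * (('X^i)%:P * 'X^(N * i)))`_t)`_j =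
    if i == j then (tau Q`_j * 'X^(N * j))`_t else 0.
  rewrite mulrA !coefMXn; case: leqP => h; last by rewrite coef0; case: eqP => // <-; rewrite h.
  rewrite coefMC coef_map coefCM coefXn eq_sym; case: eqP => [<-|_]; rewrite ?mulr1 ?mulr0 //.
  by rewrite leqNgt in h; rewrite (negPf h).
rewrite !coef_sum; have [hj|hj] := ltnP j (size Q).
  rewrite (bigD1 (Ordinal hj)) //= Et eqxx /= big1 ?addr0 // => i ne.
  by rewrite Et; case: eqP => // e; case/eqP: ne; apply: val_inj.
rewrite big1 => [|i _]; first by rewrite [Q`_j]nth_default // rmorph0 mul0r coef0.
by rewrite Et; case: eqP => // e; move: (ltn_ord i) hj; rewrite e; lia.
Qed.

Lemma lift_inj : (forall a, a != 0 -> tau a != 0) -> forall Q, Q != 0 -> lift Q != 0.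
Proof.
move=> h Q; rewrite -lead_coef_eq0 lead_coefE => /h; set j := (size Q).-1 => nz.
have [t ht _] := low_coef nz.
have := lift_coef Q (t + N * j)%N j; rewrite coefMXn ltnNge leq_addl /= addnK.
by move=> e; apply: contraNneq ht => z; rewrite -e z !coef0.
Qed.
End Lift.

Section KummerIrr.
Variables (k : fieldType) (L : fieldType) (io : {rmorphism k -> L}) (n : nat) (B : {poly {poly k}}).
Hypotheses (n0 : (0 < n)%N) (sB : (size B <= n)%N).
Notation U := {poly {poly k}}.
Definition kB : {poly U} := map_poly polyC B.
Definition kB' : {poly U} := map_poly (map_poly polyC) B.

(** Expansion of a polynomial at the point [r] of an extension. *)
Definition tau0 (r : L) : {rmorphism {poly k} -> {poly L}} := evx (polyC \o io) ('X + r%:P).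
Lemma tau0E r p : tau0 r p = map_poly io p \Po ('X + r%:P).
Proof. by rewrite /tau0 /= /evx /= /horner_eval /comp_poly -map_poly_comp. Qed.
Lemma tau0_inj r p : p != 0 -> tau0 r p != 0.
Proof.
move=> nz; rewrite tau0E -size_poly_eq0 size_comp_poly2.
  by rewrite size_poly_eq0 map_poly_eq0.
exact: size_XaddC.
Qed.

(** At [x = r] and [y' = s t ^ N] the Newton polygon of the cleared equation has the
    single slope [(N n + v) / n], with [N = v] large enough for convexity. *)
Lemma kummer_slope (r : L) v (d w : {poly {poly U}}) (lam : {poly U}) :
  (tau0 r B`_0)`_v != 0 -> (forall s : nat, (s < v)%N -> (tau0 r B`_0)`_s = 0) ->
  lam != 0 -> lam%:P * kummer_cleared n kB kB' = d * w -> (n %| (size d).-1 * v)%N.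
Proof.
move=> hv hv' l0 e.
have B0 : B`_0 != 0 by apply: contraNneq hv => ->; rewrite rmorph0 coef0.
pose N := v; pose ps1 := lift (tau0 r) 0; pose ps := lift ps1 N.
have psi : forall Q, Q != 0 -> ps Q != 0.
  by apply: lift_inj; apply: lift_inj; apply: tau0_inj.
pose H := map_poly ps (kummer_cleared n kB kB').
have psX : ps 'X = 'X%:P * 'X^N by apply: liftX.
have Kc i : (kummer_cleared n kB kB')`_i = (if i == n then kB' else 0) - 'X^n * (kB`_i)%:P.
  rewrite /kummer_cleared coefB coefMXn coefCM coef_map; congr (_ - _).
  rewrite coefC; case: (ltngtP i n) => h //; last by rewrite h subnn.
  by rewrite subn_eq0 leqNgt h.
have Hc i : H`_i = (if i == n then ps kB' else 0) - ('X^n)%:P * ps (kB`_i)%:P * 'X^(N * n).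
  have -> : H`_i = ps ((kummer_cleared n kB kB')`_i) by rewrite /H coef_map.
  rewrite Kc.
  rewrite (rmorphB ps) (rmorphM ps) (rmorphXn ps) psX /= exprMn_comm; last exact: commr_polyXn.
  rewrite -exprM -polyC_exp; congr (_ - _); first by case: eqP => // _; exact: rmorph0.
  by rewrite -!mulrA; congr (_ * _); exact: mulrC.
have kBi i : kB`_i = (B`_i)%:P by rewrite coef_map_id0 // rmorph0.
have psc i t : (ps (kB`_i)%:P)`_t = ((tau0 r B`_i)`_t)%:P%:P.
  rewrite kBi /ps liftC coef_map /=; congr (_%:P); rewrite /ps1 liftC coef_map //.
have Hc0 i : (n <= i)%N -> kB`_i = 0.
  by move=> h; rewrite kBi [B`_i]nth_default ?polyC0 // (leq_trans sB).
have sH : size H = n.+1.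
  have Hn : H`_n != 0.
    rewrite Hc eqxx Hc0 // polyC0 rmorph0 mulr0 mul0r subr0; apply: psi.
    by apply: contraNneq B0 => z; move: (congr1 (fun p : {poly U} => p`_0) z); rewrite coef_map coef0 => /eqP; rewrite map_polyC_eq0.
  apply/eqP; rewrite eqn_leq; apply/andP; split.
    apply/leq_sizeP => j hj; rewrite Hc gtn_eqF // Hc0 ?(ltnW hj) //.
    by rewrite polyC0 rmorph0 mulr0 mul0r subr0.
  by rewrite ltnNge; apply: contraNN Hn => h; rewrite nth_default.
pose V := (N * n + v)%N.
have eH : (ps lam)%:P * H = map_poly ps d * map_poly ps w.
  by rewrite -rmorphM -e rmorphM /= map_polyC.
have sd : size (map_poly ps d) = size d.
  apply: size_map_poly_id0; have : d != 0.
    apply/eqP => d0; move: eH; rewrite d0 rmorph0 mul0r => /eqP.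
    by rewrite mulf_eq0 polyC_eq0 (negPf (psi _ l0)) /= => /eqP z; move: sH; rewrite z size_poly0.
  by rewrite -lead_coef_eq0; apply: psi.
have := newton_slope (V := V) n0 (psi _ l0) eH sH; rewrite sd /V => NW.
have : (n %| (N * n + v) * (size d).-1)%N.
  apply: NW.
  - rewrite Hc (ltn_eqF n0) sub0r coefN oppr_eq0 coefMXn ltnNge leq_addr /= addKn.
    by rewrite coefCM psc mulf_neq0 // ?polyC_eq0 // -size_poly_eq0 size_polyXn.
  - rewrite Hc eqxx Hc0 // polyC0 rmorph0 mulr0 mul0r subr0.
    apply: contraNneq B0 => z; have := lift_coef ps1 N kB' 0 0.
    rewrite -/ps z coef0 muln0 expr0 mulr1 coef_map /= => e0.
    apply/eqP/polyP => i; rewrite coef0.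
    have := lift_coef (tau0 r) 0 (map_poly polyC B`_0) 0 i.
    rewrite -/ps1 -e0 coef0 mul0n expr0 mulr1 coef_map_id0 ?rmorph0 // tau0E map_polyC /= comp_polyC coefC /=.
    by move/esym/eqP; rewrite fmorph_eq0 => /eqP.
  - move=> i s; rewrite Hc; have [->|ne] := eqVneq i n; first by move=> _; rewrite leq_addl.
    rewrite sub0r coefN oppr_eq0 coefMXn; case: ltnP => h; first by rewrite eqxx.
    rewrite coefCM psc; case: i ne => [|i] ne h0.
      rewrite muln0 addn0 mulnC leq_mul2l; apply/orP; right.
      rewrite leqNgt; apply: contraNN h0 => lt; rewrite hv'; last by move: lt h; clear; lia.
      by rewrite !polyC0 mulr0.
    have aux : (N * n <= s -> 0 < n -> (N * n + v) * n <= n * s + (N * n + v) * i.+1)%N.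
      rewrite /N; clear; nia.
    exact: aux.
have h1 : (n %| N * n * (size d).-1)%N by rewrite -mulnA dvdn_mull // dvdn_mulr.
by rewrite mulnDl (dvdn_addr _ h1) mulnC.
Qed.

(** The degree of a factor times [n], [v1] and [v2] is divisible by [n]. *)
Lemma kummer_irr (d w : {poly {poly U}}) (lam : {poly U}) r1 v1 r2 v2 :
  (tau0 r1 B`_0)`_v1 != 0 -> (forall s : nat, (s < v1)%N -> (tau0 r1 B`_0)`_s = 0) ->
  (tau0 r2 B`_0)`_v2 != 0 -> (forall s : nat, (s < v2)%N -> (tau0 r2 B`_0)`_s = 0) ->
  gcdn n (gcdn v1 v2) = 1%N ->
  lam != 0 -> lam%:P * kummer_cleared n kB kB' = d * w -> (1 < size d)%N -> (n < size d)%N.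
Proof.
move=> h1 h1' h2 h2' g l0 e sd.
have d1 := kummer_slope h1 h1' l0 e; have d2 := kummer_slope h2 h2' l0 e.
have : (n %| (size d).-1)%N.
  rewrite -[X in (_ %| X)%N]muln1 -g !muln_gcdr dvdn_gcd dvdn_gcd d1 d2 andbT.
  by rewrite dvdn_mull.
move/dvdn_leq => /(_ _) h; have h3 : (0 < (size d).-1)%N by move: sd; clear; case: (size d) => [|[]].
by move: (h h3) sd; clear; case: (size d).
Qed.
End KummerIrr.

Lemma coefCXn (A : nzRingType) (p : A) i i0 : (p%:P * 'X^i)`_i0 = if i0 == i then p else 0.
Proof. by rewrite coefCM coefXn; case: eqP; rewrite ?mulr1 ?mulr0. Qed.

Lemma rmorph_poly_eq (A S : comNzRingType) (h1 h2 : {rmorphism {poly A} -> S}) :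
  (forall a, h1 a%:P = h2 a%:P) -> h1 'X = h2 'X -> h1 =1 h2.
Proof.
move=> hC hX; elim/poly_ind => [|p c IH]; first by rewrite !rmorph0.
by rewrite !rmorphD !rmorphM /= IH hX hC.
Qed.

Lemma rmorph_kummer (A S : nzRingType) (h : {rmorphism A -> S}) n (y g b : A) :
  h (y ^+ n - g * b) = h y ^+ n - h g * h b.
Proof. by rewrite rmorphB rmorphM rmorphXn. Qed.

Section EnProps.
Variables (k : finFieldType) (U : idomainType) (cU : {rmorphism k -> U}) (X X' : U).
Variables (n T l m : nat) (E : aux k T l n m).
Notation UG := {poly U}.
Notation S4 := {poly UG}.
Notation S5 := {poly S4}.

Definition nest (e : U) (t i j : nat) : S5 := ((e%:P * 'X^t)%:P * 'X^j)%:P * 'X^i.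

Lemma nest_gen (A0 A1 A2 A3 A4 : comNzRingType) (j1 : {rmorphism A0 -> A1})
   (j2 : {rmorphism A1 -> A2}) (j3 : {rmorphism A2 -> A3}) (j4 : {rmorphism A3 -> A4})
   (e : A0) (x x' : A1) (g : A2) (y' : A3) (y : A4) t a i b j :
  j4 (j3 (j2 (j1 e)))
    * (j4 (j3 g) ^+ t * j4 (j3 (j2 x)) ^+ a * y ^+ i * j4 (j3 (j2 x')) ^+ b * j4 y' ^+ j)
  = j4 (j3 (j2 (j1 e * x ^+ a * x' ^+ b) * g ^+ t) * y' ^+ j) * y ^+ i.
Proof. by rewrite !rmorphM !rmorphXn /=; ring. Qed.

Lemma aux_nested_eq : aux_nested cU X X' E =
  \sum_(u : idx T l n m) let: (t, a, i, b, j) := u in nest (cU (E u) * X ^+ a * X' ^+ b) t i j.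
Proof.
apply: eq_bigr => -[[[[t a] i] b] j] _.
exact: (nest_gen cU polyC polyC polyC).
Qed.

Lemma aux_nested_size : (size (aux_nested cU X X' E) <= n)%N.
Proof.
rewrite aux_nested_eq; apply: leq_trans (size_sum _ _ _) _; apply/bigmax_leqP => -[[[[t a] i] b] j] _.
apply/leq_sizeP => s hs; rewrite /nest coefCXn gtn_eqF //; exact: leq_trans hs.
Qed.

Lemma aux_nested_sizei s : (size ((aux_nested cU X X' E)`_s)%R <= n)%N.
Proof.
rewrite aux_nested_eq coef_sum; apply: leq_trans (size_sum _ _ _) _; apply/bigmax_leqP => -[[[[t a] i] b] j] _.
rewrite /nest coefCXn; case: eqP => _; last by rewrite size_poly0.
apply/leq_sizeP => r hr; rewrite coefCXn gtn_eqF //; exact: leq_trans hr.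
Qed.

Lemma aux_nested_coef t i j : (aux_nested cU X X' E)`_i`_j`_t =
  \sum_(u : idx T l n m) let: (t1, a, i1, b, j1) := u in
    if [&& i == i1, j == j1 & t == t1] then cU (E u) * X ^+ a * X' ^+ b else 0.
Proof.
rewrite aux_nested_eq !coef_sum; apply: eq_bigr => -[[[[t1 a] i1] b] j1] _.
rewrite /nest coefCXn; case: eqP => /= _; last by rewrite !coef0.
rewrite coefCXn; case: eqP => /= _; last by rewrite !coef0.
by rewrite coefCXn; case: eqP.
Qed.
End EnProps.

Lemma aux_nested_neq0 (k : finFieldType) n T l m (E : aux k T l n m) :
  (exists u, E u != 0) -> aux_nested (cU2 k) 'X%:P 'X E != 0.
Proof.
case=> -[[[[t a] i] b] j]; apply: contraNneq => z.
have := aux_nested_coef (cU2 k) 'X%:P 'X E t i j; rewrite z !coef0 => /esym h.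
have := congr1 (fun w : {poly {poly k}} => w`_b`_a) h.
rewrite !coef0 !coef_sum (bigD1 (t, a, i, b, j)) //= big1 => [|[[[[t1 a1] i1] b1] j1] ne].
  rewrite !eqxx addr0 -mulrA -polyC_exp mulrA -polyCM coefCXn eqxx coefCXn eqxx.
  by move=> ->.
case: ifP => [/and3P [/eqP ei /eqP ej /eqP et]|_]; last by rewrite !coef0.
rewrite -polyC_exp -polyCM coefCXn; case: eqP => [eb|_]; last by rewrite !coef0.
rewrite coefCXn; case: eqP => [ea|_] //; case/eqP: ne.
by congr (_, _, _, _, _); apply: val_inj.
Qed.

Section KummerN2.
Variables (k : finFieldType) (n : nat) (B : {poly {poly k}}).
Definition kummer_curve : {poly {poly {poly k}}} := 'X^n - 'X%:P%:P * map_poly (map_poly polyC) B.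

Section Abs.
Variables (U : idomainType) (cU : {rmorphism k -> U}) (X X' : U).

Lemma jGX : jG cU 'X = 'X.
Proof. exact: map_polyX. Qed.
Lemma jGC (a : k) : jG cU a%:P = (cU a)%:P.
Proof. exact: map_polyC. Qed.

Lemma fy'_kf : fy' cU X' kummer_curve = kummer_xy1 n (map_poly (evx cU X') B).
Proof.
have e : fy' cU X' (map_poly (map_poly polyC) B) = map_poly polyC (map_poly (evx cU X') B).
  apply/polyP => i; rewrite /fy' !coef_map; move: B`_i => p.
  rewrite -[LHS]/((evx (jG cU) X'%:P \o map_poly polyC) p) -[RHS]/((polyC \o evx cU X') p).
  apply: rmorph_poly_eq => [a|] /=.
    by rewrite map_polyC /= !evxC jGC.
  by rewrite map_polyX !evxX.
have eX : fy' cU X' 'X = 'X by exact: map_polyX.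
have eg : fy' cU X' 'X%:P%:P = 'X%:P.
  by rewrite /fy' /= map_polyC /= evxC jGX.
transitivity (fy' cU X' 'X ^+ n - fy' cU X' 'X%:P%:P * fy' cU X' (map_poly (map_poly polyC) B)).
  exact: (rmorph_kummer (fy' cU X')).
by rewrite eX eg e.
Qed.

Lemma fy_kf : fy cU X kummer_curve = kummer_xy n (map_poly (evx cU X) B).
Proof.
have e : fy cU X (map_poly (map_poly polyC) B) = map_poly (cA _) (map_poly (evx cU X) B).
  apply/polyP => i; rewrite /fy !coef_map; move: B`_i => p.
  rewrite -[LHS]/((evx (jP cU) X%:P%:P \o map_poly polyC) p) -[RHS]/((cA _ \o evx cU X) p).
  apply: rmorph_poly_eq => [a|] /=.
    by rewrite map_polyC /= !evxC /jP /= jGC.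
  by rewrite map_polyX !evxX.
have eX : fy cU X 'X = 'X by exact: map_polyX.
have eg : fy cU X 'X%:P%:P = 'X%:P%:P.
  by rewrite /fy /= map_polyC /= evxC /jP /= jGX.
transitivity (fy cU X 'X ^+ n - fy cU X 'X%:P%:P * fy cU X (map_poly (map_poly polyC) B)).
  exact: (rmorph_kummer (fy cU X)).
by rewrite eX eg e.
Qed.
End Abs.

Variables (L : fieldType) (io : {rmorphism k -> L}).
Hypotheses (n0 : (0 < n)%N) (sB : (size B <= n)%N).

(** Only the constant term [B`_0] in [y] enters, through two of its root orders. *)
Theorem kummer_N2 T l m (E : aux k T l n m) r1 v1 r2 v2 :
  (tau0 io r1 B`_0)`_v1 != 0 -> (forall s : nat, (s < v1)%N -> (tau0 io r1 B`_0)`_s = 0) ->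
  (tau0 io r2 B`_0)`_v2 != 0 -> (forall s : nat, (s < v2)%N -> (tau0 io r2 B`_0)`_s = 0) ->
  gcdn n (gcdn v1 v2) = 1%N -> (exists u, E u != 0) -> N2 (cU2 k) 'X%:P 'X E kummer_curve != 0.
Proof.
move=> h1 h1' h2 h2' g nz.
have eb : map_poly (evx (cU2 k) 'X%:P) B = kB B.
  apply/polyP => i; rewrite /kB !coef_map.
  move: B`_i => p.
  have e : evx (cU2 k) 'X%:P =1 polyC.
    apply: rmorph_poly_eq => [a|].
      exact: evxC.
    exact: evxX.
  exact: e.
have eb' : map_poly (evx (cU2 k) 'X) B = kB' B.
  apply/polyP => i; rewrite /kB' !coef_map; apply: (rmorph_poly_eq (h1 := evx _ _) (h2 := map_poly polyC)) => [a|] /=.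
    by rewrite evxC map_polyC.
  by rewrite evxX map_polyX.
have B0 : B`_0 != 0 by apply: contraNneq h1 => ->; rewrite rmorph0 coef0.
rewrite /N2 /R1 fy'_kf fy_kf eb eb'; apply: kummer_norm.
- by apply: leq_trans (size_poly _ _) sB.
- by apply: leq_trans (size_poly _ _) sB.
- rewrite coef_map /=; apply: contraNneq B0 => z; apply/eqP/polyP => i; rewrite coef0.
  by have := congr1 (fun w : {poly {poly k}} => w`_i) z; rewrite coef_map coef0 /= => /eqP; rewrite polyC_eq0 => /eqP.
- move=> d w lam l0 e; exact: (kummer_irr n0 sB h1 h1' h2 h2' g l0 e).
- exact: aux_nested_neq0.
- exact: aux_nested_size.
- exact: aux_nested_sizei.
Qed.
End KummerN2.

(** * Points on Kummer curves *)

Lemma card_fibres (T1 T2 : finType) (A : {set T1 * T2}) : #|A| = (\sum_x #|[set y | (x, y) \in A]|)%N.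
Proof.
rewrite -sum1_card; under [RHS]eq_bigr do rewrite -sum1_card.
under [RHS]eq_bigr => x _ do under eq_bigl => y do rewrite inE.
by rewrite pair_big_dep /=; apply: eq_bigl => -[x y].
Qed.

Lemma deriv_kummer (A : comNzRingType) n (g : A) (p : {poly A}) :
  ('X^n - g%:P * p)^`() = 'X^(n.-1) *+ n - g%:P * p^`().
Proof. by rewrite derivB derivXn derivM derivC mul0r add0r. Qed.

Lemma rmorph_kummer' (A S : nzRingType) (h : {rmorphism A -> S}) m n (y g b : A) :
  h (y ^+ m *+ n - g * b) = h y ^+ m *+ n - h g * h b.
Proof. by rewrite rmorphB rmorphM rmorphMn rmorphXn. Qed.

Section KummerCount.
Variable k : finFieldType.
Notation q := #|k|.
Implicit Types (B : {poly {poly k}}) (c x y : k).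

Definition bev (B : {poly {poly k}}) (x y : k) : k := (map_poly (horner_eval x) B).[y].
Definition kpts n (B : {poly {poly k}}) (c : k) : {set k * k} :=
  [set u | (u.2 != 0) && (u.2 ^+ n == c * bev B u.1 u.2)].

Lemma roots_le (p : {poly k}) d : p != 0 -> (size p <= d.+1)%N -> (#|[set y | root p y]| <= d)%N.
Proof.
move=> nz sp; rewrite -ltnS; apply: leq_trans sp; rewrite cardE; apply: max_poly_roots nz _ (enum_uniq _).
by apply/allP => y; rewrite mem_enum inE.
Qed.

Lemma zeros_le (S : {poly {poly k}}) n D : S != 0 -> (size S <= n.+1)%N -> (forall i : nat, (size (S`_i)%R <= D.+1)%N) ->
  (#|[set u : k * k | bev S u.1 u.2 == 0%R]| <= (n + D) * q)%N.
Proof.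
move=> nz sS hD; rewrite card_fibres.
pose bad := [set x | map_poly (horner_eval x) S == 0].
have hb : (#|bad| <= D)%N.
  pose i := (size S).-1; have hi : S`_i != 0 by rewrite -lead_coefE lead_coef_eq0.
  apply: leq_trans (roots_le hi (hD i)); apply/subset_leq_card/subsetP => x; rewrite !inE => /eqP z.
  by rewrite rootE -[_.[x]]/(horner_eval x _) -coef_map z coef0.
apply: leq_trans (_ : \sum_x (n + q * (x \in bad)) <= _)%N; last first.
  rewrite big_split /= sum_nat_const -big_distrr /= -big_mkcond /= sum1_card.
  by rewrite mulnDl [(n * _)%N]mulnC leq_add2l mulnC leq_mul2r hb orbT.
apply: leq_sum => x _; have [hx|hx] := boolP (x \in bad).
  by rewrite muln1 (leq_trans (max_card _)) // leq_addl.
rewrite muln0 addn0; rewrite inE in hx.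
have h : (size (map_poly (horner_eval x) S) <= n.+1)%N by apply: leq_trans (size_poly _ _) sS.
apply: leq_trans (roots_le hx h); apply/subset_leq_card/subsetP => y.
by rewrite !inE.
Qed.

Lemma kpts_le n B c : (0 < n)%N -> (size B <= n)%N -> (#|kpts n B c| <= n * q)%N.
Proof.
move=> n0 sB; rewrite card_fibres.
apply: leq_trans (_ : \sum_(x : k) n <= _)%N; last by rewrite sum_nat_const mulnC.
apply: leq_sum => x _; pose P : {poly k} := 'X^n - c *: map_poly (horner_eval x) B.
have sP : (size (c *: map_poly (horner_eval x) B : {poly k})%R < n.+1)%N.
  rewrite ltnS (leq_trans (size_scale_leq _ _)) // (leq_trans (size_poly _ _)) //.
have hs : size P = n.+1 by rewrite /P size_polyDl ?size_polyN size_polyXn.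
have P0 : P != 0 by rewrite -size_poly_eq0 hs.
have := @roots_le P n P0; rewrite hs => /(_ (leqnn _)); apply: leq_trans.
apply/subset_leq_card/subsetP => y; rewrite !inE /= => /andP [_ /eqP e].
by rewrite rootE hornerD hornerN hornerZ hornerXn e subrr.
Qed.

Lemma fpt_evx c x y p : fpt c x y (map_poly (map_poly polyC) p) = bev p x y.
Proof.
rewrite /fpt /ev2 /= /horner_eval /bev; congr (_.[_]); apply/polyP => i; rewrite !coef_map /=.
rewrite /evx /= /horner_eval; congr (_.[_]); apply/polyP => j.
by rewrite (coef_map (horner_eval c)) coef_map /= /horner_eval hornerC.
Qed.

Lemma fptY c x y : fpt c x y 'X = y.
Proof. by rewrite /fpt ev2Y. Qed.
Lemma fptg c x y : fpt c x y 'X%:P%:P = c.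
Proof. by rewrite /fpt ev2C evxC /= /horner_eval hornerX. Qed.

Lemma fpt_kf n B c x y : fpt c x y (kummer_curve n B) = y ^+ n - c * bev B x y.
Proof.
transitivity (fpt c x y 'X ^+ n - fpt c x y 'X%:P%:P * fpt c x y (map_poly (map_poly polyC) B)).
  exact: (rmorph_kummer [the {rmorphism _ -> _} of fpt c x y]).
by rewrite fptY fptg fpt_evx.
Qed.

(** On the curve [y ^ n = c B], [y] times the derivative of the equation in [y] is
    [c] times this polynomial, which does not involve [c]. *)
Definition kummer_sing n (B : {poly {poly k}}) : {poly {poly k}} := B *+ n - 'X * B^`().

Lemma fpt_kf' n B c x y : y ^+ n = c * bev B x y -> fpt c x y (kummer_curve n B)^`() * y = c * bev (kummer_sing n B) x y.
Proof.
move=> e; pose h : {rmorphism {poly {poly k}} -> k} := horner_eval y \o map_poly (horner_eval x).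
have hE p : bev p x y = h p by [].
have hX : h 'X = y by rewrite /h /= map_polyX /horner_eval hornerX.
have -> : bev (kummer_sing n B) x y = bev B x y *+ n - y * bev B^`() x y.
  by rewrite !hE /kummer_sing rmorphB rmorphM rmorphMn hX.
have -> : (kummer_curve n B)^`() = 'X^(n.-1) *+ n - 'X%:P%:P * map_poly (map_poly polyC) B^`().
  rewrite -deriv_map; exact: deriv_kummer.
have -> : fpt c x y ('X^(n.-1) *+ n - 'X%:P%:P * map_poly (map_poly polyC) B^`()) = y ^+ n.-1 *+ n - c * bev B^`() x y.
  transitivity (fpt c x y 'X ^+ n.-1 *+ n - fpt c x y 'X%:P%:P * fpt c x y (map_poly (map_poly polyC) B^`())).
    exact: (rmorph_kummer' [the {rmorphism _ -> _} of fpt c x y]).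
  by rewrite fptY fptg fpt_evx.
case: n e => [|n] e; first by rewrite !mulr0n !sub0r; ring.
by rewrite mulrBl mulrBr mulrnAl mulrnAr -e exprSr; ring.
Qed.

Definition sing_points n B (c : k) : nat := #|[set u | (u \in kpts n B c) && (bev (kummer_sing n B) u.1 u.2 == 0%R)]|.

(** A point with [y != 0] lies on a single curve of the family, so that the singular
    points of all these curves are distinct zeros of one polynomial. *)
Lemma sum_sing_points n B D : (0 < n)%N -> (size B <= n)%N -> (forall i : nat, (size (B`_i)%R <= D.+1)%N) ->
  kummer_sing n B != 0 -> (\sum_(c : k) sing_points n B c <= (n + D) * q)%N.
Proof.
move=> n0 sB hD nz.
have sS : (size (kummer_sing n B) <= n.+1)%N.
  apply/leq_sizeP => j hj; rewrite /kummer_sing coefB coefMn coefXM coef_deriv.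
  rewrite [B`_j]nth_default ?mul0rn ?sub0r; last by apply: leq_trans (ltnW hj).
  case: j hj => [|j] hj /=; first by rewrite oppr0.
  by rewrite [B`_j.+1]nth_default ?mul0rn ?oppr0 // (leq_trans sB) // ltnW.
have hS i : (size ((kummer_sing n B)`_i)%R <= D.+1)%N.
  have -> : (kummer_sing n B)`_i = B`_i *+ n - B`_i *+ i.
    by rewrite /kummer_sing coefB coefMn coefXM coef_deriv; case: i => [|i].
  rewrite -!scaler_nat (leq_trans (size_polyD _ _)) // size_polyN geq_max.
  by rewrite !(leq_trans (size_scale_leq _ _)).
apply: leq_trans (zeros_le nz sS hS).
rewrite -[leqRHS]sum1_card.
have -> : (\sum_c sing_points n B c = \sum_c \sum_(u in [set u | (u \in kpts n B c) && (bev (kummer_sing n B) u.1 u.2 == 0%R)]) 1)%N.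
  by apply: eq_bigr => c _; rewrite sum1_card.
rewrite (exchange_big_dep predT) //= [X in (_ <= X)%N]big_mkcond /=; apply: leq_sum => u _.
rewrite inE; case: eqP => hu; last first.
  rewrite big_pred0 // => c; rewrite !inE; by move/eqP/negPf: hu => ->; rewrite andbF.
rewrite sum1dep_card; apply: leq_trans (_ : #|[set (u.2 ^+ n / bev B u.1 u.2)%R]| <= _)%N; last by rewrite cards1.
apply/subset_leq_card/subsetP => c; rewrite !inE hu eqxx andbT => /andP [u0 /eqP e].
have b0 : bev B u.1 u.2 != 0.
  by apply: contraNneq u0 => z; move/eqP: e; rewrite z mulr0 expf_eq0 n0.
by rewrite e mulfK.
Qed.

Lemma kpts_pts n B c : c != 0 -> (#|kpts n B c| <= \sum_x size (pts c (kummer_curve n B) x) + sing_points n B c)%N.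
Proof.
move=> c0.
pose G := [set u in kpts n B c | bev (kummer_sing n B) u.1 u.2 != 0].
have -> : #|kpts n B c| = (#|G| + sing_points n B c)%N.
  rewrite addnC -(cardsID [set u | bev (kummer_sing n B) u.1 u.2 == 0]) /sing_points.
  by congr (_ + _)%N; apply: eq_card => u; rewrite !inE // andbC.
rewrite leq_add2r card_fibres; apply: leq_sum => x _.
rewrite /pts -(size_map id) map_id cardE; apply: uniq_leq_size; first exact: enum_uniq.
move=> y; rewrite mem_enum !inE mem_filter mem_enum andbT /= => /andP [/andP [y0 /eqP e] hS].
rewrite fpt_kf e subrr eqxx /=.
have := fpt_kf' e; apply: contra_eq_neq => ->; rewrite mul0r eq_sym mulf_neq0 //.
Qed.

Lemma pfrob_inj p : p \in [pchar k] -> injective (fun y : k => y ^+ p).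
Proof.
move=> pc x y e; apply: (fmorph_inj (pFrobenius_aut pc)); exact: e.
Qed.

(** When the derivative vanishes identically the curve is a curve in [y ^ p], and
    [y |-> y ^ p] is injective on [k]. *)
Lemma kpts_reduce n B c p : p \in [pchar k] -> B`_0 != 0 -> (0 < n)%N -> (size B <= n)%N -> kummer_sing n B = 0 ->
  exists n1 (B1 : {poly {poly k}}), [/\ n = (p * n1)%N, B1`_0 = B`_0, (size B1 <= n1)%N,
    forall i : nat, exists j : nat, B1`_i = B`_j & forall c, (#|kpts n B c| <= #|kpts n1 B1 c|)%N].
Proof.
move=> pc B0 n0 sB z; have p0 := prime_gt0 (pcharf_prime pc).
have hz i : B`_i != 0 -> (n%:R == i%:R :> k).
  move=> hi; have := congr1 (fun w : {poly {poly k}} => w`_i) z.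
  have -> : (kummer_sing n B)`_i = (n%:R - i%:R : k) *: B`_i.
    rewrite scalerBl !scaler_nat /kummer_sing coefB coefMn coefXM coef_deriv; case: i {hi} => [|i] //.
  by rewrite coef0 => /eqP; rewrite scaler_eq0 (negPf hi) orbF subr_eq0.
have pn : (p %| n)%N by rewrite (dvdn_pcharf pc); exact: (hz 0 B0).
have pi i : B`_i != 0 -> (p %| i)%N.
  by move=> /hz; rewrite (dvdn_pcharf pc) => /eqP <-; rewrite -(dvdn_pcharf pc).
pose n1 := (n %/ p)%N; pose B1 : {poly {poly k}} := \poly_(i < n1) B`_(p * i).
have en : n = (p * n1)%N by rewrite mulnC divnK.
have n10 : (0 < n1)%N by rewrite -(ltn_pmul2l p0) muln0 -en.
have B1c i : B1`_i = B`_(p * i).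
  rewrite coef_poly; case: ltnP => // h; rewrite nth_default // (leq_trans sB) // en leq_mul2l h orbT //.
exists n1, B1; split=> //.
- by rewrite B1c muln0.
- exact: size_poly.
- by move=> i; exists (p * i)%N; rewrite B1c.
move=> c1; pose F (u : k * k) := (u.1, u.2 ^+ p).
have Fi : injective F by move=> [x y] [x' y'] [-> /(pfrob_inj pc) ->].
rewrite -(card_imset _ Fi); apply/subset_leq_card/subsetP => _ /imsetP [[x y] hu ->].
move: hu; rewrite !inE /= => /andP [y0 /eqP e]; rewrite expf_neq0 //= -exprM -en e.
have -> : bev B x y = bev B1 x (y ^+ p) => //.
rewrite /bev; have -> : map_poly (horner_eval x) B = map_poly (horner_eval x) B1 \Po 'X^p.
  apply/polyP => i; rewrite coef_map coef_comp_poly_Xn // coef_map B1c; case: ifP => hi.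
    by rewrite mulnC divnK.
  by have [->|/pi] := eqVneq B`_i 0; [rewrite /= ?horner0 ?rmorph0 /horner_eval ?horner0 | rewrite hi].
by rewrite horner_comp hornerXn.
Qed.
End KummerCount.

Section KummerBound.
Variables (k : finFieldType) (L : fieldType) (io : {rmorphism k -> L}).
Notation q := #|k|.
Implicit Type B : {poly {poly k}}.

(** [v] is the multiplicity of some element of [L] as a root of [b]. *)
Definition root_order (b : {poly k}) v : Prop :=
  exists r, (tau0 io r b)`_v != 0 /\ forall s : nat, (s < v)%N -> (tau0 io r b)`_s = 0.

(** A bound by [5/4 q] up to an error [dd] that is small on average. Recording the error
    in this form absorbs both the exceptional parameters and the singular points. *)
Definition kbound n (B : {poly {poly k}}) C : Prop :=
  exists dd : k -> nat, (\sum_c dd c <= C * q)%N /\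
    forall c, c != 0 -> (4 * #|kpts n B c| <= 5 * q + C + 4 * dd c)%N.

Lemma kbound_mono n B C C' : (C <= C')%N -> kbound n B C -> kbound n B C'.
Proof.
move=> le [dd [h1 h2]]; exists dd; split; first by rewrite (leq_trans h1) // leq_mul2r le orbT.
by move=> c c0; apply: leq_trans (h2 c c0) _; rewrite leq_add2r leq_add2l.
Qed.

(** Below this size of the field the trivial bound is absorbed by the constant. *)
Definition kummer_threshold n D := (n + stM n D + Xde n D (stl n D)).+1.
Definition kummer_const n D := (n + D + Gam n D (stT n D) * n + (stl n D + 1) + 4 * (n * kummer_threshold n D))%N.

Lemma kbound_separable n D B v1 v2 : (0 < n)%N -> (0 < D)%N -> (size B <= n)%N ->
  (forall i : nat, (size (B`_i)%R <= D.+1)%N) -> kummer_sing n B != 0 ->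
  root_order B`_0 v1 -> root_order B`_0 v2 -> gcdn n (gcdn v1 v2) = 1%N ->
  kbound n B (kummer_const n D).
Proof.
move=> n0 D0 sB hD nz [r1 [h1 h1']] [r2 [h2 h2']] g.
have [small|big] := ltnP q (kummer_threshold n D).
  exists (fun=> 0%N); split; first by rewrite sum_nat_const muln0.
  move=> c c0; have h := kpts_le c n0 sB.
  have h' : (n * q <= n * kummer_threshold n D)%N by rewrite leq_mul2l (ltnW small) orbT.
  have aux (a b m x y : nat) : (a <= b -> b <= m -> 4 * a <= 5 * x + (y + 4 * m) + 4 * 0)%N by clear; lia.
  by rewrite /kummer_const; apply: aux h h'.
have [hn hM hX] : [/\ n <= q, stM n D <= q & Xde n D (stl n D) < q]%N.
  have aux (a b c d : nat) : ((a + b + c).+1 <= d -> [/\ a <= d, b <= d & c < d])%N by clear; move=> h; split; lia.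
  exact: (aux _ _ _ _ big).
have P0 : (size (- ('X%:P%:P * map_poly (map_poly polyC) B) : {poly {poly {poly k}}})%R < n.+1)%N.
  rewrite size_polyN ltnS mul_polyC (leq_trans (size_scale_leq _ _)) //.
  by apply: leq_trans (size_poly _ _) sB.
have fm : kummer_curve n B \is monic.
  by rewrite monicE /kummer_curve lead_coefDl ?lead_coefXn // size_polyXn.
have sf : size (kummer_curve n B) = n.+1 by rewrite /kummer_curve size_polyDl size_polyXn.
have fc i : (i < n)%N -> (kummer_curve n B)`_i = - ('X%:P * map_poly polyC B`_i).
  by move=> hi; rewrite /kummer_curve coefB coefXn (ltn_eqF hi) sub0r coefCM coef_map.
have hsx i : (i < n)%N -> (size ((kummer_curve n B)`_i)%R <= D.+1)%N.
  move=> hi; rewrite fc // size_polyN mul_polyC (leq_trans (size_scale_leq _ _)) //.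
  exact: leq_trans (size_poly _ _) (hD i).
have hsg i j : (i < n)%N -> (size (((kummer_curve n B)`_i)`_j)%R <= D.+1)%N.
  move=> hi; rewrite fc // coefN size_polyN coefCM coef_map /= mulrC mul_polyC.
  by apply: leq_trans (size_scale_leq _ _) _; rewrite size_polyX ltnS.
have hsg' i j : (size (((kummer_curve n B)`_i)`_j)%R <= D.+1)%N.
  have [hi|hi|->] := ltngtP i n; first exact: hsg.
    by rewrite [(kummer_curve n B)`_i]nth_default ?sf // coef0 size_poly0.
  have -> : (kummer_curve n B)`_n = 1 by have := monicP fm; rewrite lead_coefE sf.
  by rewrite coef1; case: j => [|j]; rewrite ?size_poly1 ?size_poly0.
have [E nzE hE] := stepanov n0 D0 fm sf hsx hsg' hn hM.
have N2nz := kummer_N2 n0 sB h1 h1' h2 h2' g nzE.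
have fb := few_bad n0 fm sf hsx hsg N2nz hX.
set Bad := [set c | _] in fb.
exists (fun c => if c \in Bad then n * q else sing_points n B c)%N; split.
  apply: leq_trans (_ : \sum_c (sing_points n B c + n * q * (c \in Bad)) <= _)%N.
    by apply: leq_sum => c _; case: ifP => _; rewrite ?muln1 ?muln0 ?addn0 ?leq_addl.
  rewrite big_split /= -big_distrr /= -big_mkcond /= sum1_card.
  apply: leq_trans (_ : (n + D) * q + n * q * Gam n D (stT n D) <= _)%N.
    by apply: leq_add; [exact: sum_sing_points | rewrite leq_mul2l fb orbT].
  have aux a b x y z w : ((a + b) * w + a * w * x <= (a + b + x * a + y + z) * w)%N by clear; nia.
  exact: aux.
move=> c c0; case: ifP => hc.
  have h := kpts_le c n0 sB.
  have aux a b x y : (a <= b -> 4 * a <= 5 * x + y + 4 * b)%N by clear; lia.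
  exact: aux.
have h := hE c; rewrite inE in hc; move: (h (negbT hc)) => {}h.
have h3 := kpts_pts n B c0.
have aux a b c1 x s d w y : (4 * b <= 5 * x + s + 1 -> a <= b + c1 -> 4 * a <= 5 * x + (d + w + (s + 1) + y) + 4 * c1)%N by clear; lia.
exact: aux h h3.
Qed.

(** Induction on [n], replacing [y ^ p] by [y] until the derivative is not zero;
    the constant term and its root orders are not affected. *)
Theorem kbound_kummer n D B v1 v2 : (0 < n)%N -> (0 < D)%N -> (size B <= n)%N ->
  (forall i : nat, (size (B`_i)%R <= D.+1)%N) -> B`_0 != 0 ->
  root_order B`_0 v1 -> root_order B`_0 v2 -> gcdn n (gcdn v1 v2) = 1%N ->
  kbound n B (\sum_(i < n.+1) kummer_const i D).
Proof.
have [p pp pc] := finPcharP k.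
elim/ltn_ind: n B => n IH B n0 D0 sB hD B0 o1 o2 g.
have [z|nz] := eqVneq (kummer_sing n B) 0; last first.
  apply: kbound_mono (kbound_separable n0 D0 sB hD nz o1 o2 g).
  by rewrite big_ord_recr leq_addl.
have [n1 [B1 [en e0 s1 hB1 le]]] := kpts_reduce 0 pc B0 n0 sB z.
have n10 : (0 < n1)%N by rewrite lt0n; apply: contraTneq n0 => z1; rewrite en z1 muln0.
have lt : (n1 < n)%N by rewrite en ltn_Pmull // prime_gt1.
have g1 : gcdn n1 (gcdn v1 v2) = 1%N.
  apply/eqP; rewrite -dvdn1 -g dvdn_gcd dvdn_gcdr andbT.
  by rewrite (dvdn_trans (dvdn_gcdl _ _)) // en dvdn_mull.
have hD1 i : (size (B1`_i)%R <= D.+1)%N by have [j ->] := hB1 i.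
rewrite -e0 in o1 o2 B0.
have [dd [hd1 hd2]] := IH n1 lt B1 n10 D0 s1 hD1 B0 o1 o2 g1.
apply: (@kbound_mono _ _ (\sum_(i < n1.+1) kummer_const i D)).
  rewrite -!(big_mkord xpredT (fun i => kummer_const i D)).
  by rewrite [leqRHS](@big_cat_nat _ _ _ n1.+1) //= ?leq_addr // ltnS ltnW.
exists dd; split=> // c c0; apply: leq_trans (hd2 c c0); rewrite leq_mul2l; exact: le.
Qed.
End KummerBound.

(** * Multiplicities of roots and the monomial substitution *)

Section RootOrder.
Variables (k : finFieldType) (L : fieldType) (io : {rmorphism k -> L}).

Lemma root_order_zero (b e : {poly k}) o : b = 'X^o * e -> e`_0 != 0 -> root_order io b o.
Proof.
move=> -> e0; exists 0; rewrite tau0E addr0 comp_polyXr rmorphM /= map_polyXn.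
split=> [|s hs]; last by rewrite coefXnM hs.
by rewrite coefXnM ltnn subnn coef_map fmorph_eq0.
Qed.

(** [X ^ mu - s] is the [mu]-th power of [X - r], as [mu] is a power of [p]. *)
Lemma root_order_simple (b E : {poly k}) o mu p e (s r : L) :
  p \in [pchar L] -> mu = (p ^ e)%N -> b = 'X^o * (E \Po 'X^mu) ->
  (map_poly io E).[s] = 0 -> (map_poly io E)^`().[s] != 0 -> r != 0 -> r ^+ mu = s ->
  root_order io b mu.
Proof.
move=> pc emu eb hs hs' r0 er; have mu0 : (0 < mu)%N by rewrite emu expn_gt0 prime_gt0 ?(pcharf_prime pc).
pose P := map_poly io E \Po ('X + s%:P).
have P0 : P`_0 = 0 by rewrite -horner_coef0 /P horner_comp !hornerE.
have P1 : P`_1 != 0.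
  have := coef_deriv P 0; rewrite mulr1n => <-.
  by rewrite -horner_coef0 /P deriv_comp !hornerE horner_comp !hornerE derivD derivX derivC !hornerE.
exists r; have -> : tau0 io r b = ('X + r%:P) ^+ o * (P \Po 'X^mu).
  have cp : mu.-nat (1 : nat) by [].
  rewrite tau0E eb rmorphM /= map_comp_poly !map_polyXn comp_polyM comp_Xn_poly; congr (_ * _).
  rewrite -!comp_polyA; congr (_ \Po _).
  rewrite comp_Xn_poly comp_polyD comp_polyX comp_polyC emu -er emu polyC_exp.
  rewrite exprDn_pchar // pnatX pnatE ?(pcharf_prime pc) //.
  by apply/orP; left; exact: (rmorph_pchar polyC pc).
have hl1 (x : nat) : (x < 0)%N -> (('X + r%:P) ^+ o)`_x = 0 by [].
have hl2 (x : nat) : (x < mu)%N -> (P \Po 'X^mu)`_x = 0.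
  move=> hx; rewrite coef_comp_poly_Xn //; case: ifP => // dv.
  by move: dv hx; case: x => [|x]; [rewrite div0n P0 | move/dvdn_leq => /(_ isT) h1 h2; move: (leq_ltn_trans h1 h2); rewrite ltnn].
have [e1 l1] := low_mul hl1 hl2; rewrite add0n in e1 l1; split; last exact: l1.
rewrite e1 mulf_neq0 //; last by rewrite coef_comp_poly_Xn // dvdnn divnn mu0.
by rewrite -horner_coef0 horner_exp !hornerE expf_neq0.
Qed.
End RootOrder.

Section Transport.
Variables (k : finFieldType) (p : nat) (M : {poly k}).
Hypothesis pc : p \in [pchar k].
Variables (a b w1 w2 N0 : nat).

(** The exponent [l] is the power [pdeg l] of [p] times the integer [cdeg l], prime
    to [p]. *)
Definition pdeg l := (l`_p)%N.
Definition cdeg l := (l`_p^')%N.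
(** Exponents of [v] and, below, of [g ^-1] in the [i]-th term of [h ((x + h) ^ l - x ^ l)]. *)
Definition ev l i := (b * (1 + pdeg l * i.+1) + a * (l - pdeg l * i.+1))%N.
Definition eg l i := (w2 * (1 + pdeg l * i.+1) + w1 * (l - pdeg l * i.+1))%N.
(** The polynomial [g ^ N0 h (M(x + h) - M(x))] in [v] and [g] for
    [h g ^ w2 = v ^ b] and [x g ^ w1 = v ^ a]. The factor [g ^ N0] clears the
    denominators; the expansion runs over multiples of [pdeg l], where the binomial
    coefficients of [l] do not vanish. *)
Definition transported : {poly {poly k}} :=
  \sum_(l < size M | (0 < l)%N) \sum_(i < cdeg l)
    ((M`_l *+ 'C(cdeg l, i.+1)) *: 'X^(ev l i))%:P * 'X^(N0 - eg l i).

(** The common value of [h (M(x + h) - M(x))] on a collision, up to sign. *)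
Definition hdiff (M : {poly k}) (x h : k) : k := h * (M.[x + h] - M.[x]).

Hypothesis weights : forall l i : nat, (0 < l)%N -> M`_l != 0 -> (i < cdeg l)%N -> (eg l i <= N0)%N.

Lemma pc_deg l : (0 < l)%N -> (pdeg l * cdeg l)%N = l.
Proof. by move=> l0; rewrite /pdeg /cdeg partnC. Qed.

Lemma expD_frob l (x h : k) : (0 < l)%N ->
  (x + h) ^+ l - x ^+ l = \sum_(i < cdeg l) (x ^+ (l - pdeg l * i.+1) * h ^+ (pdeg l * i.+1)) *+ 'C(cdeg l, i.+1).
Proof.
move=> l0; have pp := pcharf_prime pc.
have cq : [pchar k].-nat (pdeg l).
  have := part_pnat p l; rewrite -/(pdeg l); apply: sub_in_pnat => r _ /eqP -> //.
rewrite -{1 2}(pc_deg l0) !exprM exprDn_pchar // exprDn big_ord_recl /= subn0 expr0 mulr1 bin0 mulr1n addrC addKr.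
apply: eq_bigr => i _; rewrite /bump /= add1n -!exprM; congr (_ ^+ _ * _ *+ _).
by rewrite mulnBr pc_deg.
Qed.

Lemma bev_transported (x h v g : k) : h * g ^+ w2 = v ^+ b -> x * g ^+ w1 = v ^+ a ->
  bev transported v g = g ^+ N0 * hdiff M x h.
Proof.
move=> eh ex.
pose H : {rmorphism {poly {poly k}} -> k} := horner_eval g \o map_poly (horner_eval v).
have HX e : H 'X^e = g ^+ e by rewrite /H /= map_polyXn /horner_eval hornerXn.
have HC (P : {poly k}) : H P%:P = P.[v] by rewrite /H /= map_polyC /horner_eval hornerC.
rewrite -[LHS]/(H transported) /transported (rmorph_sum H) /hdiff.
have -> : M.[x + h] - M.[x] = \sum_(l < size M | (0 < l)%N) M`_l * ((x + h) ^+ l - x ^+ l).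
  rewrite !horner_coef -sumrB [LHS](bigID (fun l : 'I_(size M) => (0 < l)%N)) /= [X in _ + X]big1 ?addr0.
    by apply: eq_bigr => l _; rewrite mulrBr.
  by move=> l; rewrite -eqn0Ngt => /eqP ->; rewrite !expr0 subrr.
rewrite mulrA mulr_sumr; apply: eq_bigr => l l0; rewrite (rmorph_sum H) expD_frob // mulr_sumr mulr_sumr.
apply: eq_bigr => i _; have [->|nz] := eqVneq M`_l 0.
  by rewrite mul0rn scale0r polyC0 mul0r (rmorph0 H) !(mul0r, mulr0).
rewrite (rmorphM H) HX HC hornerZ hornerXn.
rewrite -{2}(subnK (weights l0 nz (ltn_ord i))) /ev /eg !exprD !exprM -eh -ex !exprMn -!exprM.
rewrite (exprD h 1) expr1 !(mulrnAl, mulrnAr); congr (_ *+ _).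
move: (g ^+ (N0 - _)) (g ^+ (w2 * _)) (g ^+ (w1 * _)) (x ^+ _) (h ^+ (pdeg l * _)) => A1 A2 A3 A4 A5.
by ring.
Qed.

Lemma transported_size : (0 < w2)%N -> (0 < N0)%N -> (size transported <= N0)%N.
Proof.
move=> w20 N00; apply/leq_sizeP => j hj; rewrite coef_sum big1 // => l l0.
rewrite coef_sum big1 // => i _; rewrite coefCM coefXn; case: eqP => [ej|]; last by rewrite mulr0.
have : (0 < eg l i)%N by rewrite /eg addn_gt0 muln_gt0 w20.
by move: hj; rewrite ej; clear -N00; lia.
Qed.

Lemma transported_coef D j : (forall l i : nat, (l < size M)%N -> (0 < l)%N -> (i < cdeg l)%N -> (ev l i <= D)%N) ->
  (size ((transported`_j)%R) <= D.+1)%N.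
Proof.
move=> hD; apply/leq_sizeP => t ht; rewrite !coef_sum big1 // => l l0.
rewrite !coef_sum big1 // => i _; rewrite coefCM coefXn; case: eqP => _; last by rewrite mulr0 coef0.
rewrite mulr1 coefZ coefXn gtn_eqF ?mulr0 //.
exact: leq_ltn_trans (hD l i (ltn_ord l) l0 (ltn_ord i)) ht.
Qed.

Lemma transported_0 : transported`_0 = \sum_(l < size M | (0 < l)%N) \sum_(i < cdeg l)
    if (N0 <= eg l i)%N then (M`_l *+ 'C(cdeg l, i.+1)) *: 'X^(ev l i) else 0.
Proof.
rewrite coef_sum; apply: eq_bigr => l _; rewrite coef_sum; apply: eq_bigr => i _.
by rewrite coefCM coefXn eq_sym subn_eq0; case: ifP; rewrite ?mulr1 ?mulr0.
Qed.

Hypothesis bez : (b * w1 = a * w2 + 1)%N.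

(** The monomial substitution is a bijection of the torus, as its exponent matrix has
    determinant one. The points with [x = 0] are few and are counted apart. *)
Lemma transport_count c : c != 0 -> M != 0 ->
  (#|[set u : k * k | hdiff M u.1 u.2 == c]| <= #|kpts N0 transported c^-1| + size M)%N.
Proof.
move=> c0 M0.
pose A := [set u : k * k | hdiff M u.1 u.2 == c].
have hA u : u \in A -> u.2 != 0.
  by rewrite inE; apply: contraTneq => z; rewrite /hdiff z mul0r eq_sym.
rewrite -(cardsID [set u : k * k | u.1 != 0]); apply: leq_add.
  pose T (u : k * k) : k * k := (u.2 ^+ w1 / u.1 ^+ w2, u.2 ^+ a / u.1 ^+ b).
  have Tinj : {in A :&: [set u | u.1 != 0] &, injective T}.
    have inv u : u \in A :&: [set u | u.1 != 0] ->
       u.2 = (T u).1 ^+ b / (T u).2 ^+ w2 /\ u.1 = (T u).1 ^+ a / (T u).2 ^+ w1.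
      rewrite inE => /andP [/hA h0]; rewrite inE /T /= => x0.
      have e : forall y : k, y ^+ (w1 * b) = y ^+ (a * w2) * y.
        by move=> y; rewrite mulnC bez exprD expr1.
      rewrite !expr_div_n -!exprM [(w2 * b)%N]mulnC [(w2 * a)%N]mulnC e [(w1 * a)%N]mulnC [(b * w1)%N]mulnC e.
      have h0' := h0; split; field; rewrite ?expf_neq0 ?x0 ?h0 //.
    move=> u1 u2 /inv [e1 e2] /inv [e3 e4] eT.
    by rewrite [u1]surjective_pairing [u2]surjective_pairing e1 e2 e3 e4 eT.
  rewrite -(card_in_imset Tinj); apply/subset_leq_card/subsetP => _ /imsetP [u hu ->].
  move: hu; rewrite inE => /andP [uA]; rewrite inE => x0; have h0 := hA u uA.
  have g0 : (T u).2 != 0 by rewrite mulf_neq0 ?invr_eq0 ?expf_neq0.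
  rewrite inE g0 /=; move: uA; rewrite inE => /eqP eF.
  have -> : bev transported (T u).1 (T u).2 = (T u).2 ^+ N0 * c.
    rewrite -eF; apply: bev_transported; rewrite /T /= !expr_div_n -!exprM.
      have e : forall y : k, y ^+ (w1 * b) = y ^+ (a * w2) * y by move=> y; rewrite mulnC bez exprD expr1.
      by rewrite e [(w2 * b)%N]mulnC; field; rewrite ?expf_neq0 ?x0 ?h0.
    have e : forall y : k, y ^+ (b * w1) = y ^+ (w2 * a) * y by move=> y; rewrite bez exprD expr1 mulnC.
    by rewrite e [(w1 * a)%N]mulnC; field; rewrite ?expf_neq0 ?x0 ?h0.
  by rewrite [c^-1 * _]mulrC mulfK.
have -> : A :\: [set u | u.1 != 0] = [set u in A | u.1 == 0] by apply/setP => u; rewrite !inE negbK andbC.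
pose P : {poly k} := 'X * (M - M.[0]%:P) - c%:P.
have P0 : P != 0.
  apply: contraNneq c0 => z; have := congr1 (horner_eval 0) z; rewrite /horner_eval /P !hornerE => /eqP.
  by rewrite ?mul0r ?sub0r ?add0r oppr_eq0.
have sP : (size P <= (size M).+1)%N.
  rewrite /P (leq_trans (size_polyD _ _)) // geq_max size_polyN (leq_trans (size_polyC_leq1 _)) // andbT.
  rewrite (leq_trans (size_polyMleq _ _)) // size_polyX /= ltnS (leq_trans (size_polyD _ _)) //.
  by rewrite geq_max size_polyN leqnn (leq_trans (size_polyC_leq1 _)) // size_poly_gt0.
apply: leq_trans (roots_le P0 sP).
have inj2 : {in [set u in A | u.1 == 0] &, injective (snd : k * k -> k)}.
  move=> u u'; rewrite !inE => /andP [_ /eqP e1] /andP [_ /eqP e2] e3.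
  by rewrite [u]surjective_pairing [u']surjective_pairing e1 e2 e3.
rewrite -(card_in_imset inj2); apply/subset_leq_card/subsetP => z /imsetP [u hu ->].
move: hu; rewrite !inE => /andP [/eqP e /eqP x0].
by rewrite rootE /P !hornerE -e /hdiff x0 add0r subrr.
Qed.
End Transport.

(** * Edges of the Newton polygon of a polynomial that is not linearized *)

(** The weight decreases by [w1 - w2] at each step of the expansion. *)
Lemma eg_arith w1 w2 l u v : (w2 < w1)%N -> (u + v <= l)%N ->
  (w2 * (1 + (u + v)) + w1 * (l - (u + v)) + (w1 - w2) * v = w2 * (1 + u) + w1 * (l - u))%N.
Proof.
move=> w12 hl.
have [x ex] : exists x, l = (u + v + x)%N by exists (l - (u + v))%N; rewrite subnKC.
have [y ey] : exists y, w1 = (w2 + y)%N by exists (w1 - w2)%N; rewrite subnKC // ltnW.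
rewrite ex ey.
have -> : (u + v + x - (u + v) = x)%N by lia.
have -> : (u + v + x - u = v + x)%N by lia.
have -> : (w2 + y - w2 = y)%N by lia.
by clear; nia.
Qed.

Lemma Q_le p l : (0 < l)%N -> (pdeg p l <= l)%N.
Proof. by move=> l0; apply: dvdn_leq => //; apply: dvdn_part. Qed.
Lemma Qi_le p l i : (0 < l)%N -> (i < cdeg p l)%N -> (pdeg p l * i.+1 <= l)%N.
Proof. by move=> l0 hi; rewrite -{2}(pc_deg p l0) leq_mul2l hi orbT. Qed.

Lemma eg_mono_gen p w1 w2 l i : (w2 < w1)%N -> (0 < l)%N -> (i < cdeg p l)%N ->
  (eg p w1 w2 l i + (w1 - w2) * (pdeg p l * i))%N = eg p w1 w2 l 0.
Proof.
move=> w12 l0 hi; have := Qi_le l0 hi; rewrite /eg muln1 mulnS; exact: eg_arith.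
Qed.

Section Edge.
Variables (k : finFieldType) (L : closedFieldType) (io : {rmorphism k -> L}) (p : nat).
Hypothesis pc : p \in [pchar k].

(** A root of the edge polynomial [E] that is simple has, in [b], the multiplicity [mu];
    the root zero has the multiplicity [o]. *)
Lemma edge_orders (b E : {poly k}) o mu e :
  mu = (p ^ e)%N -> b = 'X^o * (E \Po 'X^mu) -> E`_0 != 0 -> (exists2 j, (0 < j)%N & E`_j != 0) ->
  (forall s : L, (map_poly io E).[s] = 0 -> (map_poly io E)^`().[s] != 0) ->
  root_order io b o /\ root_order io b mu.
Proof.
move=> emu eb E0 [j j0 hj] sep.
have mu0 : (0 < mu)%N by rewrite emu expn_gt0 prime_gt0 ?(pcharf_prime pc).
split.
  apply: root_order_zero eb _; by rewrite -horner_coef0 horner_comp hornerXn expr0n gtn_eqF // horner_coef0.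
have sE : size (map_poly io E) != 1%N.
  rewrite size_map_poly; apply: contraNneq hj => h; rewrite nth_default // h //.
have /closed_rootP [s /rootP hs] := sE.
have s0 : s != 0.
  by apply: contraNneq E0 => z; move: hs; rewrite z horner_coef0 coef_map => /eqP; rewrite fmorph_eq0.
have : size ('X^mu - s%:P) != 1%N by rewrite size_XnsubC // eqSS -lt0n.
case/closed_rootP => r /rootP; rewrite !hornerE => /eqP; rewrite subr_eq0 => /eqP hr.
have r0 : r != 0 by apply: contraNneq s0 => z; rewrite -hr z expr0n gtn_eqF.
exact: (root_order_simple (rmorph_pchar io pc) emu eb hs (sep s hs) r0 hr).
Qed.
End Edge.

Section Cases.
Variables (k : finFieldType) (L : closedFieldType) (io : {rmorphism k -> L}) (p : nat).
Hypothesis pc : p \in [pchar k].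
Variables (M : {poly k}) (d : nat).
Hypotheses (sM : size M = d.+1) (d0 : (0 < d)%N).
Let pp : prime p := pcharf_prime pc.
Notation Q := (pdeg p).
Notation cd := (cdeg p).

Lemma Md0 : M`_d != 0.
Proof. by have := lead_coef_eq0 M; rewrite lead_coefE sM /= -size_poly_eq0 sM => ->. Qed.
Lemma cd_gt0 l : (0 < cd l)%N. Proof. exact: part_gt0. Qed.
Lemma Q_gt0 l : (0 < Q l)%N. Proof. exact: part_gt0. Qed.
Lemma Q_pow l : Q l = (p ^ logn p l)%N. Proof. exact: p_part. Qed.
Lemma cd_unit l : (cd l)%:R != 0 :> k.
Proof.
rewrite -(dvdn_pcharf pc); have := part_pnat p^' l; rewrite -/(cd l) p'natE //.
Qed.
(** Here [B`_0] is [v ((1 + v ^ Q) ^ d' - 1)] up to a scalar, where [d = Q d'] and [p]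
    does not divide [d']. *)
Lemma orders_generic_degree : (1 < cd d)%N ->
  let B := transported p M 0 1 1 1 (1 + d) in
  root_order io B`_0 (1 + Q d) /\ root_order io B`_0 (Q d).
Proof.
move=> cd1 B; pose E : {poly k} := \poly_(i < cd d) (M`_d *+ 'C(cd d, i.+1)).
have eg1 l i : (0 < l)%N -> (i < cd l)%N -> eg p 1 1 l i = l.+1.
  by move=> l0 hi; have := Qi_le l0 hi; rewrite /eg; lia.
have dlt : (d < size M)%N by rewrite sM.
have eB : B`_0 = 'X^(1 + Q d) * (E \Po 'X^(Q d)).
  rewrite /B transported_0 (bigD1 (Ordinal dlt)) //= [X in _ + X]big1 ?addr0 => [|l /andP [l0 ne]]; last first.
    apply: big1 => i _; rewrite eg1 // ltnNge; case: (leqP d l) => //= h.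
    by case/eqP: ne; apply: val_inj => /=; apply/eqP; rewrite eqn_leq h -ltnS -sM ltn_ord.
  rewrite /E poly_def rmorph_sum mulr_sumr; apply: eq_bigr => i _.
  rewrite eg1 // leqnn /ev mul1n mul0n addn0 /= comp_polyZ comp_Xn_poly -exprM -scalerAr -exprD.
  by rewrite mulnS addnA.
have E0 : E`_0 != 0 by rewrite coef_poly cd_gt0 bin1 -mulr_natr mulf_neq0 ?Md0 ?cd_unit.
apply: (edge_orders pc (Q_pow d) eB E0).
  exists (cd d).-1; first by move: cd1; clear; lia.
  by rewrite coef_poly prednK ?cd_gt0 // leqnn binn mulr1n Md0.
have XE : 'X * E = M`_d *: (('X + 1) ^+ cd d - 1).
  apply/polyP => j; rewrite coefXM coefZ coefB coef1 coef_poly exprDn coef_sum.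
  have cj (i : 'I_(cd d).+1) : (('X : {poly k}) ^+ (cd d - i) * 1 ^+ i *+ 'C(cd d, i))`_j =
      if (j == cd d - i)%N then 'C(cd d, i)%:R else 0.
    by rewrite expr1n mulr1 coefMn coefXn; case: eqP; rewrite ?mul0rn.
  rewrite (eq_bigr _ (fun i _ => cj i)).
  have [hj|hj] := leqP j (cd d); last first.
    rewrite gtn_eqF ?(leq_ltn_trans _ hj) // big1 ?subrr ?mulr0; last first.
      by move=> i _; case: eqP => // ej; move: hj; rewrite ej; lia.
    by rewrite ltnNge -ltnS prednK ?hj //; lia.
  have lt : (cd d - j < (cd d).+1)%N by lia.
  rewrite (bigD1 (Ordinal lt)) //= subKn // eqxx bin_sub // big1 ?addr0 => [|i ne]; last first.
    case: eqP => // ej; case/eqP: ne; apply: val_inj => /=; rewrite ej subKn // -ltnS //.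
  case: j hj lt {cj} => [|j] hj lt /=; first by rewrite bin0 subrr mulr0.
  by rewrite hj subr0 mulr_natr.
move=> s hs; have := congr1 (fun P => (map_poly io P).[s]) XE.
rewrite rmorphM /= map_polyX hornerM hs mulr0 linearZ /= rmorphB rmorphXn rmorphD /= map_polyX rmorph1 !hornerE.
move=> /esym /eqP; rewrite mulf_eq0 fmorph_eq0 (negPf Md0) /= subr_eq0 => /eqP hs1.
have s1 : s + 1 != 0.
  apply: contra_eq_neq hs1 => ->; by rewrite expr0n gtn_eqF ?cd_gt0 // eq_sym oner_eq0.
have := congr1 (fun P => (map_poly io P^`()).[s]) XE.
have -> : ('X * E)^`() = E + 'X * E^`() by rewrite derivM derivX mul1r.
have -> : (M`_d *: (('X + 1) ^+ cd d - 1))^`() = M`_d *: (('X + 1) ^+ (cd d).-1 *+ cd d).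
  by rewrite derivZ derivB deriv_exp derivD derivX derivC addr0 mul1r subr0.
rewrite rmorphD rmorphM /= map_polyX deriv_map hornerD hs add0r hornerM hornerX linearZ /= rmorphMn rmorphXn rmorphD /= map_polyX rmorph1.
rewrite hornerZ hornerMn !hornerE => e; apply: contraTneq isT => z.
move/eqP: e; rewrite z mulr0 eq_sym mulf_eq0 fmorph_eq0 (negPf Md0) /= -mulr_natr mulf_eq0 expf_eq0 (negPf s1) andbF /=.
by rewrite -(rmorph_nat io) fmorph_eq0 (negPf (cd_unit d)).
Qed.

Section CaseB.
Variables (a b w1 w2 : nat).
Hypotheses (w20 : (0 < w2)%N) (w12 : (w2 < w1)%N) (bez : (b * w1 = a * w2 + 1)%N) (pw : ~~ (p %| w1)%N).
Notation N0 := (w2 * (1 + d))%N.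
Hypothesis weights : forall l : nat, (0 < l)%N -> M`_l != 0 -> (eg p w1 w2 l 0 <= N0)%N.
Hypothesis dpow : cd d = 1%N.
Variable ls : nat.
Hypotheses (ls0 : (0 < ls)%N) (lsM : M`_ls != 0) (lsd : (ls < d)%N) (lsN : eg p w1 w2 ls 0 = N0).

Lemma eg_mono l i : (0 < l)%N -> (i < cd l)%N -> (eg p w1 w2 l i + (w1 - w2) * (Q l * i))%N = eg p w1 w2 l 0.
Proof. exact: eg_mono_gen. Qed.

Definition edge l := [&& (0 < l)%N, M`_l != 0 & eg p w1 w2 l 0 == N0].

Lemma edge_ev l : edge l -> (w1 * ev p a b l 0 = 1 + Q l + a * N0)%N.
Proof.
case/and3P => l0 _ /eqP; rewrite /eg /ev !muln1 => e.
have -> : (w1 * (b * (1 + Q l) + a * (l - Q l)) = (b * w1) * (1 + Q l) + a * (w1 * (l - Q l)))%N by clear; nia.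
by rewrite bez -e; clear; nia.
Qed.

Lemma edge_inj l l' : edge l -> edge l' -> Q l = Q l' -> l = l'.
Proof.
case/and3P => l0 _ /eqP e /and3P [l0' _ /eqP e'] eQ; move: e'; rewrite -e /eg !muln1 eQ => /eqP.
rewrite eqn_add2l eqn_pmul2l; last exact: leq_trans w12.
have := @Q_le p _ l0; have := @Q_le p _ l0'; rewrite eQ => h1 h2 /eqP h3.
by move: h1 h2 h3; clear; lia.
Qed.

Lemma edge_d : edge d.
Proof.
rewrite /edge d0 Md0 /=; have := pc_deg p d0; rewrite dpow muln1 => h.
by rewrite /eg muln1 h subnn muln0 addn0.
Qed.
Lemma edge_ls : edge ls.
Proof. by rewrite /edge ls0 lsM lsN eqxx. Qed.

(** Now the degree [d] is a power of [p]. The monomials of [M] on the edge through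
    [v ^ d] contribute one term each to [B`_0]. With [mu] the least of their [p]-parts,
    [E] satisfies [w1 X E' = E(0) - E] because the other exponents are congruent to
    [-1] modulo [p]; so its roots are simple. *)
Lemma orders_power_degree :
  let B := transported p M a b w1 w2 N0 in
  exists o e, [/\ root_order io B`_0 o, root_order io B`_0 (p ^ e) & (w1 * o = 1 + p ^ e + a * N0)%N].
Proof.
move=> B; have lss : (ls < size M)%N by rewrite sM ltnS ltnW.
have ds : (d < size M)%N by rewrite sM.
have [l0 el0 hmin] := @arg_minnP _ (Ordinal lss) (fun l : 'I_(size M) => edge l) (fun l => Q l) edge_ls.
set o := ev p a b l0 0; set e := logn p l0; set mu := (p ^ e)%N.
have emu : Q l0 = mu by exact: Q_pow.
have mu0 : (0 < mu)%N by rewrite expn_gt0 prime_gt0.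
have w10 : (0 < w1)%N by exact: leq_trans w12.
have ho : (w1 * o = 1 + mu + a * N0)%N by rewrite edge_ev // emu.
pose el l := ((ev p a b l 0 - o) %/ mu)%N.
have hel (l : 'I_(size M)) : edge l -> (ev p a b l 0 = o + mu * el l)%N /\ (w1 * el l * mu = Q l - mu)%N /\ (mu %| Q l)%N.
  move=> hl; have hQ : (mu <= Q l)%N by rewrite -emu; apply: hmin.
  have dv : (mu %| Q l)%N.
    rewrite Q_pow /mu dvdn_exp2l // -(leq_exp2l _ _ (prime_gt1 pp)) -Q_pow //.
  have h1 := edge_ev hl.
  have oe : (o <= ev p a b l 0)%N.
    by rewrite -(leq_pmul2l w10) ho h1 leq_add2r leq_add2l.
  have h2 : (w1 * (ev p a b l 0 - o) = Q l - mu)%N by rewrite mulnBr ho h1; clear; lia.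
  have cop : coprime mu w1 by rewrite coprimeXl // prime_coprime.
  have dv2 : (mu %| ev p a b l 0 - o)%N.
    by rewrite -(Gauss_dvdr _ cop) h2 dvdn_sub.
  rewrite /el; split; first by rewrite mulnC divnK // subnKC.
  by split => //; rewrite -mulnA divnK.
pose be (l : 'I_(size M)) : k := M`_l *+ cd l.
have be0 (l : 'I_(size M)) : edge l -> be l != 0.
  by case/and3P => _ hl _; rewrite /be -mulr_natr mulf_neq0 ?cd_unit.
pose E : {poly k} := \sum_(l < size M | edge l) be l *: 'X^(el l).
have eB : B`_0 = 'X^o * (E \Po 'X^mu).
  rewrite /B transported_0 /E rmorph_sum mulr_sumr.
  rewrite [LHS](bigID (fun l : 'I_(size M) => edge l)) /= [X in _ + X]big1 ?addr0 => [|l /andP [l1 ne]]; last first.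
    apply: big1 => i _; have [z|nz] := eqVneq M`_l 0; first by rewrite z mul0rn scale0r if_same.
    case: ifP => // h; case/negP: ne; rewrite /edge l1 nz eqn_leq weights //=.
    by apply: leq_trans h _; rewrite -(eg_mono l1 (ltn_ord i)) leq_addr.
  apply: eq_big => [l|l /andP [l1 hl]]; first by case h : (edge l); rewrite ?andbF //; case/and3P: h => ->.
  have hl' := hl; case/and3P: hl => _ nz /eqP he.
  rewrite (bigD1 (Ordinal (cd_gt0 l))) //= he leqnn bin1 big1 ?addr0 => [|i ne]; last first.
    have i0 : (0 < i)%N by rewrite lt0n; apply: contraNneq ne => z; apply/eqP/val_inj.
    case: ifP => // h; have := eg_mono l1 (ltn_ord i); rewrite he.
    have : (0 < (w1 - w2) * (Q l * i))%N by rewrite !muln_gt0 subn_gt0 w12 Q_gt0 i0.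
    by move: h; clear; lia.
  rewrite /= comp_polyZ comp_Xn_poly -exprM -scalerAr -exprD.
  by have [-> _] := hel l hl'.
have elinj (l l' : 'I_(size M)) : edge l -> edge l' -> el l = el l' -> l = l'.
  move=> h h' ee; have [_ [e1 _]] := hel l h; have [_ [e2 _]] := hel l' h'.
  apply: val_inj; apply: edge_inj => //=; have q1 : (mu <= Q l)%N by rewrite -emu; apply: hmin.
  have q2 : (mu <= Q l')%N by rewrite -emu; apply: hmin.
  by rewrite -(subnK q1) -(subnK q2) -e1 -e2 ee.
have Ec (l : 'I_(size M)) : edge l -> E`_(el l) = be l.
  move=> hl; rewrite coef_sum (bigD1 l) //= coefZ coefXn eqxx mulr1 big1 ?addr0 // => l' /andP [h' ne].
  by rewrite coefZ coefXn; case: eqP => [ee|_]; [case/eqP: ne; apply/esym/elinj | rewrite mulr0].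
have el00 : el l0 = 0%N by rewrite /el subnn div0n.
have E0 : E`_0 = be l0 by rewrite -el00 Ec.
exists o, e.
have [|||r1 r2] := edge_orders (mu := mu) (e := e) (o := o) (E := E) (b := B`_0) (io := io) pc erefl eB; last by [].
- by rewrite E0 be0.
- exists (el (Ordinal ds)); last by rewrite Ec ?be0 //; exact: edge_d.
  rewrite lt0n; apply/eqP => z; have := elinj (Ordinal ds) _ edge_d el0; rewrite el00 => /(_ z) /(congr1 val) /= ed.
  have := hmin (Ordinal lss) edge_ls; rewrite /= -ed; have := pc_deg p d0; rewrite dpow muln1 => ->.
  by rewrite leqNgt (leq_ltn_trans (@Q_le p _ ls0) lsd).
move=> s hs.
have key : w1%:R *: ('X * E^`()) = (be l0)%:P - E.
  rewrite /E linear_sum mulr_sumr scaler_sumr /= [X in _ = _ - X](bigD1 l0) //= el00 expr0 alg_polyC.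
  rewrite opprD addrA subrr add0r (bigD1 l0) //= el00 expr0 derivZ derivC scaler0 mulr0 scaler0 add0r -sumrN.
  apply: eq_bigr => l /andP [hl ne].
  have [_ [e1 dv]] := hel l hl.
  have e1' : el l != 0%N by apply: contraNneq ne => z; apply/eqP/elinj => //; rewrite z el00.
  have dX : 'X * ('X^((el l).-1) *+ el l) = (el l)%:R *: 'X^(el l) :> {poly k}.
    by rewrite mulrnAr -exprS prednK ?lt0n // scaler_nat.
  rewrite derivZ derivXn -scalerAr scalerA dX scalerA -scaleNr; congr (_ *: _).
  rewrite mulrAC mulrC -natrM.
  have -> : (w1 * el l = Q l %/ mu - 1)%N.
    by apply/eqP; rewrite -(eqn_pmul2r mu0) mulnBl divnK // mul1n e1.
  rewrite natrB; last by rewrite divn_gt0 // dvdn_leq // Q_gt0.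
  have : (p %| Q l %/ mu)%N.
    have [j ej] : exists j, (Q l %/ mu = p ^ j)%N.
      exists (logn p l - e)%N; rewrite Q_pow /mu expnB ?prime_gt0 //.
      by rewrite -(leq_exp2l _ _ (prime_gt1 pp)) -Q_pow dvdn_leq ?Q_gt0.
    case: j ej => [|j] ej; last by rewrite ej expnS dvdn_mulr.
    have : (w1 * el l * mu = 0)%N by rewrite e1 -[Q l](divnK dv) ej mul1n subnn.
    by move/eqP; rewrite !muln_eq0 (negPf e1') !gtn_eqF.
  by rewrite (dvdn_pcharf pc) => /eqP ->; rewrite sub0r mulrN1.
have := congr1 (fun P => (map_poly io P).[s]) key.
rewrite linearZ /= rmorphM /= map_polyX deriv_map rmorphB /= map_polyC /= hornerZ hornerM hornerX hornerD hornerN hornerC hs subr0 => h.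
apply: contraNneq (be0 l0 el0) => z; rewrite z !mulr0 in h.
by rewrite -(fmorph_eq0 io) -h.
Qed.
End CaseB.
End Cases.

(** * Solutions for a polynomial that is not linearized *)

Definition nonlinear_bidegree d := ((d * d + 1) * (1 + d) + d * d)%N.
Definition nonlinear_const d := (\sum_(i < (d * (1 + d)).+1) kummer_const i (nonlinear_bidegree d) + 4 * d.+1)%N.

(** [N] is at most [5/4 q + C] apart from an error whose total is linear in [q]. *)
Definition almost54 (k : finFieldType) (N : k -> nat) C :=
  exists dd : k -> nat, (\sum_c dd c <= C * #|k|)%N /\
    forall c, c != 0 -> (4 * N c <= 5 * #|k| + C + 4 * dd c)%N.

Definition Ndiff (k : finFieldType) (M : {poly k}) (c : k) := #|[set u : k * k | hdiff M u.1 u.2 == c]|.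

Section Nonlinear.
Variables (k : finFieldType) (p : nat) (M : {poly k}) (d : nat).
Hypotheses (pc : p \in [pchar k]) (sM : size M = d.+1) (d0 : (0 < d)%N).

Lemma transport_bound (L : closedFieldType) (io : {rmorphism k -> L}) a b w1 w2 v1 v2 :
  (0 < w2 <= d)%N -> (w2 <= w1 <= d)%N -> (a <= d)%N -> (b * w1 = a * w2 + 1)%N ->
  (forall l i : nat, (0 < l)%N -> M`_l != 0 -> (i < cdeg p l)%N -> (eg p w1 w2 l i <= w2 * (1 + d))%N) ->
  let B := transported p M a b w1 w2 (w2 * (1 + d)) in
  root_order io B`_0 v1 -> root_order io B`_0 v2 -> gcdn (w2 * (1 + d)) (gcdn v1 v2) = 1%N ->
  almost54 (Ndiff M) (nonlinear_const d).
Proof.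
move=> /andP [w20 w2d] /andP [w21 w1d] ad bez we B o1 o2 g.
set N0 := (w2 * (1 + d))%N in we B o1 o2 g *.
have N00 : (0 < N0)%N by rewrite muln_gt0 w20.
have B0 : B`_0 != 0 by case: o1 => r [h _]; apply: contraNneq h => ->; rewrite rmorph0 coef0.
have bd : (b <= d * d + 1)%N.
  apply: leq_trans (_ : b * w1 <= _)%N; first by rewrite leq_pmulr // (leq_trans w20).
  by rewrite bez leq_add2r leq_mul.
have hD : forall l i : nat, (l < size M)%N -> (0 < l)%N -> (i < cdeg p l)%N -> (ev p a b l i <= nonlinear_bidegree d)%N.
  move=> l i; rewrite sM ltnS => ld l0 hi; rewrite /ev /nonlinear_bidegree; apply: leq_add; apply: leq_mul => //.
    by rewrite leq_add2l (leq_trans (Qi_le l0 hi)).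
  exact: leq_trans (leq_subr _ _) ld.
have M0 : M != 0 by rewrite -size_poly_eq0 sM.
have D0 : (0 < nonlinear_bidegree d)%N by rewrite /nonlinear_bidegree addn_gt0 muln_gt0 addn1.
have [dd [h1 h2]] := kbound_kummer (D := nonlinear_bidegree d) N00 D0 (transported_size p M a b w1 w20 N00) (fun j => transported_coef w1 w2 N0 j hD) B0 o1 o2 g.
have curve_const : (\sum_(i < N0.+1) kummer_const i (nonlinear_bidegree d) + 4 * d.+1 <= nonlinear_const d)%N.
  rewrite leq_add2r -!(big_mkord xpredT (fun i => kummer_const i (nonlinear_bidegree d))).
  have le : (N0 <= d * (1 + d))%N by rewrite leq_mul2r w2d orbT.
  by rewrite [leqRHS](@big_cat_nat _ _ _ N0.+1) //= ?leq_addr.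
exists (fun c => dd c^-1); split.
  rewrite (reindex_inj (@invr_inj k)) /=; under eq_bigr do rewrite invrK.
  apply: leq_trans h1 _; rewrite leq_mul2r; apply/orP; right.
  by apply: leq_trans curve_const; apply: leq_addr.
move=> c c0; have t := transport_count pc we bez c0 M0.
have c0' : c^-1 != 0 by rewrite invr_eq0.
have := h2 _ c0'; rewrite -/N0 -/B.
move: t; rewrite sM -/(Ndiff M c) -/B => t h.
have aux (x y z s C e f q : nat) : (x <= y + z -> 4 * y <= q + s + e -> s + 4 * z <= C -> 4 * x <= q + C + e)%N by clear; lia.
exact: aux t h curve_const.
Qed.

Lemma caseA_weights l i : (0 < l)%N -> M`_l != 0 -> (i < cdeg p l)%N -> (eg p 1 1 l i <= 1 * (1 + d))%N.
Proof.
move=> l0 nz hi; have ld : (l <= d)%N.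
  by rewrite -ltnS -sM ltnNge; apply: contraNN nz => h; rewrite nth_default.
have := Qi_le l0 hi; rewrite /eg; move: (pdeg p l * i.+1)%N => u; move: ld; clear; lia.
Qed.

(** If the degree is not a power of [p] the weights [1], [1] are used. Otherwise the weights
    [w1 > w2] come from the monomial minimizing [(d - Q) / (l - Q)], in lowest terms.
    The exponents [n], [v1], [v2] have no common prime factor: such a prime divides
    a power of [p], and then [1 + p ^ e]. *)
Theorem nonlinear_bound l : (0 < l)%N -> M`_l != 0 -> (1 < cdeg p l)%N -> almost54 (Ndiff M) (nonlinear_const d).
Proof.
have [L [io _]] := countable_algebraic_closure k.
have pp := pcharf_prime pc.
have lsz m : M`_m != 0 -> (m <= d)%N.
  by move=> nz; rewrite -ltnS -sM ltnNge; apply: contraNN nz => h; rewrite nth_default.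
move=> l0 lM cl.
have [cd1|cd1] := ltnP 1 (cdeg p d).
  have [o1 o2] := orders_generic_degree io pc sM d0 cd1.
  apply: (transport_bound (io := io) (a := 0) (b := 1) (w1 := 1) (w2 := 1) (v1 := (1 + pdeg p d)%N) (v2 := pdeg p d)).
  - by rewrite d0.
  - by rewrite d0.
  - by [].
  - by [].
  - exact: caseA_weights.
  - by rewrite mul1n.
  - by rewrite mul1n.
  - have -> : gcdn (1 + pdeg p d) (pdeg p d) = 1%N by rewrite gcdnC gcdnDr gcdn1.
    by rewrite gcdn1.
have {cd1} cd1 : cdeg p d = 1%N by apply/eqP; rewrite eqn_leq cd1 cd_gt0.
have Qd : pdeg p d = d by have := pc_deg p d0; rewrite cd1 muln1.
pose num m := (d - pdeg p m)%N; pose den m := (m - pdeg p m)%N.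
pose P (m : 'I_d.+1) := [&& (0 < m)%N, M`_m != 0 & (1 < cdeg p m)%N].
have denP m : (0 < m)%N -> (1 < cdeg p m)%N -> (0 < den m)%N.
  by move=> m0 cm; rewrite subn_gt0 -{2}(pc_deg p m0) ltn_Pmulr // Q_gt0.
have Pl : P (Ordinal (lsz l lM : (l < d.+1)%N)) by rewrite /P /= l0 lM.
pose K := (d`!)%N.
have [s /and3P [s0 sM' cs] smin] := @arg_minnP _ _ P (fun m => num m * (K %/ den m))%N Pl.
have sd : (s < d)%N.
  rewrite ltn_neqAle -ltnS ltn_ord andbT; apply: contraTneq cs => ->; by rewrite cd1.
have dvK m : P m -> (den m %| K)%N.
  case/and3P => m0 _ cm; apply: dvdn_fact; rewrite denP //= leq_subLR.
  by apply: leq_trans (leq_addl _ _); rewrite -ltnS; apply: ltn_ord.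
have cross m : P m -> (num s * den m <= num m * den s)%N.
  move=> Pm; have h := smin m Pm.
  have Ps : P s by rewrite /P s0 sM' cs.
  have K0 : (0 < K)%N by exact: fact_gt0.
  have k1 := divnK (dvK s Ps); have k2 := divnK (dvK m Pm).
  rewrite -(leq_pmul2r K0) -[X in (_ * X <= _)%N]k1 -[X in (_ <= _ * X)%N]k2.
  have -> : (num s * den m * (K %/ den s * den s) = (num s * (K %/ den s)) * (den m * den s))%N by clear; lia.
  have -> : (num m * den s * (K %/ den m * den m) = (num m * (K %/ den m)) * (den m * den s))%N by clear; lia.
  by rewrite leq_mul2r h orbT.
have ds0 := denP _ s0 cs.
set Qs := pdeg p s in cs *.
have Qsd : (Qs <= s)%N by exact: @Q_le.
have nd : (den s < num s)%N by rewrite /den /num -/Qs; move: sd Qsd; clear; lia.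
pose g := gcdn (num s) (den s); have g0 : (0 < g)%N by rewrite gcdn_gt0 ds0 orbT.
pose w1 := (num s %/ g)%N; pose w2 := (den s %/ g)%N.
have e1 : (num s = w1 * g)%N by rewrite divnK // dvdn_gcdl.
have e2 : (den s = w2 * g)%N by rewrite divnK // dvdn_gcdr.
have w20 : (0 < w2)%N by move: ds0; rewrite e2 muln_gt0 => /andP [].
have w12 : (w2 < w1)%N by move: nd; rewrite e1 e2 ltn_pmul2r.
have w10 : (0 < w1)%N by exact: leq_trans w12.
have cop : coprime w1 w2.
  by rewrite /coprime -(eqn_pmul2r g0) mul1n muln_gcdl -e1 -e2.
have w1d : (w1 <= d)%N by apply: leq_trans (leq_div _ _) (leq_subr _ _).
have [a aw /dvdnP [b hb]] := Bezoutl w2 w10.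
have bez : (b * w1 = a * w2 + 1)%N by rewrite -hb (eqP cop) addnC.
have we0 m : (0 < m)%N -> M`_m != 0 -> (eg p w1 w2 m 0 <= w2 * (1 + d))%N.
  move=> m0 nz; have md := lsz m nz; rewrite /eg muln1.
  have Qm := @Q_le p _ m0.
  have [c1|c1] := ltnP 1 (cdeg p m).
    have Pm : P (Ordinal (md : (m < d.+1)%N)) by rewrite /P /= m0 nz c1.
    have := cross _ Pm; rewrite /= e1 e2 mulnAC [(num m * _)%N]mulnA leq_pmul2r // => h.
    have : (pdeg p m + num m = d)%N by rewrite subnKC // (leq_trans Qm).
    rewrite -/(den m) => h2; rewrite -h2 !mulnDr addnA leq_add2l [(w2 * num m)%N]mulnC; exact: h.
  have cm : cdeg p m = 1%N by apply/eqP; rewrite eqn_leq c1 cd_gt0.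
  have := pc_deg p m0; rewrite cm muln1 => ->; rewrite subnn muln0 addn0 leq_mul2l leq_add2l md orbT //.
have pw : ~~ (p %| w1)%N.
  have [j ej] : exists j, (d = Qs * p ^ j.+1)%N.
    have := Qd; rewrite Q_pow => ed; have hs : Qs = (p ^ logn p s)%N by exact: Q_pow.
    have lt : (logn p s < logn p d)%N.
      by rewrite -(ltn_exp2l _ _ (prime_gt1 pp)) -hs ed; exact: leq_ltn_trans Qsd sd.
    exists (logn p d - (logn p s).+1)%N; transitivity (p ^ logn p d)%N; first by rewrite ed.
    rewrite hs -expnD; congr (_ ^ _)%N; move: lt; clear; lia.
  have Qg : (Qs %| g)%N.
    have h1 : (Qs %| s)%N by rewrite /Qs /pdeg dvdn_part.
    have h2 : (Qs %| d)%N by rewrite ej dvdn_mulr.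
    by rewrite dvdn_gcd /num /den -/Qs !dvdn_sub.
  have [g' eg'] := dvdnP Qg.
  have : (w1 * g' = p ^ j.+1 - 1)%N.
    have Q0 : (0 < Qs)%N by exact: Q_gt0.
    apply/eqP; rewrite -(eqn_pmul2l Q0) mulnBr -ej muln1 -[(d - Qs)%N]/(num s) e1 eg'; apply/eqP; clear; lia.
  move=> e; apply/negP => pw; have : (p %| p ^ j.+1 - 1)%N by rewrite -e dvdn_mulr.
  rewrite dvdn_subr ?expn_gt0 ?prime_gt0 ?expnS ?dvdn_mulr //.
  by rewrite dvdn1 => /eqP p1; move: pp; rewrite p1.
have sN : eg p w1 w2 s 0 = (w2 * (1 + d))%N.
  rewrite /eg muln1 -/Qs -/(den s).
  have -> : (1 + d = 1 + Qs + num s)%N by rewrite -addnA subnKC // (leq_trans Qsd) // ltnW.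
  by rewrite [in RHS]mulnDr e1 e2; congr (_ + _)%N; clear; lia.
have [o [e [o1 o2 ho]]] := orders_power_degree io pc sM d0 w12 bez pw we0 cd1 s0 sM' sd sN.
apply: (transport_bound (io := io) (a := a) (b := b) (w1 := w1) (w2 := w2) (v1 := o) (v2 := (p ^ e)%N)) => //.
- by rewrite w20 (leq_trans _ w1d) // ltnW.
- by rewrite (ltnW w12).
- exact: leq_trans (ltnW aw) w1d.
- move=> m i m0 nz hi; apply: leq_trans (we0 m m0 nz).
  by rewrite -(eg_mono_gen w12 m0 hi) leq_addr.
apply/eqP; apply/negPn/negP => ng.
have [r rp rd] : exists2 r, prime r & (r %| gcdn (w2 * (1 + d)) (gcdn o (p ^ e)))%N.
  exists (pdiv (gcdn (w2 * (1 + d)) (gcdn o (p ^ e)))); last exact: pdiv_dvd.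
  apply: pdiv_prime; rewrite ltn_neqAle eq_sym ng gcdn_gt0 muln_gt0 w20 //.
move: rd; rewrite !dvdn_gcd => /and3P [r1 r2 r3].
have : (r %| 1 + p ^ e + a * (w2 * (1 + d)))%N by rewrite -ho dvdn_mull.
rewrite (dvdn_addl _ (dvdn_mull a r1)) (dvdn_addl _ r3) dvdn1 => /eqP rr.
by move: rp; rewrite rr.
Qed.
End Nonlinear.

(** * Euler's identity and Gauss's lemma *)

Section Euler.
Variables (K : fieldType).
Notation P2 := {poly {poly K}}.

Lemma lift_top (G1 G2 : P2) e1 e2 : (size G1 <= e1.+1)%N -> (size G2 <= e2.+1)%N ->
  (G1 * G2)`_(e1 + e2) = G1`_e1 * G2`_e2.
Proof.
move=> h1 h2; rewrite coefM; have lt : (e1 < (e1 + e2).+1)%N by rewrite ltnS leq_addr.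
rewrite (bigD1 (Ordinal lt)) //= addKn big1 ?addr0 // => j ne.
have [h|h|h] := ltngtP j e1; last by case/eqP: ne; apply: val_inj.
  by rewrite [G2`_ _]nth_default ?mulr0 // (leq_trans h2) //; move: h; clear; lia.
by rewrite [G1`_ _]nth_default ?mul0r // (leq_trans h1).
Qed.

Lemma size_unit_factors (A : idomainType) (x : A) (P Q : {poly A}) :
  P * Q = x%:P -> x != 0 -> size P = 1%N /\ size Q = 1%N.
Proof.
move=> e x0; have /andP [P0 Q0] : (P != 0) && (Q != 0) by rewrite -negb_or -mulf_eq0 e polyC_eq0.
have m := size_mul P0 Q0; rewrite e size_polyC x0 in m.
rewrite -size_poly_gt0 in P0; rewrite -size_poly_gt0 in Q0.
have ax (u v : nat) : (1 = (u + v).-1 -> 0 < u -> 0 < v -> u = 1 /\ v = 1)%N by clear; lia.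
exact: ax m P0 Q0.
Qed.

Lemma size_theta (G : P2) e (c : K) : size G = e.+1 -> e%:R + c = 0 ->
  (size ('X * G^`() + c%:P%:P * G)%R <= e)%N.
Proof.
move=> sG ec; apply/leq_sizeP => j hj; rewrite coefD coefXM coefCM coef_deriv.
have [h|h] := leqP j e; last by rewrite ![G`__]nth_default ?sG //; case: j hj h => // j hj h; rewrite ?mulr0 ?addr0 // ?mul0rn // ltnS.
have -> : j = e by apply/eqP; rewrite eqn_leq h.
have -> : (if e == 0%N then 0 else G`_e.-1.+1 *+ e.-1.+1) = e%:R *: G`_e.
  by case: (e) => [|e'] /=; rewrite ?scale0r // scaler_nat.
by rewrite mul_polyC -scalerDl ec scale0r.
Qed.

(** A factorization of [Sg] turns Euler's identity into [G1 a + G2 b = c], where [a] and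
    [b] have smaller degree in [t] than [G2] and [G1]. The top coefficients would cancel,
    so that the leading coefficient of [G1] divides that of [b], which has smaller
    degree in [y]. The shift [de] allows for a factor [t] taken from one side. *)
Lemma euler_irreducible (Sg G1 G2 : P2) (c : K) (de N : nat) :
  Sg + 'X * Sg^`() = c%:P%:P -> c != 0 -> Sg = G1 * G2 ->
  (forall i : nat, (size (G1`_i)%R <= (i + de).+1)%N) -> (forall i : nat, (size (G2`_i)%R <= i.+1)%N) ->
  size Sg = N.+1 -> (N.+1%:R = 0 :> K) -> size (Sg`_N) = (N + de).+1%N -> separable_poly (Sg`_N) ->
  size G2 = 1%N \/ (size G1 = 1%N /\ size G1`_0 = 1%N).
Proof.
move=> eu c0 eS h1 h2 sS N1 sW sep.
have Sg0 : Sg != 0 by rewrite -size_poly_eq0 sS.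
have /andP [G10 G20] : (G1 != 0) && (G2 != 0) by rewrite -negb_or -mulf_eq0 -eS.
pose e1 := (size G1).-1; pose e2 := (size G2).-1.
have s1 : size G1 = e1.+1 by rewrite prednK // size_poly_gt0.
have s2 : size G2 = e2.+1 by rewrite prednK // size_poly_gt0.
have eN : N = (e1 + e2)%N.
  by have := size_mul G10 G20; rewrite -eS sS s1 s2 addSn addnS /= => -[].
set W1 := G1`_e1; set W2 := G2`_e2.
have W10 : W1 != 0 by rewrite /W1 /e1 -lead_coefE lead_coef_eq0.
have W20 : W2 != 0 by rewrite /W2 /e2 -lead_coefE lead_coef_eq0.
have eW : Sg`_N = W1 * W2 by rewrite eS eN lift_top ?s1 ?s2.
have cop : coprimep W1 W2 by move: sep; rewrite eW separable_mul => /and3P [].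
have sW1 : size W1 = (e1 + de).+1%N.
  have m := size_mul W10 W20; rewrite -eW sW eN in m.
  have p1 := W10; have p2 := W20; rewrite -size_poly_gt0 in p1; rewrite -size_poly_gt0 in p2.
  have ax (x y : nat) : ((e1 + e2 + de).+1 = (x + y).-1 -> x <= (e1 + de).+1 -> y <= e2.+1 -> 0 < x -> 0 < y -> x = (e1 + de).+1)%N.
    by clear; lia.
  exact: ax m (h1 e1) (h2 e2) p1 p2.
pose a := 'X * G2^`() + (e1.+1%:R)%:P%:P * G2; pose b := 'X * G1^`() + (- e1%:R)%:P%:P * G1.
have ab : G1 * a + G2 * b = c%:P%:P.
  rewrite -eu eS derivM /a /b -[e1.+1]addn1 natrD !rmorphD !rmorphN /=; ring.
have sa : (size a <= e2)%N.
  by apply: size_theta s2 _; rewrite -natrD addnS addnC -eN.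
have sb : (size b <= e1)%N by apply: size_theta s1 _; rewrite subrr.
have c0' : c%:P != 0 :> {poly K} by rewrite polyC_eq0.
have [a0|a0] := eqVneq a 0.
  left; have eb : G2 * b = c%:P%:P by rewrite -ab a0 mulr0 add0r.
  have b0 : b != 0 by apply: contraNneq c0 => z; move/eqP: eb; rewrite z mulr0 eq_sym !polyC_eq0.
  exact: (size_unit_factors eb c0').1.
have sa0 : (0 < size a)%N by rewrite size_poly_gt0.
pose da := (size a).-1; have sda : size a = da.+1 by rewrite prednK.
have [z|pos] := posnP (e1 + da).
  right; have [z1 zd] : e1 = 0%N /\ da = 0%N by move: z; clear; lia.
  have b0 : b = 0 by apply/eqP; rewrite -size_poly_leq0 -[0%N]z1.
  have eG : G1 * a = c%:P%:P by rewrite -ab b0 mulr0 addr0.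
  split; first by rewrite s1 z1.
  have := lift_top (e1 := 0) (e2 := 0) (G1 := G1) (G2 := a); rewrite s1 z1 sda zd eG coefC /= => /(_ (leqnn _) (leqnn _)) e.
  have /andP [p0 q0] : (G1`_0 != 0) && (a`_0 != 0) by rewrite -negb_or -mulf_eq0 -e polyC_eq0.
  exact: (size_unit_factors (esym e) c0).1.
exfalso; have ha : a`_da != 0 by rewrite -lead_coefE lead_coef_eq0.
(* the product G2 * b must cancel the top term of G1 * a *)
have b0 : b != 0.
  apply/eqP => z; move: ab; rewrite z mulr0 addr0 => eG.
  have [u1 u2] := size_unit_factors eG c0'; rewrite s1 in u1; rewrite sda in u2.
  by move: pos u1 u2; clear; case: (e1); case: (da).
pose db := (size b).-1; have sdb : size b = db.+1 by rewrite prednK // size_poly_gt0.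
have hb : b`_db != 0 by rewrite -lead_coefE lead_coef_eq0.
have t1 := size_mul G10 a0; have t2 := size_mul G20 b0.
rewrite s1 sda addSn addnS /= in t1; rewrite s2 sdb addSn addnS /= in t2.
have T1 : (G1 * a)`_(e1 + da) = W1 * a`_da by apply: lift_top; rewrite ?s1 ?sda.
have T2 : (G2 * b)`_(e2 + db) = W2 * b`_db by apply: lift_top; rewrite ?s2 ?sdb.
have eq : (e1 + da = e2 + db)%N.
  have [lt|lt|//] := ltngtP (e1 + da)%N (e2 + db)%N.
    have := congr1 (fun P : P2 => P`_(e2 + db)) ab; rewrite coefD T2 [(G1 * a)`__]nth_default; last first.
      by rewrite t1.
    rewrite add0r coefC gtn_eqF; last exact: leq_ltn_trans lt.
    by move/eqP; rewrite mulf_eq0 (negPf hb) (negPf W20).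
  have := congr1 (fun P : P2 => P`_(e1 + da)) ab; rewrite coefD T1 [(G2 * b)`__]nth_default; last first.
    by rewrite t2.
  rewrite addr0 coefC gtn_eqF //.
  by move/eqP; rewrite mulf_eq0 (negPf ha) (negPf W10).
have top : W1 * a`_da + W2 * b`_db = 0.
  have := congr1 (fun P : P2 => P`_(e1 + da)) ab.
  by rewrite coefD T1 {1}eq T2 coefC gtn_eqF.
have dvd : W1 %| b`_db.
  rewrite -(Gauss_dvdpr _ cop); have -> : W2 * b`_db = W1 * (- a`_da).
    by apply/eqP; rewrite mulrN -addr_eq0 addrC top.
  exact: dvdp_mulr.
have := dvdp_leq hb dvd; rewrite sW1.
have : (size (b`_db)%R <= (db + de).+1)%N.
  rewrite coefD coefXM coefCM (leq_trans (size_polyD _ _)) // geq_max; apply/andP; split.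
    case: eqP => [_|]; first by rewrite size_poly0.
    case: (db) => [//|j] _; rewrite coef_deriv /= -scaler_nat.
    exact: leq_trans (size_scale_leq _ _) (h1 _).
  by rewrite mul_polyC (leq_trans (size_scale_leq _ _)).
rewrite sdb in sb => le1 le2; have := leq_trans le2 le1.
by rewrite ltnS leq_add2r leqNgt sb.
Qed.
End Euler.

Section Gauss.
Variables (K : closedFieldType).
Notation P2 := {poly {poly K}}.

Lemma coef_ev_eq0 (d : P2) r : map_poly (horner_eval r) d = 0 -> exists d', d = ('X - r%:P)%:P * d'.
Proof.
move=> z; exists (map_poly (fun c => c %/ ('X - r%:P)) d); apply/polyP => i.
rewrite coefCM coef_map_id0 ?div0p // mulrC divpK // dvdp_XsubCl rootE.
by have := congr1 (fun P : {poly K} => P`_i) z; rewrite coef_map coef0 => e; apply/eqP; exact: e.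
Qed.

(** Gauss's lemma over an algebraically closed field: each root of [lam] can be divided
    out of one of the two factors. *)
Lemma gauss (lam : {poly K}) (H d w : P2) : lam != 0 -> lam%:P * H = d * w ->
  exists d' w' : P2, [/\ H = d' * w', size d' = size d & size w' = size w].
Proof.
have [n] := ubnP (size lam); elim: n lam d w => // n IH lam d w sl l0 e.
have sz (u : {poly K}) (P : P2) : u != 0 -> size (u%:P * P) = size P by move=> u0; rewrite mul_polyC size_scale.
have [s1|s1] := eqVneq (size lam) 1%N.
  have [x x0 ex] := size_poly1P _ (introT eqP s1).
  exists ((x^-1)%:P%:P * d), w; split => //; last by rewrite sz // polyC_eq0 invr_eq0.
  by rewrite -mulrA -e ex mulrA -!polyCM mulVf // mul1r.
have /closed_rootP [r hr] := s1; have [lam' el] := factor_theorem _ _ hr.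
have r0 : 'X - r%:P != 0 by rewrite polyXsubC_eq0.
have l'0 : lam' != 0 by apply: contraNneq l0 => z; rewrite el z mul0r.
have sl' : (size lam' < n)%N.
  by move: sl; rewrite el size_Mmonic ?monicXsubC // size_XsubC addn2 /=.
have rP0 : ('X - r%:P)%:P != 0 :> P2 by rewrite polyC_eq0.
have : map_poly (horner_eval r) d * map_poly (horner_eval r) w = 0.
  rewrite -rmorphM -e rmorphM /= map_polyC /= /horner_eval (eqP hr) mul0r //.
move/eqP; rewrite mulf_eq0 => /orP [] /eqP /coef_ev_eq0 [u eu].
  have [|d' [w' [e1 e2 e3]]] := IH lam' u w sl' l'0.
    by apply: (mulfI rP0); rewrite mulrA -polyCM [('X - _) * _]mulrC -el e eu mulrA.
  by exists d', w'; split => //; rewrite e2 eu sz.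
have [|d' [w' [e1 e2 e3]]] := IH lam' d u sl' l'0.
  by apply: (mulfI rP0); rewrite mulrA -polyCM [('X - _) * _]mulrC -el e eu mulrCA.
by exists d', w'; split => //; rewrite e3 eu sz.
Qed.
End Gauss.

(** * Points on a fixed absolutely irreducible curve *)

(** A closed field is infinite. *)
Lemma neq0_spec (K : closedFieldType) (v : {poly {poly K}}) : v != 0 -> exists c, v.[c%:P] != 0.
Proof.
move=> v0; have l0 : lead_coef v != 0 by rewrite lead_coef_eq0.
have [r hr] := closed_nonrootP _ l0.
have v1 : map_poly (horner_eval r) v != 0.
  apply: contraNneq hr => z; rewrite rootE -[_.[r]]/(horner_eval r _) lead_coefE -coef_map z coef0 //.
have [c hc] := closed_nonrootP _ v1; exists c; apply: contraNneq hc => z.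
by rewrite rootE -[X in _.[X]](hornerC c r) horner_map /= z /horner_eval horner0.
Qed.

Lemma norm_factor (A : idomainType) n (f E : {poly A}) :
  f \is monic -> size f = n.+1 -> (size E <= n)%N -> E != 0 -> norm n f E = 0 ->
  exists d w (lam : A), [/\ lam != 0, lam%:P * f = d * w, (1 < size d)%N & (size d <= n)%N].
Proof.
move=> fm sf sE E0 z; pose h : {rmorphism A -> {fraction A}} := @FracField.tofrac A.
have ex : exists i, h E`_i != 0.
  by exists (size E).-1; rewrite /h tofrac_eq0 -lead_coefE lead_coef_eq0.
have hz : h (norm n f E) = 0 by rewrite z rmorph0.
have [d [w [e sd1 sdn]]] := norm_common_factor fm sf sE ex hz.
have [a1 [dd [a10 ed]]] := frac_clear d; have [a2 [ww [a20 ew]]] := frac_clear w.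
have hi : injective h by move=> x y /eqP; rewrite /h tofrac_eq => /eqP.
have sdd : size dd = size d.
  by rewrite -(size_map_inj_poly hi (rmorph0 _)) ed mul_polyC size_scale // tofrac_eq0.
exists dd, ww, (a1 * a2); rewrite sdd; split=> //; first by rewrite mulf_neq0.
apply: (map_inj_poly hi (rmorph0 _)).
have ed' : map_poly h dd = (h a1)%:P * d by exact: ed.
have ew' : map_poly h ww = (h a2)%:P * w by exact: ew.
by rewrite !rmorphM /= ed' ew' !map_polyC /= e; exact: mulrACA.
Qed.

Section ConstCurve.
Variables (k : finFieldType) (K : closedFieldType) (io : {rmorphism k -> K}).
Variables (n D : nat) (f0 : {poly {poly k}}).
Hypotheses (n0 : (0 < n)%N) (D0 : (0 < D)%N) (fm : f0 \is monic) (sf : size f0 = n.+1).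
Hypothesis hD : forall i : nat, (size (f0`_i)%R <= D.+1)%N.
Notation ioP := (map_poly io).
Definition closure_curve : {poly {poly K}} := map_poly ioP f0.
Hypothesis irr : forall d w : {poly {poly K}}, closure_curve = d * w -> size d = 1%N \/ size w = 1%N.
Hypothesis fsep : f0^`() != 0.

Lemma closure_curve_monic : closure_curve \is monic. Proof. exact: monic_map. Qed.
Lemma closure_curve_size : size closure_curve = n.+1.
Proof. by rewrite -sf size_map_poly_id0 // (monicP fm) rmorph1 oner_eq0. Qed.

(** A function of degree less than [n] in [y] has no common factor with an irreducible
    equation. *)
Lemma norm_irreducible (P : {poly {poly K}}) : P != 0 -> (size P <= n)%N -> norm n closure_curve P != 0.
Proof.
move=> P0 sP; apply/eqP => z.
have [dd [ww [lam [l0 eG sd1 sdn]]]] := norm_factor closure_curve_monic closure_curve_size sP P0 z.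
have [d' [w' [e' s1 s2]]] := gauss l0 eG.
have := closure_curve_size; have f00 : closure_curve != 0 by rewrite -size_poly_eq0 closure_curve_size.
have /andP [d0 w0] : (d' != 0) && (w' != 0) by rewrite -negb_or -mulf_eq0 -e'.
rewrite e' size_mul // s1 => es.
have [t|t] := irr e'; first by move: sd1; rewrite -s1 t.
by move: es sdn; rewrite t addn1 /= => ->; rewrite ltnn.
Qed.

Lemma norm_spec (P : {poly {poly K}}) x y :
  (map_poly (horner_eval x) closure_curve).[y] = 0 -> (norm n closure_curve P).[x] != 0 -> (map_poly (horner_eval x) P).[y] != 0.
Proof.
move=> h; apply: contraNneq => z; have [u [w e]] := norm_ideal P closure_curve_monic closure_curve_size n0.
have := congr1 (fun Q => (map_poly (horner_eval x) Q).[y]) e.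
rewrite /= map_polyC rmorphD !rmorphM /= hornerC hornerD !hornerM h z !mulr0 addr0 /horner_eval => ->.
by rewrite eqxx.
Qed.

Definition const_family : {poly {poly {poly k}}} := map_poly (map_poly polyC) f0.
Lemma const_family_monic : const_family \is monic. Proof. exact: monic_map. Qed.
Lemma const_family_size : size const_family = n.+1.
Proof. by rewrite -sf size_map_poly_id0 // (monicP fm) rmorph1 oner_eq0. Qed.

(** Where the norm of the derivative does not vanish the fibre is separable. *)
Lemma roots_spec x : (norm n closure_curve closure_curve^`()).[x] != 0 ->
  exists rs : seq K, [/\ uniq rs, size rs = n & forall y, y \in rs -> (map_poly (horner_eval x) closure_curve).[y] = 0].
Proof.
move=> hx; set s := map_poly (horner_eval x) closure_curve.
have sm : s \is monic by apply: monic_map closure_curve_monic.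
have ss : size s = n.+1 by rewrite -closure_curve_size size_map_poly_id0 // (monicP closure_curve_monic) rmorph1 oner_eq0.
have [rs ers] := closed_field_poly_normal s; rewrite (monicP sm) scale1r in ers.
exists rs; split.
- rewrite -separable_prod_XsubC -ers unlock.
  rewrite /coprimep; apply/negPn/negP => /closed_rootP [r]; rewrite root_gcd => /andP [/rootP r1 /rootP r2].
  have := norm_spec r1 hx; rewrite -deriv_map -/s.
  by move: r2; rewrite -?deriv_map => ->; rewrite eqxx.
- by have := size_prod_XsubC rs (fun z : K => z); rewrite -ers ss => -[].
- by move=> y hy; apply/rootP; rewrite -/s ers root_prod_XsubC.
Qed.

Notation U := {poly {poly k}}.
Section N2.
Variables (T l m : nat) (E : aux k T l n m).
Hypothesis Enz : exists u, E u != 0.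
Notation EE := (aux_nested (cU2 k) 'X%:P 'X E).
Notation V := {poly {poly K}}.
Definition rU x0 : {rmorphism U -> {poly K}} := evx ioP x0%:P.
Definition rG x0 : {rmorphism {poly U} -> V} := map_poly (rU x0).
(** Fixes a point [(x0, y0)] of the second copy; [x] and [gamma] remain variables. *)
Definition chi x0 y0 : {rmorphism {poly {poly U}} -> V} := evx (rG x0) y0%:P%:P.

Lemma rUC x0 p : rU x0 p%:P = ioP p.
Proof. exact: evxC. Qed.
Lemma rGC x0 u : rG x0 u%:P = (rU x0 u)%:P.
Proof. exact: map_polyC. Qed.
Lemma chiC x0 y0 u : chi x0 y0 u%:P = rG x0 u.
Proof. exact: evxC. Qed.

Lemma rG_const x0 (p : {poly k}) : rG x0 (evx (jG (cU2 k)) 'X%:P (map_poly polyC p)) = ((ioP p).[x0])%:P%:P.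
Proof.
pose h1 : {rmorphism {poly k} -> V} := rG x0 \o (evx (jG (cU2 k)) 'X%:P \o map_poly polyC).
pose h2 : {rmorphism {poly k} -> V} := (polyC \o polyC) \o (horner_eval x0 \o ioP).
rewrite -[LHS]/(h1 p) -[RHS]/(h2 p); apply: rmorph_poly_eq => [a|] /=.
  have -> : evx (jG (cU2 k)) 'X%:P (map_poly polyC a%:P) = (cU2 k a)%:P by rewrite map_polyC /= evxC jGC.
  rewrite (rGC x0) /cU2 /= (rUC x0) !map_polyC /horner_eval hornerC //.
by rewrite !map_polyX evxX /rG /= map_polyC /= /rU /= evxX /horner_eval hornerX.
Qed.

Lemma chi_const x0 y0 (p : {poly k}) : chi x0 y0 (evx (jP (cU2 k)) ('X%:P)%:P%:P (map_poly polyC p)) = (ioP p)%:P.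
Proof.
pose h1 : {rmorphism {poly k} -> V} := chi x0 y0 \o (evx (jP (cU2 k)) ('X%:P)%:P%:P \o map_poly polyC).
pose h2 : {rmorphism {poly k} -> V} := polyC \o ioP.
rewrite -[LHS]/(h1 p) -[RHS]/(h2 p); apply: rmorph_poly_eq => [a|] /=.
  have -> : evx (jP (cU2 k)) ('X%:P)%:P%:P (map_poly polyC a%:P) = (cU2 k a)%:P%:P by rewrite map_polyC /= evxC /jP /= jGC.
  by rewrite (chiC x0) (rGC x0) /cU2 /= (rUC x0).
by rewrite !map_polyX evxX (chiC x0) (rGC x0) (rUC x0) map_polyX.
Qed.

Lemma chi_coef x0 y0 (P : {poly {poly U}}) t a : (size P <= n)%N ->
  ((chi x0 y0 P)`_t)`_a =
  (map_poly (horner_eval x0) (map_poly ioP (\poly_(j < n) map_poly (coefp a) P`_j`_t))).[y0].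
Proof.
move=> sP.
have rGc u : (rG x0 u)`_t = rU x0 u`_t by exact: coef_map.
have rUc (u : U) : (rU x0 u)`_a = (ioP (map_poly (coefp a) u)).[x0].
  have -> : rU x0 u = \sum_(b < size u) ioP u`_b * (x0%:P) ^+ b.
    rewrite /rU /= /evx /= /horner_eval (@horner_coef_wide _ (size u)) ?size_poly //.
    by apply: eq_bigr => b _; rewrite coef_map.
  rewrite coef_sum (@horner_coef_wide _ (size u)); last first.
    by apply: leq_trans (size_poly _ _) _; exact: size_poly.
  apply: eq_bigr => b _; by rewrite -polyC_exp coefMC !coef_map.
have -> : chi x0 y0 P = \sum_(j < n) rG x0 P`_j * (y0%:P%:P) ^+ j.
  rewrite /chi /= /evx /= /horner_eval (@horner_coef_wide _ n); last exact: leq_trans (size_poly _ _) sP.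
  by apply: eq_bigr => j _; rewrite (coef_map (rG x0)).
rewrite !coef_sum (@horner_coef_wide _ n); last first.
  by do 2!apply: leq_trans (size_poly _ _) _; exact: size_poly.
apply: eq_bigr => j _; rewrite -!polyC_exp !coefMC rGc rUc !coef_map coef_poly ltn_ord //.
Qed.

(** Some coefficient of the auxiliary polynomial is a nonzero function [g] on the second
    copy. Choose [x0] off the zeros of the norms of [g] and of the derivative. The fibre
    above [x0] then has [n] points, and at each of them the first norm does not vanish;
    a polynomial of degree less than [n] cannot vanish at all of them. *)
Theorem const_N2 : N2 (cU2 k) 'X%:P 'X E const_family != 0.
Proof.
have [i [ti [ai hi]]] : exists i t a, exists2 j, (j < n)%N & EE`_i`_j`_t != 0 /\ exists b, EE`_i`_j`_t`_b`_a != 0.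
  have lc (A : idomainType) (P : {poly A}) : P != 0 -> exists2 i, (i < size P)%N & P`_i != 0.
    by move=> P0; exists (size P).-1; rewrite -?lead_coefE ?lead_coef_eq0 // prednK // size_poly_gt0.
  have [i _ h1] := lc _ _ (aux_nested_neq0 Enz); have [j hj h2] := lc _ _ h1.
  have [t _ h3] := lc _ _ h2; have [b _ h4] := lc _ _ h3; have [a _ h5] := lc _ _ h4.
  exists i, t, a, j; first exact: leq_trans hj (aux_nested_sizei _ _ _ _ _).
  by split => //; exists b.
have [j hj [_ [b hb]]] := hi.
pose g : {poly {poly k}} := \poly_(j < n) map_poly (coefp ai) EE`_i`_j`_ti.
have g0 : g != 0.
  apply: contraNneq hb => z; have := congr1 (fun P : {poly {poly k}} => P`_j`_b) z.
  by rewrite !coef0 coef_poly hj coef_map_id0 /= ?coef0 // => ->.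
pose gK : {poly {poly K}} := map_poly ioP g.
have gK0 : gK != 0 by rewrite map_poly_eq0_id0 // map_poly_eq0 lead_coef_eq0.
have sg : (size gK <= n)%N by apply: leq_trans (size_poly _ _) (size_poly _ _).
have fK'0 : closure_curve^`() != 0.
  by rewrite deriv_map map_poly_eq0_id0 // map_poly_eq0 lead_coef_eq0.
have sf' : (size closure_curve^`() <= n)%N by rewrite -ltnS -closure_curve_size lt_size_deriv // -size_poly_eq0 closure_curve_size.
have p0 := norm_irreducible gK0 sg; have p1 := norm_irreducible fK'0 sf'.
have p01 : norm n closure_curve gK * norm n closure_curve closure_curve^`() != 0 by rewrite mulf_neq0.
have [x0 hx0] := closed_nonrootP _ p01.
move: hx0; rewrite rootE hornerM mulf_eq0 negb_or => /andP [hg hf].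
have [rs [urs srs hrs]] := roots_spec hf.
apply/eqP => z.
pose F' := fy' (cU2 k) 'X const_family; pose RR := R1 (cU2 k) 'X%:P 'X E const_family.
have Fm : F' \is monic by apply: monic_map const_family_monic.
have zz : norm n (map_poly (rG x0) F') (map_poly (rG x0) RR) = 0.
  rewrite -map_norm // -[norm n F' RR]/(N2 (cU2 k) 'X%:P 'X E const_family) z; exact: rmorph0.
have Fm2 : map_poly (rG x0) F' \is monic by apply: monic_map.
have Fs2 : size (map_poly (rG x0) F') = n.+1.
  rewrite size_map_poly_id0 ?(monicP Fm) ?rmorph1 ?oner_eq0 //.
  by rewrite size_map_poly_id0 ?(monicP const_family_monic) ?rmorph1 ?oner_eq0 // const_family_size.
have [Q [w [Q0 sQ eQ]]] := norm_eq0 Fm2 Fs2 zz.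
have Fc i0 : (map_poly (rG x0) F')`_i0 = ((ioP f0`_i0).[x0])%:P%:P.
  have e1 : F'`_i0 = evx (jG (cU2 k)) 'X%:P const_family`_i0 by exact: coef_map.
  have e2 : const_family`_i0 = map_poly polyC f0`_i0 by exact: coef_map.
  rewrite coef_map e1 e2; exact: rG_const.
have Froot y : y \in rs -> (map_poly (rG x0) F').[y%:P%:P] = 0.
  move=> /hrs hy.
  have -> : map_poly (rG x0) F' = map_poly (polyC \o polyC) (map_poly (horner_eval x0) closure_curve).
    by apply/polyP => i0; rewrite Fc !coef_map.
  by rewrite -[y%:P%:P]/((polyC \o polyC) y) horner_map hy rmorph0.
have key y : y \in rs -> (map_poly (rG x0) RR).[y%:P%:P] != 0.
  move=> hy; rewrite -[_.[_]]/(chi x0 y RR).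
  have fym : fy (cU2 k) 'X%:P const_family \is monic by apply: monic_map const_family_monic.
  rewrite /RR /R1 map_norm //.
  have -> : map_poly (chi x0 y) (fy (cU2 k) 'X%:P const_family) = map_poly polyC closure_curve.
    apply/polyP => i0.
    have e1 : (fy (cU2 k) 'X%:P const_family)`_i0 = evx (jP (cU2 k)) ('X%:P)%:P%:P const_family`_i0 by exact: coef_map.
    have e2 : const_family`_i0 = map_poly polyC f0`_i0 by exact: coef_map.
    rewrite coef_map e1 e2 !coef_map; exact: chi_const.
  set P := map_poly _ EE.
  have sP : (size P <= n)%N by apply: leq_trans (size_poly _ _) (aux_nested_size _ _ _ _).
  have P0 : P != 0.
    have h := norm_spec (hrs y hy) hg.
    apply: contraNneq h => zP; rewrite /gK /g -chi_coef ?aux_nested_sizei // -coef_map -/P zP !coef0 //.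
  have hl : lead_coef P != 0 by rewrite lead_coef_eq0.
  have [c hc] := neq0_spec hl.
  apply/eqP => zn; have := congr1 (horner_eval c%:P) zn.
  rewrite rmorph0 map_norm; last by apply: monic_map closure_curve_monic.
  have -> : map_poly (horner_eval c%:P) (map_poly polyC closure_curve) = closure_curve.
    by apply/polyP => i0; rewrite !coef_map /= /horner_eval hornerC.
  apply/eqP/norm_irreducible; last exact: leq_trans (size_poly _ _) sP.
  apply: contraNneq hc => z2; rewrite -[_.[_]]/(horner_eval c%:P _) lead_coefE -coef_map z2 coef0 //.
have rQ : all (root Q) [seq (y%:P%:P : V) | y <- rs].
  apply/allP => _ /mapP [y hy ->]; rewrite rootE.
  have := congr1 (fun W => W.[y%:P%:P]) eQ; rewrite !hornerM (Froot y hy) mulr0 => /eqP.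
  by rewrite mulf_eq0 (negPf (key y hy)) orbF.
have := max_poly_roots Q0 rQ; rewrite map_inj_uniq ?urs; last by move=> a b' /polyC_inj /polyC_inj.
by rewrite size_map srs ltnNge sQ => /(_ isT).
Qed.
End N2.
End ConstCurve.

Definition curve_const n D := (stl n D + 1 + 4 * (D * n * n * n) + 4 * (n * (kummer_threshold n D + Gam n D (stT n D)).+1))%N.

Section ConstCount.
Variables (k : finFieldType) (K : closedFieldType) (io : {rmorphism k -> K}).
Variables (n D : nat) (f0 : {poly {poly k}}).
Hypotheses (n0 : (0 < n)%N) (D0 : (0 < D)%N) (fm : f0 \is monic) (sf : size f0 = n.+1).
Hypothesis hD : forall i : nat, (size (f0`_i)%R <= D.+1)%N.
Hypothesis irr : forall d w : {poly {poly K}}, closure_curve io f0 = d * w -> size d = 1%N \/ size w = 1%N.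
Hypothesis fsep : f0^`() != 0.
Notation q := #|k|.
Notation pts0 := [set u : k * k | bev f0 u.1 u.2 == 0%R].

Lemma fibre_le x : (#|[set y | bev f0 x y == 0%R]| <= n)%N.
Proof.
have s : size (map_poly (horner_eval x) f0) = n.+1.
  by rewrite -sf size_map_poly_id0 // (monicP fm) rmorph1 oner_eq0.
have s0 : map_poly (horner_eval x) f0 != 0 by rewrite -size_poly_eq0 s.
by have := roots_le s0 (eq_leq s); apply: leq_trans; apply/subset_leq_card/subsetP => y; rewrite !inE.
Qed.

Lemma singular_le : (#|[set u : k * k | (bev f0 u.1 u.2 == 0%R) && (bev f0^`() u.1 u.2 == 0%R)]| <= D * n * n * n)%N.
Proof.
pose r := norm n f0 f0^`().
have r0 : r != 0.
  have sK : size (closure_curve io f0) = n.+1 by apply: closure_curve_size.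
  have f'0 : (closure_curve io f0)^`() != 0 by rewrite deriv_map map_poly_eq0_id0 // map_poly_eq0 lead_coef_eq0.
  have sf' : (size (closure_curve io f0)^`()%R <= n)%N by rewrite -ltnS -sK lt_size_deriv // -size_poly_eq0 sK.
  have := norm_irreducible fm sf irr f'0 sf'; rewrite deriv_map -map_norm //.
  by rewrite map_poly_eq0.
have sr : (size r <= (D * n * n).+1)%N.
  have hf : wfil (degf k) D (D * n)%N f0.
    by apply: wfil_monic => // i hi; apply/degfP.
  have hf' : wfil (degf k) D (D * n)%N f0^`().
    move=> i; case: ifP => hi; last first.
      rewrite nth_default //; have : (size f0^`() < n.+1)%N by rewrite -sf lt_size_deriv // -size_poly_eq0 sf.
      move=> h; apply: leq_trans (_ : n <= i)%N; first by rewrite -ltnS.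
      by rewrite leqNgt; apply/negP => h'; move/negP: hi; apply; rewrite leq_mul2l (ltnW h') orbT.
    have h := hf i.+1; rewrite coef_deriv; case: ifP h => hi1 h.
      have hn := fil_nat (degf k) 0 i.+1; rewrite -mulr_natr.
      apply: (@filW _ _ (D * n - D * i.+1 + 0)%N); first by rewrite addn0 leq_sub2l // leq_mul2l leqnSn orbT.
      exact: (filM h hn).
    by rewrite h mul0rn; apply: fil0.
  by have /degfP := fil_norm fm sf hf hf'.
rewrite card_fibres; apply: leq_trans (_ : \sum_(x | root r x) n <= _)%N; last first.
  by rewrite sum_nat_const leq_mul2r -[X in (X <= _)%N]cardsE (roots_le r0 sr) orbT.
rewrite [leqRHS]big_mkcond /=; apply: leq_sum => x _; case: ifP => hx.
  apply: leq_trans (fibre_le x); apply/subset_leq_card/subsetP => y; rewrite !inE /=; by case/andP.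
rewrite leqn0 cards_eq0; apply/eqP/setP => y; rewrite !inE /=; apply/negP => /andP [/eqP e1 /eqP e2].
case/negP: hx; rewrite rootE; have [u [w e]] := norm_ideal f0^`() fm sf n0.
have := congr1 (fun Q => bev Q x y) e; rewrite /bev map_polyC rmorphD !rmorphM /= hornerC hornerD !hornerM.
by rewrite -/(bev f0 x y) -/(bev f0^`() x y) e1 e2 !mulr0 addr0 /horner_eval => ->.
Qed.

(** No parameter occurs in the equation, so that any good value of [gamma] will do. *)
Theorem const_count : (4 * #|pts0| <= 5 * q + curve_const n D)%N.
Proof.
have triv : (#|pts0| <= n * q)%N.
  rewrite card_fibres; apply: leq_trans (_ : \sum_(x : k) n <= _)%N; last by rewrite sum_nat_const mulnC.
  apply: leq_sum => x _; apply: leq_trans (fibre_le x); apply/subset_leq_card/subsetP => y; by rewrite !inE.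
have [small|big] := leqP q (kummer_threshold n D + Gam n D (stT n D)).
  have aux (a s m x t1 t2 : nat) : (a <= m -> m <= t2 -> 4 * a <= 5 * x + (s + t1 + 4 * t2))%N by clear; lia.
  apply: aux triv _; rewrite leq_mul2l ltnW ?orbT //.
have [hn hM hX hG] : [/\ n <= q, stM n D <= q, Xde n D (stl n D) < q & Gam n D (stT n D) < q]%N.
  have aux (a b c d e : nat) : ((a + b + c).+1 + e < d -> [/\ a <= d, b <= d, c < d & e < d])%N by clear; move=> h; split; lia.
  exact: (aux _ _ _ _ _ big).
have f3c i : (const_family f0)`_i = map_poly polyC f0`_i by exact: coef_map.
have hsx i : (i < n)%N -> (size ((const_family f0)`_i)%R <= D.+1)%N.
  by move=> _; rewrite f3c; apply: leq_trans (size_poly _ _) (hD i).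
have hsg' i j : (size (((const_family f0)`_i)`_j)%R <= D.+1)%N.
  by rewrite f3c coef_map (leq_trans (size_polyC_leq1 _)).
have f3m := const_family_monic fm; have f3s := const_family_size fm sf.
have [E nzE hE] := stepanov n0 D0 f3m f3s hsx hsg' hn hM.
have N2nz := const_N2 n0 fm sf irr fsep nzE.
have fb := few_bad n0 f3m f3s hsx (fun i j _ => hsg' i j) N2nz hX.
have [c hc] : exists c : k, norm n (fspec c (const_family f0)) (Phi c E) != 0.
  have : [set c : k | norm n (fspec c (const_family f0)) (Phi c E) == 0] != setT.
    by apply: contraTneq fb => ->; rewrite cardsT -ltnNge.
  rewrite -subTset => /subsetPn [c _]; rewrite inE => hc; by exists c.
have h := hE c hc.
have le : (#|pts0| <= \sum_x size (pts c (const_family f0) x) + D * n * n * n)%N.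
  rewrite -(cardsID [set u | bev f0^`() u.1 u.2 == 0]) addnC; apply: leq_add; last first.
    by apply: leq_trans singular_le; apply/subset_leq_card/subsetP => u; rewrite !inE.
  rewrite card_fibres; apply: leq_sum => x _.
  rewrite /pts -(size_map id) map_id cardE; apply: uniq_leq_size; first exact: enum_uniq.
  move=> y; rewrite mem_enum !inE mem_filter mem_enum andbT /= => /andP [hS e].
  have -> : (const_family f0)^`() = const_family f0^`() by rewrite /const_family -!deriv_map.
  by rewrite /const_family !fpt_evx e hS.
have aux (a x t z w y : nat) : (4 * x <= 5 * z + t + 1 -> a <= x + y -> 4 * a <= 5 * z + (t + 1 + 4 * y + w))%N by clear; lia.
exact: aux h le.
Qed.
End ConstCount.

(** * Linearized polynomials *)

Section Family.
Variables (K : fieldType).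
Notation P2 := {poly {poly K}}.
(** Puts a plane curve in polar form: [x] becomes [t] and [y] becomes [y t], so that the
    coefficient of [t ^ d] is the homogeneous component of degree [d]. *)
Definition polar : {rmorphism P2 -> P2} := lift [the {rmorphism {poly K} -> {poly K}} of idfun] 1.

Lemma polar_coef Q t j : ((polar Q)`_t)`_j = (Q`_j * 'X^j)`_t.
Proof. by rewrite lift_coef /= mul1n. Qed.
Lemma polar_size Q t : (size ((polar Q)`_t)%R <= t.+1)%N.
Proof. by apply/leq_sizeP => j hj; rewrite polar_coef coefMXn hj. Qed.
Lemma polarC (c : {poly K}) : polar c%:P = map_poly polyC c.
Proof. exact: liftC. Qed.
Lemma polarX : polar 'X = 'X%:P * 'X.
Proof. exact: liftX. Qed.
Lemma polar_const Q : (size (polar Q) <= 1)%N -> (size Q <= 1)%N.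
Proof.
move=> h; apply/leq_sizeP => j hj; apply/polyP => r; rewrite coef0.
have := polar_coef Q (r + j) j; rewrite coefMXn ltnNge leq_addl /= addnK => <-.
by rewrite [(polar Q)`__]nth_default ?coef0 // (leq_trans h) // (leq_trans hj) // leq_addl.
Qed.

(** All the degrees [p ^ i - 1] are congruent to [-1], except for [i = 0]; this is Euler's
    identity. In characteristic two ([de = 1]) a factor [t] is removed first. *)
Lemma irr_family p (m de : nat) (w : nat -> {poly K}) (c : K) (F : P2) :
  p \in [pchar K] -> (0 < m)%N -> (de <= 1)%N ->
  polar F = 'X^de * \sum_(i < m.+1) (w i)%:P * 'X^(p ^ i - 1) ->
  w 0%N = c%:P -> c != 0 -> size (w m) = (p ^ m + de)%N -> separable_poly (w m) ->
  forall d u : P2, F = d * u -> size d = 1%N \/ size u = 1%N.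
Proof.
move=> pc m0 de1 eF w0 c0 sw sep.
have pp := pcharf_prime pc; set N := (p ^ m - 1)%N.
have pN : (p ^ m = N.+1)%N by rewrite /N subn1 prednK // expn_gt0 prime_gt0.
set Sg := \sum_(i < m.+1) _ in eF.
have ex_inj (i j : nat) : (p ^ i - 1 = p ^ j - 1)%N -> i = j.
  move=> e; apply/eqP; rewrite -(eqn_exp2l _ _ (prime_gt1 pp)).
  have h1 : (0 < p ^ i)%N by rewrite expn_gt0 prime_gt0.
  have h2 : (0 < p ^ j)%N by rewrite expn_gt0 prime_gt0.
  by move: e h1 h2; clear; lia.
have SgN : Sg`_N = w m.
  rewrite coef_sum (bigD1 ord_max) //= coefCXn eqxx big1 ?addr0 // => i ne.
  rewrite coefCXn; case: eqP => // /ex_inj e; case/eqP: ne; apply: val_inj; exact: esym e.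
have wm0 : w m != 0 by rewrite -size_poly_gt0 sw pN.
have sS : size Sg = N.+1.
  apply/eqP; rewrite eqn_leq; apply/andP; split.
    apply: leq_trans (size_sum _ _ _) _; apply/bigmax_leqP => i _.
    rewrite mul_polyC (leq_trans (size_scale_leq _ _)) // size_polyXn ltnS leq_sub2r //.
    by rewrite leq_exp2l ?prime_gt1 // -ltnS.
  by rewrite ltnNge; apply/negP => h; move: wm0; rewrite -SgN nth_default ?eqxx.
have eu : Sg + 'X * Sg^`() = c%:P%:P.
  rewrite /Sg linear_sum /= mulr_sumr -big_split /= big_ord_recl big1 ?addr0 => [|i _].
    by rewrite expn0 subnn expr0 mulr1 derivC mulr0 addr0 w0.
  have e1 : ((p ^ i.+1 - 1).-1.+1 = p ^ i.+1 - 1)%N.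
    rewrite prednK // subn_gt0 -{1}(expn0 p) ltn_exp2l ?prime_gt1 //.
  have e2 : ((p ^ i.+1 - 1).+1 = p ^ i.+1)%N by rewrite subn1 prednK // expn_gt0 prime_gt0.
  rewrite derivM derivC mul0r add0r derivXn mulrCA mulrnAr -exprS /= e1 mulrnAr -mulrS e2.
  have pP : p \in [pchar P2] by apply: (rmorph_pchar polyC); apply: (rmorph_pchar polyC).
  by rewrite -mulr_natr expnS natrM (pcharf0 pP) mul0r mulr0.
have N1 : N.+1%:R = 0 :> K.
  by rewrite -pN -(prednK m0) expnS natrM (pcharf0 pc) mul0r.
have eul G1 G2 := @euler_irreducible K Sg G1 G2 c de N eu c0.
have pz (Q : P2) : Q != 0 -> polar Q != 0 by apply: lift_inj.
have X0 : 'X^de != 0 :> P2 by rewrite -size_poly_eq0 size_polyXn.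
have F0 : F != 0.
  apply: contraNneq wm0 => z; rewrite -SgN; move/eqP: eF; rewrite z rmorph0 eq_sym mulf_eq0 (negPf X0) /=.
  by move=> /eqP ->; rewrite coef0.
have size1 (Q : P2) : Q != 0 -> size (polar Q) = 1%N -> size Q = 1%N.
  by move=> Q0 h; apply/eqP; rewrite eqn_leq polar_const ?h // size_poly_gt0.
have half (d u G : P2) : F = d * u -> polar d = 'X^de * G -> size u = 1%N \/ (de = 0%N /\ size d = 1%N).
  move=> e ed; have /andP [d0 u0] : (d != 0) && (u != 0) by rewrite -negb_or -mulf_eq0 -e.
  have eS : Sg = G * polar u.
    by apply: (mulfI X0); rewrite -eF e rmorphM ed mulrA.
  have hG (i : nat) : (size (G`_i)%R <= (i + de).+1)%N.
    have -> : G`_i = (polar d)`_(i + de) by rewrite ed coefXnM ltnNge leq_addl /= addnK.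
    exact: polar_size.
  have [||h|[h1 h2]] := eul _ _ eS hG (polar_size u) sS N1 _ _.
  - by rewrite SgN sw pN.
  - by rewrite SgN.
  - by left; apply: size1.
  right; case: (de) de1 ed sw hG => [|[|//]] _ ed sw' _.
    by split => //; apply: size1 => //; rewrite ed expr0 mul1r.
  exfalso; have : Sg`_N = G`_0 * (polar u)`_N.
    by rewrite eS {1}(size1_polyC (eq_leq h1)) coefCM.
  rewrite SgN => eW; have : (size (w m) <= N.+1)%N.
    rewrite eW {1}(size1_polyC (eq_leq h2)) mul_polyC (leq_trans (size_scale_leq _ _)) //.
    exact: polar_size.
  by rewrite sw' pN addn1 ltnn.
move=> d u e; case: (posnP de) => [z|dp].
  have [h|[_ h]] := half d u (polar d) e (etrans (esym (mul1r _)) (congr1 (fun j => 'X^j * polar d) (esym z))); by [right | left].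
have d1 : de = 1%N by apply/eqP; rewrite eqn_leq de1.
have : (polar d)`_0 * (polar u)`_0 = 0.
  by rewrite -coef0M -rmorphM -e eF d1 coef0M coefX mul0r.
have fac (Q : P2) : (polar Q)`_0 = 0 -> exists G, polar Q = 'X^de * G.
  move=> z; exists (drop_poly 1 (polar Q)); rewrite d1 expr1; apply/polyP => i.
  by rewrite coefXM coef_drop_poly; case: i => [|i]; rewrite ?z //= addn1.
move/eqP; rewrite mulf_eq0 => /orP [] /eqP /fac [G eG].
  by have [h|[z _]] := half d u G e eG; [right | rewrite z in dp].
have e' : F = u * d by rewrite mulrC.
by have [h|[z _]] := half u d G e' eG; [left | rewrite z in dp].
Qed.
End Family.

Lemma monic_add (A : nzRingType) n (g : {poly A}) : (size g <= n)%N -> ('X^n + g \is monic) /\ size ('X^n + g) = n.+1.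
Proof.
move=> h; have h' : (size g < size ('X^n : {poly A}))%N by rewrite size_polyXn ltnS.
by split; [rewrite monicE lead_coefDl // lead_coefXn | rewrite size_polyDl // size_polyXn].
Qed.

Section LinearCount.
Variables (k : finFieldType) (p m : nat) (a : nat -> k).
Hypotheses (pc : p \in [pchar k]) (a0 : a 0%N != 0) (am : a m != 0).
Notation q := #|k|.
Notation P2k := {poly {poly k}}.
Let pp : prime p := pcharf_prime pc.

Definition lin (x : k) : k := \sum_(i < m.+1) a i * x ^+ (p ^ i)%N.
(** The sum of the squares of the fibre sizes of [x |-> x (lin x)]. *)
Definition moment2 : nat := #|[set u : k * k | u.1 * lin u.1 == u.2 * lin u.2]|.
Definition bn i := a i / a m.
Definition h2 (x y : k) : {rmorphism P2k -> k} := horner_eval y \o map_poly (horner_eval x).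

Lemma h2C x y b : h2 x y b%:P%:P = b.
Proof. by rewrite /h2 /= map_polyC /= /horner_eval !hornerC. Qed.
Lemma h2x x y : h2 x y 'X%:P = x.
Proof. by rewrite /h2 /= map_polyC /= /horner_eval hornerX hornerC. Qed.
Lemma h2y x y : h2 x y 'X = y.
Proof. by rewrite /h2 /= map_polyX /horner_eval hornerX. Qed.

Lemma linD x y : lin (x + y) = lin x + lin y.
Proof.
rewrite /lin -big_split /=; apply: eq_bigr => i _; rewrite -mulrDr exprDn_pchar // pnatX pnatE //.
by apply/orP; left.
Qed.
Lemma linN x : lin (- x) = - lin x.
Proof.
apply/eqP; rewrite -addr_eq0 -linD addNr /lin big1 // => i _.
by rewrite expr0n gtn_eqF ?mulr0 // expn_gt0 prime_gt0.
Qed.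

Lemma pow_succ i : (p ^ i = (p ^ i - 1).+1)%N.
Proof. by rewrite subn1 prednK // expn_gt0 prime_gt0. Qed.
Lemma bn_am i : a m * bn i = a i.
Proof. by rewrite /bn mulrC divfK. Qed.

Lemma bn_m : bn m = 1.
Proof. by rewrite /bn divff. Qed.

Lemma row_le (x0 : k) (P : pred k) : (#|[set u : k * k | (u.1 == x0) && P u.2]| <= q)%N.
Proof.
rewrite card_fibres (bigD1 x0) //= big1 ?addn0 ?max_card // => x ne.
by apply/eqP; rewrite cards_eq0; apply/eqP/setP => y; rewrite !inE /= (negPf ne).
Qed.

Section Curve.
Variables (f0 g0 : P2k) (n de : nat) (bw : forall K : closedFieldType, {rmorphism k -> K} -> nat -> {poly K}) (e : k).
Hypotheses (m0 : (0 < m)%N) (de1 : (de <= 1)%N) (n0 : (0 < n)%N) (ef : f0 = 'X^n + g0) (sg : (size g0 <= n)%N).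
Hypothesis hc : cof (degf k) n f0.
Hypothesis fsep : f0^`() != 0.
Hypothesis hp : forall (K : closedFieldType) (io : {rmorphism k -> K}), [/\
  polar K (closure_curve io f0) = 'X^de * \sum_(i < m.+1) (bw io i)%:P * 'X^(p ^ i - 1),
  bw io 0%N = (io e)%:P, size (bw io m) = (p ^ m + de)%N & separable_poly (bw io m)].
Hypothesis e0 : e != 0.

(** Common to both characteristics: the data [bw] are the homogeneous components at
    [x = 1]. *)
Lemma family_count : (4 * #|[set u : k * k | bev f0 u.1 u.2 == 0%R]| <= 5 * q + curve_const n n)%N.
Proof.
have [K [io _]] := countable_algebraic_closure k.
have [h1 h2 h3 h4] := hp io.
have [fm sf] := monic_add sg; rewrite -ef in fm sf.
apply: (const_count (io := io)) => //.
  by move=> i; have /cofP /(_ i) /degfP := hc.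
move=> d u; apply: irr_family (rmorph_pchar io pc) m0 de1 h1 h2 _ h3 h4 d u.
by rewrite fmorph_eq0.
Qed.
End Curve.

Section Odd.
Hypothesis podd : p != 2%N.
Notation n := (p ^ m - 1)%N.
(** In the coordinates [x + x'] and [x - x'] this is what remains of
    [x M(x) = x' M(x')] off the two lines. *)
Definition odd_curve : P2k := \sum_(i < m.+1) (bn i)%:P%:P * ('X%:P ^+ (p ^ i - 1) + 'X ^+ (p ^ i - 1)).

Lemma two_neq0 : 2%:R != 0 :> k.
Proof. by rewrite -(dvdn_pcharf pc) dvdn_prime2. Qed.

Lemma bev_odd_curve x y : x * y * (a m * bev odd_curve x y) = x * lin y + y * lin x.
Proof.
have -> : bev odd_curve x y = \sum_(i < m.+1) bn i * (x ^+ (p ^ i - 1) + y ^+ (p ^ i - 1)).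
  rewrite -[LHS]/(h2 x y odd_curve) /odd_curve rmorph_sum; apply: eq_bigr => i _.
  rewrite -[LHS]/(h2 x y (_ * _)) rmorphM rmorphD.
  by rewrite (rmorphXn (h2 x y)) (rmorphXn (h2 x y)) h2C h2x h2y.
rewrite /lin !mulr_sumr -big_split /=; apply: eq_bigr => i _; rewrite -(bn_am i).
have e (z : k) : z ^+ (p ^ i) = z * z ^+ (p ^ i - 1) by rewrite -exprS -pow_succ.
rewrite (e x) (e y).
by ring.
Qed.

Lemma odd_curve_count : (0 < m)%N -> (4 * #|[set u : k * k | bev odd_curve u.1 u.2 == 0%R]| <= 5 * q + curve_const n n)%N.
Proof.
move=> m0; have p2 : (2 < p)%N by rewrite ltn_neqAle eq_sym podd prime_gt1.
have n0 : (0 < n)%N by rewrite subn_gt0 -{1}(expn0 p) ltn_exp2l // prime_gt1.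
have in_ (i : 'I_m.+1) : (p ^ i - 1 <= n)%N by rewrite leq_sub2r // leq_exp2l ?prime_gt1 // -ltnS.
pose g0 : P2k := ('X%:P) ^+ n + \sum_(i < m) (bn i)%:P%:P * ('X%:P ^+ (p ^ i - 1) + 'X ^+ (p ^ i - 1)).
have ef : odd_curve = 'X^n + g0.
  rewrite /odd_curve big_ord_recr /= bn_m !polyC1 mul1r /g0; move: (\sum_(i < m) _) => Z; ring.
have sg : (size g0 <= n)%N.
  rewrite (leq_trans (size_polyD _ _)) // geq_max -polyC_exp (leq_trans (size_polyC_leq1 _)) //=.
  apply: leq_trans (size_sum _ _ _) _; apply/bigmax_leqP => i _.
  rewrite mul_polyC (leq_trans (size_scale_leq _ _)) // (leq_trans (size_polyD _ _)) // geq_max -polyC_exp.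
  rewrite (leq_trans (size_polyC_leq1 _)) //= size_polyXn -pow_succ.
  by rewrite -ltnS -pow_succ ltn_exp2l // prime_gt1.
have hc : cof (degf k) n odd_curve.
  apply: fil_sum => i _; rewrite -[n]add0n; apply: filM.
    by apply/wfilC/degfP; rewrite size_polyC_leq1.
  apply: filD; apply: (filW (in_ i)).
    by rewrite -polyC_exp; apply/wfilC/degfP; rewrite size_polyXn.
  have : cof (degf k) (0 * (p ^ i - 1))%N ('X ^+ (p ^ i - 1)) by apply: fil_exp; apply: wfilX.
  by rewrite mul0n; apply: filW.
apply: (@family_count odd_curve g0 n 0 (fun K io i => io (bn i) *: ('X^(p ^ i - 1) + 1)) (2%:R * bn 0)) => //.
- have nk : (n%N)%:R = -1 :> k.
    apply/eqP; rewrite -addr_eq0 -[1]/(1%:R) -natrD addn1 -pow_succ -(prednK m0) expnS natrM (pcharf0 pc) mul0r //.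
  apply: contraTneq isT => z; have := congr1 (fun P : P2k => P`_n.-1) z.
  rewrite coef0 coef_deriv prednK // ef coefD coefXn eqxx [g0`__]nth_default // addr0 => /eqP.
  by rewrite -polyC1 -polyCMn nk polyC_eq0 oppr_eq0 oner_eq0.
- move=> K io; split.
  + rewrite expr0 mul1r /closure_curve /odd_curve !rmorph_sum; apply: eq_bigr => i _.
    rewrite !rmorphM !rmorphD !rmorphXn /= !map_polyC !map_polyX /= map_polyC /= map_polyX.
    rewrite !polarC polarX !map_polyC map_polyX /= -mul_polyC exprMn polyCM polyCD !polyC_exp polyC1; ring.
  + by rewrite expn0 subnn expr0 -[1 + 1]/(2%:R) -[2%:R]scaler_nat scalerA alg_polyC rmorphM rmorph_nat mulrC.
  + rewrite bn_m rmorph1 scale1r size_polyDl size_polyXn ?size_poly1 //.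
      by rewrite addn0 -pow_succ.
  rewrite bn_m rmorph1 scale1r unlock; apply/Bezout_eq1_coprimepP; exists (1, 'X) => /=.
  have nk : (n%N)%:R = -1 :> K.
    apply/eqP; rewrite -addr_eq0 -[1]/(1%:R) -natrD addn1 -pow_succ -(prednK m0) expnS natrM (pcharf0 (rmorph_pchar io pc)) mul0r //.
  rewrite derivD derivXn derivC addr0 mul1r mulrnAr -exprS prednK // -scaler_nat nk scaleN1r; ring.
- by rewrite mulf_neq0 ?two_neq0 // mulf_neq0 ?invr_eq0.
Qed.

Lemma moment2_odd : (4 * moment2 <= 13 * q + curve_const n n)%N.
Proof.
pose T (u : k * k) := (u.1 + u.2, u.1 - u.2).
have Ti : injective T.
  move=> [x y] [x' y'] [e1 e2].
  have ex : 2%:R * x = 2%:R * x' by transitivity ((x + y) + (x - y)); [ring | rewrite e1 e2; ring].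
  have ey : 2%:R * y = 2%:R * y' by transitivity ((x + y) - (x - y)); [ring | rewrite e1 e2; ring].
  by rewrite (mulfI two_neq0 ex) (mulfI two_neq0 ey).
pose S1 := [set u : k * k | (u.1 == 0) && true]; pose S2 := [set u : k * k | u.2 == 0].
pose S3 := [set u : k * k | (u.1 * u.2 != 0) && (bev odd_curve u.1 u.2 == 0)].
have sub : (moment2 <= #|S1| + #|S2| + #|S3|)%N.
  rewrite /moment2 -(card_imset _ Ti); apply: leq_trans (_ : #|S1 :|: S2 :|: S3| <= _)%N; last first.
    by rewrite (leq_trans (leq_card_setU _ _)) // leq_add2r leq_card_setU.
  apply/subset_leq_card/subsetP => _ /imsetP [[x y] hu ->]; move: hu; rewrite !inE /= => /eqP e.
  set u := x + y; set v := x - y.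
  have key : u * lin v + v * lin u = 0.
    have -> : u * lin v + v * lin u = 2%:R * (x * lin x - y * lin y) by rewrite linD linD linN /u /v; ring.
    by rewrite e subrr mulr0.
  have [->|u0] := eqVneq u 0; first by [].
  have [->|v0] := eqVneq v 0; first by rewrite orbT.
  rewrite mulf_neq0 //=; have := bev_odd_curve u v; rewrite key => /eqP.
  by rewrite !mulf_eq0 (negPf u0) (negPf v0) (negPf am) /= => ->.
have c1 : (#|S1| <= q)%N by exact: (row_le 0 xpredT).
have c2 : (#|S2| <= q)%N.
  rewrite card_fibres; apply: leq_trans (_ : \sum_(x : k) 1 <= _)%N; last by rewrite sum1_card.
  by apply: leq_sum => x _; rewrite -(cards1 (0 : k)); apply/subset_leq_card/subsetP => y; rewrite !inE.
have c3 : (4 * #|S3| <= 5 * q + curve_const n n)%N.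
  case: (posnP m) => [z|m0].
    have -> : S3 = set0.
      apply/setP => u; rewrite !inE; apply/negP => /andP [u0 /eqP e].
      have := bev_odd_curve u.1 u.2; rewrite e !mulr0 /lin z !big_ord_recl !big_ord0 !addr0 !expr1 => /esym /eqP.
      have -> : u.1 * (a 0%N * u.2) + u.2 * (a 0%N * u.1) = 2%:R * a 0%N * (u.1 * u.2) by ring.
      by rewrite mulf_eq0 (negPf u0) orbF mulf_eq0 (negPf two_neq0) (negPf a0).
    by rewrite cards0 muln0.
  apply: leq_trans (odd_curve_count m0); rewrite leq_mul2l /=; apply/subset_leq_card/subsetP => u.
  by rewrite !inE => /andP [].
have aux (N x y z s C : nat) : (N <= x + y + z -> x <= s -> y <= s -> 4 * z <= 5 * s + C -> 4 * N <= 13 * s + C)%N by clear; lia.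
exact: aux sub c1 c2 c3.
Qed.
End Odd.

Section Two.
Hypothesis p2 : p = 2%N.
Notation n := (p ^ m)%N.
Definition even_term i : P2k := 'X ^+ (p ^ i) + 'X%:P ^+ (p ^ i - 1) * 'X + 'X%:P ^+ (p ^ i).
(** In the coordinates [x + x'] and [x], the curve that remains off the line [x = x']. *)
Definition even_curve : P2k := (bn 0)%:P%:P * 'X%:P + \sum_(i < m) (bn i.+1)%:P%:P * even_term i.+1.

Lemma addxx (x : k) : x + x = 0.
Proof. by rewrite -mulr2n -mulr_natr -p2 (pcharf0 pc) mulr0. Qed.

Lemma h2_even_term u x i : h2 u x (even_term i) = x ^+ (p ^ i) + u ^+ (p ^ i - 1) * x + u ^+ (p ^ i).
Proof.
rewrite /even_term (rmorphD (h2 u x)) (rmorphD (h2 u x)) (rmorphM (h2 u x)).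
by rewrite (rmorphXn (h2 u x)) (rmorphXn (h2 u x)) (rmorphXn (h2 u x)) h2x h2y.
Qed.

Lemma bev_even_curve u x : u * (a m * bev even_curve u x) = u * lin x + x * lin u + u * lin u.
Proof.
have -> : bev even_curve u x = bn 0 * u + \sum_(i < m) bn i.+1 * (x ^+ (p ^ i.+1) + u ^+ (p ^ i.+1 - 1) * x + u ^+ (p ^ i.+1)).
  rewrite -[LHS]/(h2 u x even_curve) /even_curve rmorphD rmorphM h2C h2x; congr (_ + _).
  rewrite rmorph_sum; apply: eq_bigr => i _.
  by rewrite -[LHS]/(h2 u x (_ * _)) (rmorphM (h2 u x)) h2C h2_even_term.
rewrite /lin !big_ord_recl expn0 !expr1 !mulrDr !mulr_sumr.
have -> : u * (a m * (bn 0 * u)) = u * (a 0%N * u) + (u * (a 0%N * x) + x * (a 0%N * u)).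
  have -> : u * (a 0%N * x) + x * (a 0%N * u) = 0 by rewrite -[RHS](addxx (u * (a 0%N * x))); ring.
  by rewrite -(bn_am 0) addr0; ring.
have -> : \sum_(i < m) u * (a m * (bn i.+1 * (x ^+ (p ^ i.+1) + u ^+ (p ^ i.+1 - 1) * x + u ^+ (p ^ i.+1)))) =
  \sum_(i < m) u * (a (bump 0 i) * x ^+ (p ^ bump 0 i)) + \sum_(i < m) x * (a (bump 0 i) * u ^+ (p ^ bump 0 i))
   + \sum_(i < m) u * (a (bump 0 i) * u ^+ (p ^ bump 0 i)).
  rewrite -!big_split; apply: eq_bigr => i _ /=; rewrite /bump add1n -(bn_am i.+1).
  have -> : x * (a m * bn i.+1 * u ^+ (p ^ i.+1)) = x * (a m * bn i.+1 * (u * u ^+ (p ^ i.+1 - 1))).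
    by rewrite -exprS -pow_succ.
  by ring.
by ring.
Qed.

Lemma even_curve_count : (0 < m)%N -> (4 * #|[set u : k * k | bev even_curve u.1 u.2 == 0%R]| <= 5 * q + curve_const n n)%N.
Proof.
move=> m0; have n0 : (0 < n)%N by rewrite pow_succ.
have n1 : (1 < n)%N by rewrite -{1}(expn0 p) ltn_exp2l // prime_gt1.
have le_ (i : 'I_m) : (p ^ i.+1 <= n)%N by rewrite leq_exp2l ?prime_gt1 // ltn_ord.
have le1 (i : 'I_m) : (p ^ i.+1 - 1 <= n)%N by apply: leq_trans (leq_subr _ _) (le_ i).
have mm : m = m.-1.+1 by rewrite prednK.
pose rest : P2k := 'X%:P ^+ (n - 1) * 'X + 'X%:P ^+ n.
pose g0 : P2k := rest + ((bn 0)%:P%:P * 'X%:P + \sum_(i < m.-1) (bn i.+1)%:P%:P * even_term i.+1).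
have ef : even_curve = 'X^n + g0.
  have -> : even_curve = (bn 0)%:P%:P * 'X%:P + \sum_(i < m.-1.+1) (bn i.+1)%:P%:P * even_term i.+1 by rewrite -mm.
  rewrite big_ord_recr /= -mm bn_m !polyC1 mul1r /g0 /rest /even_term; move: (\sum_(i < m.-1) _) => Z; ring.
have sHr j : (size ('X%:P ^+ (j - 1) * 'X + 'X%:P ^+ j : P2k)%R <= 2)%N.
  rewrite (leq_trans (size_polyD _ _)) // geq_max -!polyC_exp mul_polyC (leq_trans (size_scale_leq _ _)) ?size_polyX //=.
  by rewrite (leq_trans (size_polyC_leq1 _)).
have sg : (size g0 <= n)%N.
  rewrite (leq_trans (size_polyD _ _)) // geq_max (leq_trans (sHr n)) //=.
  rewrite (leq_trans (size_polyD _ _)) // geq_max -polyCM (leq_trans (size_polyC_leq1 _)) //=.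
  apply: leq_trans (size_sum _ _ _) _; apply/bigmax_leqP => i _.
  have lt : (p ^ i.+1 < n)%N by rewrite ltn_exp2l ?prime_gt1 // {2}mm ltnS ltn_ord.
  rewrite mul_polyC (leq_trans (size_scale_leq _ _)) // /even_term -addrA (leq_trans (size_polyD _ _)) // geq_max.
  by rewrite size_polyXn lt (leq_trans (sHr _)).
have hC (b : k) : cof (degf k) 0 b%:P%:P by apply/wfilC/degfP; rewrite size_polyC_leq1.
have hY j : cof (degf k) 0 ('X ^+ j).
  by have h : cof (degf k) (0 * j)%N ('X ^+ j) by [apply: fil_exp; apply: wfilX]; rewrite mul0n in h.
have hX j : cof (degf k) j ('X%:P ^+ j) by rewrite -polyC_exp; apply/wfilC/degfP; rewrite size_polyXn.
have hc : cof (degf k) n even_curve.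
  apply: filD.
    by apply: (filW n0); rewrite -[1%N]add0n; apply: filM (hC _) (hX 1%N).
  apply: fil_sum => i _; rewrite -[n]add0n; apply: filM (hC _) _.
  apply: filD; last by apply: (filW (le_ i)); apply: hX.
  apply: filD; first by apply: (filW (leq0n _)); apply: hY.
  by apply: (filW (le1 i)); rewrite -[X in cof _ X _]addn0; apply: filM (hX _) (hY 1%N).
apply: (@family_count even_curve g0 n 1 (fun K io i => if i == 0%N then (io (bn 0))%:P else io (bn i) *: ('X^(p ^ i) + ('X + 1))) (bn 0)) => //.
- apply: contraTneq isT => z; have := congr1 (fun P : P2k => P`_0`_(n - 1)) z.
  have sH i : (even_term i.+1)`_1 = 'X^(p ^ i.+1 - 1).
    rewrite /even_term !coefD -!polyC_exp coefCM coefX mulr1 coefC addr0 coefXn; case: eqP => [e|_]; last by rewrite add0r.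
    have : (1 < p ^ i.+1)%N by rewrite -{1}(expn0 p) ltn_exp2l // prime_gt1.
    by rewrite -e.
  rewrite !coef0 coef_deriv mulr1n /even_curve coefD -polyCM coefC add0r !coef_sum mm big_ord_recr /= -mm.
  have sHm := sH m.-1; rewrite -mm in sHm.
  rewrite coefCM sHm coefCM bn_m mul1r coefXn eqxx big1 ?add0r; last first.
    move=> i _; rewrite coefCM sH coefCM coefXn; case: eqP => [e|_]; last by rewrite mulr0.
    have lt : (p ^ i.+1 < n)%N by rewrite ltn_exp2l ?prime_gt1 // {2}mm ltnS ltn_ord.
    by move: e lt; rewrite [in (p ^ i.+1)%N]pow_succ; clear -n0; lia.
  by move/eqP; rewrite oner_eq0.
- move=> K io; split.
  + pose ps : {rmorphism P2k -> {poly {poly K}}} := polar K \o map_poly (map_poly io).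
    have psC (b : k) : ps b%:P%:P = (io b)%:P%:P by rewrite /ps /= !map_polyC /= polarC !map_polyC.
    have psx : ps 'X%:P = 'X by rewrite /ps /= map_polyC /= map_polyX polarC map_polyX.
    have psy : ps 'X = 'X%:P * 'X by rewrite /ps /= map_polyX polarX.
    have psH i : ps (even_term i) = ('X%:P * 'X) ^+ (p ^ i) + 'X ^+ (p ^ i - 1) * ('X%:P * 'X) + 'X ^+ (p ^ i).
      rewrite /even_term (rmorphD ps) (rmorphD ps) (rmorphM ps) (rmorphXn ps) (rmorphXn ps) (rmorphXn ps) psx psy //.
    rewrite -[LHS]/(ps even_curve) big_ord_recl mulrDr /even_curve (rmorphD ps) (rmorphM ps) psC psx; congr (_ + _).
      by rewrite /= expn0 subnn expr0 mulr1 expr1 mulrC.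
    rewrite (rmorph_sum ps) mulr_sumr; apply: eq_bigr => i _; rewrite lift0.
    transitivity (ps (bn i.+1)%:P%:P * ps (even_term i.+1)); first exact: (rmorphM ps).
    rewrite psC psH /= -mul_polyC exprMn polyCM !polyCD !polyC_exp polyC1 expr1.
    have -> : 'X ^+ (p ^ i.+1) = 'X * 'X ^+ (p ^ i.+1 - 1) :> {poly {poly K}} by rewrite -exprS -pow_succ.
    by ring.
  + by [].
  + rewrite gtn_eqF // bn_m rmorph1 scale1r size_polyDl size_polyXn ?addn1 // size_XaddC //.
  rewrite gtn_eqF // bn_m rmorph1 scale1r unlock; apply/Bezout_eq1_coprimepP; exists (0, 1) => /=.
  rewrite derivD derivXn derivD derivX derivC addr0 mul0r add0r mul1r -scaler_nat mm expnS natrM (pcharf0 (rmorph_pchar io pc)) mul0r scale0r add0r //.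
- by rewrite mulf_neq0 ?invr_eq0.
Qed.

Lemma moment2_two : (4 * moment2 <= 9 * q + curve_const n n)%N.
Proof.
pose T (u : k * k) := (u.1 + u.2, u.1).
have Ti : injective T.
  by move=> [x y] [x' y'] [e1 e2]; rewrite e2 in e1 *; rewrite (addrI _ e1).
pose S1 := [set u : k * k | (u.1 == 0) && true].
pose S3 := [set u : k * k | (u.1 != 0) && (bev even_curve u.1 u.2 == 0)].
have sub : (moment2 <= #|S1| + #|S3|)%N.
  rewrite /moment2 -(card_imset _ Ti); apply: leq_trans (_ : #|S1 :|: S3| <= _)%N; last exact: leq_card_setU.
  apply/subset_leq_card/subsetP => _ /imsetP [[x y] hu ->]; move: hu; rewrite !inE /= => /eqP e.
  set u := x + y.
  have key : u * lin x + x * lin u + u * lin u = 0.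
    have -> : u * lin x + x * lin u + u * lin u = (y * lin y - x * lin x) + (x * lin x + x * lin x) + (x * lin x + x * lin x)
        + (x * lin y + x * lin y) + (y * lin x + y * lin x) by rewrite linD /u; ring.
    by rewrite !addxx e subrr !addr0.
  have [->|u0] := eqVneq u 0; first by [].
  have := bev_even_curve u x; rewrite key => /eqP.
  by rewrite !mulf_eq0 (negPf u0) (negPf am) /= => ->.
have c1 : (#|S1| <= q)%N by exact: (row_le 0 xpredT).
have c3 : (4 * #|S3| <= 5 * q + curve_const n n)%N.
  case: (posnP m) => [z|m0].
    have -> : S3 = set0.
      apply/setP => u; rewrite !inE; apply/negP => /andP [u0 /eqP e].
      have := bev_even_curve u.1 u.2; rewrite e !mulr0 /lin z !big_ord_recl !big_ord0 !addr0 !expr1 => /esym /eqP.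
      have -> : u.1 * (a 0%N * u.2) + u.2 * (a 0%N * u.1) + u.1 * (a 0%N * u.1) = (a 0%N * u.1 * u.2 + a 0%N * u.1 * u.2) + a 0%N * (u.1 * u.1) by ring.
      by rewrite addxx add0r !mulf_eq0 (negPf u0) (negPf a0).
    by rewrite cards0 muln0.
  apply: leq_trans (even_curve_count m0); rewrite leq_mul2l /=; apply/subset_leq_card/subsetP => u.
  by rewrite !inE => /andP [].
have aux (N x z s C : nat) : (N <= x + z -> x <= s -> 4 * z <= 5 * s + C -> 4 * N <= 9 * s + C)%N by clear; lia.
exact: aux sub c1 c3.
Qed.
End Two.
End LinearCount.

(** * Collisions *)

(** The number of collisions is the sum of the squares of the fibre sizes. *)
Lemma fibre_ineq (T T' : finType) (f : T -> T') al be :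
  (forall x, let m := #|[set y | f y == f x]| in (be * m <= al + m * m)%N) ->
  (be * #|T| <= al * #|[set f x | x in T]| + #|[set u : T * T | f u.1 == f u.2]|)%N.
Proof.
move=> h.
have part (F : T -> nat) : (\sum_x F x = \sum_(y in [set f x | x in T]) \sum_(x | f x == y) F x)%N.
  have := @partition_big_imset _ 0%N addn _ _ f [set: T] F.
  rewrite (eq_bigl xpredT) => [->|x]; last by rewrite inE.
  rewrite (eq_bigl (fun y => y \in [set f x | x in T])) => [|y].
    by apply: eq_bigr => y _; apply: eq_bigl => x; rewrite inE.
  by apply/imsetP/imsetP => -[x _ ->]; exists x.
have cf y : (\sum_(x | f x == y) 1 = #|[set x | f x == y]|)%N by rewrite sum1dep_card.
have -> : #|T| = (\sum_(y in [set f x | x in T]) #|[set x | f x == y]|)%N.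
  by rewrite -sum1_card (eq_bigl xpredT) // part; apply: eq_bigr => y _; apply: cf.
have -> : #|[set u : T * T | f u.1 == f u.2]| =
   (\sum_(y in [set f x | x in T]) #|[set x | f x == y]| * #|[set x | f x == y]|)%N.
  rewrite card_fibres part; apply: eq_bigr => y _; rewrite -{1}cf big_distrl /=.
  apply: eq_bigr => x /eqP e; rewrite mul1n; apply: eq_card => z; by rewrite !inE /= e eq_sym.
rewrite big_distrr /= mulnC -sum_nat_const -big_split /=; apply: leq_sum => y /imsetP [x _ ->].
by have := h x; rewrite /=.
Qed.

Section Collide.
Variables (k : finFieldType) (L M : {poly k}).
Notation q := #|k|.

Definition psi (s : k) (t : k * k) : k * k := (s * t.1 + L.[t.2], s * t.2 + M.[t.1]).
Definition card_im (s : k) := #|[set psi s t | t in {: k * k}]|.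
Definition collisions (s : k) := #|[set u : (k * k) * (k * k) | psi s u.1 == psi s u.2]|.

(** A collision with [s != 0] lies over a common nonzero value of [hdiff M] and [hdiff L],
    and [s] can be recovered from it. *)
Lemma coll_le : (\sum_(s : k | s != 0%R) collisions s <= q ^ 3 + \sum_(c : k | c != 0%R) Ndiff M c * Ndiff L c)%N.
Proof.
pose C' (s : k) := [set u : (k * k) * (k * k) | (psi s u.1 == psi s u.2) && (u.1 != u.2)].
have split s : (collisions s <= q ^ 2 + #|C' s|)%N.
  rewrite /collisions -(cardsID [set u | u.1 == u.2]); apply: leq_add.
    apply: leq_trans (_ : #|[set (t, t) | t in {: k * k}]| <= _)%N.
      apply/subset_leq_card/subsetP => -[t t']; rewrite !inE /= => /andP [_ /eqP ->].
      by apply/imsetP; exists t'.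
    by apply: leq_trans (leq_imset_card _ _) _; rewrite cardE -cardE card_prod -mulnn.
  by apply/subset_leq_card/subsetP => u; rewrite !inE andbC.
apply: leq_trans (_ : \sum_(s : k | s != 0%R) (q ^ 2 + #|C' s|) <= _)%N; first by apply: leq_sum => s _.
rewrite big_split /=; apply: leq_add.
  by rewrite sum_nat_const [leqRHS]expnS leq_mul2r max_card orbT.
pose Z := [set x : k * ((k * k) * (k * k)) | (x.1 != 0) && (x.2 \in C' x.1)].
have -> : (\sum_(s : k | s != 0%R) #|C' s| = #|Z|)%N.
  rewrite card_fibres [RHS](bigID (fun s : k => s != 0)) /= [X in (_ + X)%N]big1 ?addn0.
    by apply: eq_bigr => s s0; apply: eq_card => u; rewrite !inE /= s0.
  by move=> s /negbTE s0; apply/eqP; rewrite cards_eq0; apply/eqP/setP => u; rewrite !inE /= s0.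
pose W := [set x : (k * k) * (k * k) | (hdiff M x.1.1 x.1.2 != 0) && (hdiff M x.1.1 x.1.2 == hdiff L x.2.1 x.2.2)].
have -> : (\sum_(c : k | c != 0%R) Ndiff M c * Ndiff L c = #|W|)%N.
  pose Wc (c : k) := setX [set u : k * k | hdiff M u.1 u.2 == c] [set u : k * k | hdiff L u.1 u.2 == c].
  transitivity (\sum_(c : k | c != 0%R) #|Wc c|)%N; first by apply: eq_bigr => c _; rewrite cardsX.
  have -> : #|W| = (\sum_(x in W) 1)%N by rewrite sum1_card.
  rewrite (partition_big (fun x : (k * k) * (k * k) => hdiff M x.1.1 x.1.2) (fun c => c != 0)) /=; last first.
    by move=> x; rewrite inE => /andP [].
  apply: eq_bigr => c c0; rewrite sum1dep_card; apply: eq_card => x; rewrite !inE.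
  by apply/andP/andP => [[/eqP e1 /eqP e2]|[/andP [_ /eqP e] /eqP e1]]; rewrite -?e ?e1 ?e2 ?eqxx ?c0.
pose T (x : k * ((k * k) * (k * k))) : (k * k) * (k * k) :=
  ((x.2.1.1, x.2.2.1 - x.2.1.1), (x.2.1.2, x.2.2.2 - x.2.1.2)).
have facts x : x \in Z -> [/\ x.2.2.1 - x.2.1.1 != 0, x.2.2.2 - x.2.1.2 != 0,
     hdiff M x.2.1.1 (x.2.2.1 - x.2.1.1) = - (x.1 * (x.2.2.1 - x.2.1.1) * (x.2.2.2 - x.2.1.2)) &
     hdiff L x.2.1.2 (x.2.2.2 - x.2.1.2) = - (x.1 * (x.2.2.1 - x.2.1.1) * (x.2.2.2 - x.2.1.2))].
  case: x => s [[t1 t2] [t1' t2']]; rewrite !inE /= => /andP [s0 /andP [/eqP [e1 e2] ne]].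
  have f1 : L.[t2'] - L.[t2] = - (s * (t1' - t1)).
    apply/eqP; rewrite -subr_eq0 opprK; apply/eqP.
    transitivity (s * t1' + L.[t2'] - (s * t1 + L.[t2])); [by ring | by rewrite e1 subrr].
  have f2 : M.[t1'] - M.[t1] = - (s * (t2' - t2)).
    apply/eqP; rewrite -subr_eq0 opprK; apply/eqP.
    transitivity (s * t2' + M.[t1'] - (s * t2 + M.[t1])); [by ring | by rewrite e2 subrr].
  have h12 : (t1' - t1 == 0) = (t2' - t2 == 0).
    apply/idP/idP; rewrite !subr_eq0 => /eqP e.
      by move/eqP: f2; rewrite e subrr eq_sym oppr_eq0 mulf_eq0 (negPf s0) subr_eq0.
    by move/eqP: f1; rewrite e subrr eq_sym oppr_eq0 mulf_eq0 (negPf s0) subr_eq0.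
  have h1 : t1' - t1 != 0.
    apply: contraNneq ne => z; move: h12; rewrite z eqxx => /esym; rewrite subr_eq0 => /eqP ->.
    by move/eqP: z; rewrite subr_eq0 => /eqP ->.
  by split; rewrite /hdiff -?h12 // [_ + (_ - _)]addrC subrK ?f1 ?f2; ring.
have Ti : {in Z &, injective T}.
  move=> x y hx hy; have [a1 a2 a3 a4] := facts x hx; have [b1 b2 b3 b4] := facts y hy.
  case: x y hx hy a1 a2 a3 a4 b1 b2 b3 b4 => s [[t1 t2] [t1' t2']] [r [[u1 u2] [u1' u2']]] _ _ /=.
  move=> a1 a2 a3 _ b1 b2 b3 _ [e1 e2 e3 e4].
  have E1 : t1' = u1' by rewrite -(subrK t1 t1') e2 e1 subrK.
  have E2 : t2' = u2' by rewrite -(subrK t2 t2') e4 e3 subrK.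
  subst; congr (_, _); move: a3; rewrite b3 => /oppr_inj /(mulIf a2) /(mulIf a1) ->//.
rewrite -(card_in_imset Ti); apply/subset_leq_card/subsetP => _ /imsetP [x hx ->].
have [a1 a2 a3 a4] := facts x hx; move: hx; rewrite !inE /= a3 a4 => /andP [s0 _].
by rewrite eqxx andbT oppr_eq0 !mulf_neq0.
Qed.

Lemma sum_Ndiff (P : {poly k}) : (\sum_c Ndiff P c = q ^ 2)%N.
Proof.
transitivity (\sum_(u : k * k) 1)%N; last by rewrite sum1_card card_prod mulnn.
rewrite (partition_big (fun u : k * k => hdiff P u.1 u.2) predT) //=.
by apply: eq_bigr => c _; rewrite sum1dep_card.
Qed.

Lemma Ndiff_le (P : {poly k}) c : c != 0 -> (Ndiff P c <= size P * q)%N.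
Proof.
move=> c0; rewrite /Ndiff card_fibres; apply: leq_trans (_ : \sum_(x : k) size P <= _)%N; last first.
  by rewrite sum_nat_const mulnC.
apply: leq_sum => x _; pose R : {poly k} := 'X * (P \Po ('X + x%:P) - P.[x]%:P) - c%:P.
have R0 : R != 0.
  apply: contraNneq c0 => z; have := congr1 (horner_eval 0) z.
  by rewrite /horner_eval /R hornerD hornerM hornerX mul0r add0r hornerN hornerC horner0 => /eqP; rewrite oppr_eq0.
have [P0|P0] := posnP (size P).
  have z : P = 0 by apply/eqP; rewrite -size_poly_eq0 P0.
  rewrite z size_poly0 leqn0 cards_eq0; apply/eqP/setP => h; rewrite !inE /= /hdiff !horner0 subrr mulr0.
  by rewrite eq_sym (negPf c0).
have sR : (size R <= (size P).+1)%N.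
  rewrite /R (leq_trans (size_polyD _ _)) // geq_max size_polyN (leq_trans (size_polyC_leq1 _)) // andbT.
  rewrite (leq_trans (size_polyMleq _ _)) // size_polyX /= ltnS (leq_trans (size_polyD _ _)) //.
  rewrite geq_max size_polyN (leq_trans (size_polyC_leq1 _)) // andbT size_comp_poly2 //.
  exact: size_XaddC.
apply: leq_trans (roots_le R0 sR); apply/subset_leq_card/subsetP => h; rewrite !inE /= => /eqP e.
rewrite rootE /R hornerD hornerM hornerX hornerN hornerC hornerD horner_comp !hornerD hornerX !hornerN !hornerC.
by rewrite -e /hdiff [h + x]addrC subrr.
Qed.
End Collide.

(** The total number of pairs is [q ^ 2], so that only the error terms need the bound for
    a single [c]. *)
Lemma sum_bound (k : finFieldType) (A B : k -> nat) C e : almost54 A C ->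
  (forall c, c != 0 -> (B c <= e * #|k|)%N) -> (\sum_c B c = #|k| ^ 2)%N ->
  (4 * \sum_(c : k | c != 0%R) A c * B c <= 5 * #|k| ^ 3 + (C + 4 * (C * e)) * #|k| ^ 2)%N.
Proof.
move=> [dd [h1 h2]] hB sB; set q := #|k|.
have sB' : (\sum_(c : k | c != 0%R) B c <= q ^ 2)%N.
  by rewrite -sB [leqRHS](bigID (fun c : k => c != 0)) leq_addr.
have sD : (\sum_(c : k | c != 0%R) dd c <= C * q)%N.
  by apply: leq_trans h1; rewrite [leqRHS](bigID (fun c : k => c != 0)) leq_addr.
rewrite big_distrr /=.
apply: leq_trans (_ : \sum_(c : k | c != 0%R) ((5 * q + C) * B c + 4 * (e * q) * dd c) <= _)%N.
  apply: leq_sum => c c0; have a1 := h2 c c0; have a2 := hB c c0; rewrite mulnA.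
  apply: leq_trans (leq_mul a1 (leqnn (B c))) _; rewrite mulnDl leq_add2l -!mulnA leq_mul2l /=.
  by rewrite mulnC mulnA leq_mul2r a2 orbT.
rewrite big_split /= -!big_distrr /=.
apply: leq_trans (leq_add (leq_mul (leqnn (5 * q + C)) sB') (leq_mul (leqnn (4 * (e * q))) sD)) _.
by rewrite eq_leq // !expnS expn0; clear; ring.
Qed.

Section LinearFibres.
Variables (k : finFieldType) (p : nat) (L M : {poly k}) (mL mM : nat) (aL aM : nat -> k) (eL eM : k).
Hypothesis pc : p \in [pchar k].
Hypotheses (hL : forall x, L.[x] = lin p mL aL x + eL) (hM : forall x, M.[x] = lin p mM aM x + eM).
Notation q := #|k|.

(** The fibres are cosets of a kernel, whose order divides [q ^ 2]. *)
Lemma fibre_pow s : exists j, forall t, #|[set y | psi L M s y == psi L M s t]| = (p ^ j)%N.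
Proof.
pose Ke := [set z : k * k | (s * z.1 + lin p mL aL z.2 == 0) && (s * z.2 + lin p mM aM z.1 == 0)].
have hK t : #|[set y | psi L M s y == psi L M s t]| = #|Ke|.
  pose f (z : k * k) : k * k := (t.1 + z.1, t.2 + z.2).
  have fi : injective f by move=> [x y] [x' y'] [/addrI -> /addrI ->].
  rewrite -(card_imset Ke fi); apply: eq_card => y; rewrite !inE.
  have e1 (a b : k * k) : (psi L M s (f a) == psi L M s t) = (a \in Ke).
    rewrite inE /psi /f xpair_eqE /= !hL !hM !(linD _ _ pc); congr (_ && _).
      rewrite -subr_eq0; congr (_ == 0); ring.
    rewrite -subr_eq0; congr (_ == 0); ring.
  apply/idP/imsetP => [h|[z hz ->]]; last by rewrite (e1 z z).
  exists (y.1 - t.1, y.2 - t.2); last by rewrite /f /= ![_ + (_ - _)]addrC !subrK -surjective_pairing.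
  by rewrite -(e1 _ t) /f /= ![_ + (_ - _)]addrC !subrK -surjective_pairing.
have dv : (#|Ke| %| q ^ 2)%N.
  rewrite -mulnn -card_prod -cardsT; apply/dvdnP; exists #|[set psi L M s t | t in [set: k * k]]|.
  rewrite -sum1_card (partition_big_imset (psi L M s)) /= -sum_nat_const; apply: eq_bigr => _ /imsetP [t _ ->].
  rewrite -(hK t) -sum1dep_card; apply: eq_bigl => y; by rewrite inE.
have [r er] : exists r, q = (p ^ r)%N by exists (logn p q); exact: (card_pprimeChar pc).
have [j _ ej] : exists2 j, (j <= r * 2)%N & #|Ke| = (p ^ j)%N.
  by apply/(dvdn_pfactor _ _ (pcharf_prime pc)); rewrite expnM -er.
by exists j => t; rewrite hK.
Qed.

Lemma Ndiff_lin (P : {poly k}) m a e c : (forall x, P.[x] = lin p m a x + e) ->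
  Ndiff P c = (q * #|[set h : k | (h * lin p m a h == c)%R]|)%N.
Proof.
move=> hP; rewrite /Ndiff card_fibres -sum_nat_const; apply: eq_bigr => x _; apply: eq_card => h.
rewrite !inE /= /hdiff !hP (linD _ _ pc); congr (_ == _); ring.
Qed.

Lemma moment2_sum m a : (\sum_(c : k) #|[set h : k | (h * lin p m a h == c)%R]| ^ 2 = moment2 p m a)%N.
Proof.
rewrite /moment2 -sum1_card (partition_big (fun u : k * k => u.1 * lin p m a u.1) predT) //=.
apply: eq_bigr => c _; rewrite -mulnn -cardsX sum1dep_card; apply: eq_card => -[x y].
rewrite !inE /=; apply/andP/andP => [[/eqP e1 /eqP e2]|[/eqP e1 /eqP e2]]; last by rewrite -e1 e2.
by rewrite e1 e2.
Qed.

(** Cauchy's inequality between the solutions for [L] and for [M]. *)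
Lemma lin_sum C : (4 * moment2 p mM aM + 4 * moment2 p mL aL <= C)%N ->
  (8 * \sum_(c : k | c != 0%R) Ndiff M c * Ndiff L c <= C * q ^ 2)%N.
Proof.
move=> hC; rewrite [leqRHS]mulnC; apply: leq_trans (leq_mul (leqnn _) hC).
rewrite -!moment2_sum -mulnDr -big_split /= big_distrr /= !big_distrr /=.
rewrite [leqRHS](bigID (fun c : k => c != 0)) /=; apply: leq_trans (leq_addr _ _).
apply: leq_sum => c _; rewrite (Ndiff_lin c hM) (Ndiff_lin c hL).
move: #|[set h | _]| #|[set h | _]| => x y; have h := leq_mul (leqnn (4 * q ^ 2)) (nat_Cauchy x y).1.
by move: h; move: #|k| => z; rewrite !expnS !expn0 !muln1; clear; lia.
Qed.
End LinearFibres.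

(** The exponents that occur are zero or powers of [p]. *)
Definition powerfree (R : nzRingType) p (M : {poly R}) : bool :=
  [forall l : 'I_(size M), (0 < l)%N && (M`_l != 0) ==> (cdeg p l <= 1)%N].

Lemma powerfreeN (R : nzRingType) p (M : {poly R}) : ~~ powerfree p M ->
  exists l : nat, [/\ (0 < l)%N, M`_l != 0 & (1 < cdeg p l)%N].
Proof.
rewrite negb_forall => /existsP [l]; rewrite negb_imply -ltnNge => /andP [/andP [l0 nz] cl].
by exists l.
Qed.

Lemma powerfree_form (R : nzRingType) p (M : {poly R}) d : prime p -> powerfree p M -> size M = d.+1 -> (0 < d)%N ->
  exists m, d = (p ^ m)%N /\ M = \sum_(i < m.+1) M`_(p ^ i) *: 'X^(p ^ i)%N + (M`_0)%:P.
Proof.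
move=> pp /forallP pf sM d0.
have pw l : (0 < l)%N -> M`_l != 0 -> l = (p ^ logn p l)%N.
  move=> l0 nz; have [lt|ge] := ltnP l (size M); last by rewrite nth_default ?eqxx in nz.
  have := pf (Ordinal lt); rewrite /= l0 nz /= => cl; have c1 : cdeg p l = 1%N by apply/eqP; rewrite eqn_leq cl cd_gt0.
  by rewrite -[LHS](pc_deg p l0) c1 muln1 Q_pow.
have Md : M`_d != 0 by have := lead_coef_eq0 M; rewrite lead_coefE sM /= -size_poly_eq0 sM => ->.
exists (logn p d); rewrite -pw //; split => //; set m := logn p d.
apply/polyP => j; rewrite coefD coef_sum coefC.
have [->|j0] := eqVneq j 0%N.
  rewrite big1 ?add0r // => i _; by rewrite coefZ coefXn ltn_eqF ?mulr0 // expn_gt0 prime_gt0.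
rewrite addr0; have [z|nz] := eqVneq M`_j 0.
  rewrite z big1 // => i _; rewrite coefZ coefXn; case: eqP => [e|_]; last by rewrite mulr0.
  by rewrite -e z mul0r.
have ej := pw j; rewrite lt0n j0 nz in ej; have {}ej := ej isT isT.
have jd : (j <= d)%N by rewrite -ltnS -sM ltnNge; apply: contraNN nz => h; rewrite nth_default.
have lt : (logn p j < m.+1)%N.
  by rewrite ltnS -(leq_exp2l _ _ (prime_gt1 pp)) -ej /m -pw.
rewrite (bigD1 (Ordinal lt)) //= -ej coefZ coefXn eqxx mulr1 big1 ?addr0 // => i ne.
rewrite coefZ coefXn; case: eqP => [e|_]; last by rewrite mulr0.
case/eqP: ne; apply: val_inj => /=; apply/eqP; rewrite -(eqn_exp2l _ _ (prime_gt1 pp)) -e -ej //.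
Qed.

Lemma powerfree_linearized (R : nzRingType) p (M : {poly R}) : prime p -> powerfree p M -> linearized p M.
Proof.
move=> pp pf; have [h|h] := leqP (size M) 1.
  by exists 0%N, (fun=> 0); rewrite big_ord0 add0r {1}(size1_polyC h) horner_coef0.
have sM : size M = (size M).-1.+1 by rewrite prednK // ltnW.
have d0 : (0 < (size M).-1)%N by rewrite -ltnS -sM.
have [m [_ e]] := powerfree_form pp pf sM d0.
by exists m.+1, (fun i => M`_(p ^ i)); rewrite horner_coef0.
Qed.

Definition linear_const d := (\sum_(i < d.+1) curve_const i i)%N.
Lemma linear_const_le n d : (n <= d)%N -> (curve_const n n <= linear_const d)%N.
Proof.
by move=> h; rewrite /linear_const (bigD1 (Ordinal (h : (n < d.+1)%N))) //= leq_addr.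
Qed.

Definition Kbound dL dM := (64 + (nonlinear_const dM + 4 * (nonlinear_const dM * dL.+1)) + (nonlinear_const dL + 4 * (nonlinear_const dL * dM.+1)) + (linear_const dM + linear_const dL))%N.

Section Key.
Variables (k : finFieldType) (p : nat) (L M : {poly k}).
Hypothesis pc : p \in [pchar k].
Let pp : prime p := pcharf_prime pc.
Notation q := #|k|.
Notation dL := (size L).-1.
Notation dM := (size M).-1.
Notation I := (\sum_(s : k | s != 0%R) card_im L M s)%N.

Lemma fibres_total al be :
  (forall s x, let m := #|[set y | psi L M s y == psi L M s x]| in (be * m <= al + m * m)%N) ->
  (be * q ^ 3 <= al * I + (q ^ 3 + \sum_(c : k | c != 0%R) Ndiff M c * Ndiff L c) + be * q ^ 2)%N.
Proof.
move=> h.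
have q1 : #|[pred s : k | s != 0]| = q.-1.
  by have := cardC1 (0 : k); apply: etrans; apply: eq_card => s; rewrite !inE.
have t : (be * (q.-1 * q ^ 2) <= al * I + \sum_(s : k | s != 0%R) collisions L M s)%N.
  rewrite -q1 -sum_nat_const big_distrr /= big_distrr /= -big_split /=; apply: leq_sum => s _.
  by have := fibre_ineq (h s); rewrite card_prod mulnn.
have q0 : (0 < q)%N by apply: ltnW (card_finNzRing_gt1 k).
have e : (be * q ^ 3 = be * (q.-1 * q ^ 2) + be * q ^ 2)%N.
  by rewrite -mulnDr -mulSnr prednK // -expnS.
rewrite e leq_add2r; apply: leq_trans t _; rewrite leq_add2l; exact: coll_le.
Qed.

(** One factor satisfies the bound on average; for the other the number of all pairs is
    enough. *)
Lemma key_nonlinear : ~~ powerfree p M || ~~ powerfree p L -> (q ^ 3 <= 4 * I + Kbound dL dM * q ^ 2)%N.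
Proof.
move=> hN.
have sq (m : nat) : (8 * m <= 16 + m * m)%N by have := (nat_Cauchy m 4).1; rewrite !expnS !expn0; clear; lia.
have ft := fibres_total (fun s x => sq _).
have nl (A : {poly k}) : ~~ powerfree p A -> almost54 (Ndiff A) (nonlinear_const (size A).-1).
  move=> /powerfreeN [l [l0 nz cl]].
  have lt : (l < size A)%N by rewrite ltnNge; apply: contraNN nz => h; rewrite nth_default.
  have sA : size A = (size A).-1.+1 by rewrite prednK // (leq_ltn_trans _ lt).
  have d0 : (0 < (size A).-1)%N by rewrite -ltnS -sA (leq_ltn_trans l0).
  exact: (nonlinear_bound pc sA d0 l0 nz cl).
have Ne (A : {poly k}) c : c != 0 -> (Ndiff A c <= (size A).-1.+1 * q)%N.
  by move=> c0; apply: leq_trans (Ndiff_le A c0) _; rewrite leq_mul2r leqSpred orbT.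
have fin (C e : nat) : (C + 4 * (C * e) <= Kbound dL dM - 32)%N ->
  (4 * \sum_(c : k | c != 0%R) Ndiff M c * Ndiff L c <= 5 * q ^ 3 + (C + 4 * (C * e)) * q ^ 2)%N -> (q ^ 3 <= 4 * I + Kbound dL dM * q ^ 2)%N.
  have K32 : (32 <= Kbound dL dM)%N by rewrite /Kbound -!addnA leq_addr.
  move=> hk hs; have hk' : (C + 4 * (C * e) + 32 <= Kbound dL dM)%N by rewrite addnC -leq_subRL // addnC.
  have := leq_mul hk' (leqnn (q ^ 2)); rewrite mulnDl => hh.
  move: ft hs hh; move: (q ^ 3)%N (q ^ 2)%N I (\sum_(c | _) _)%N (Kbound _ _) (C + _)%N => a b i s K W; clear.
  by move: (W * b)%N (K * b)%N => u v; lia.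
case/orP: hN => hn.
  apply: (fin (nonlinear_const dM) dL.+1); last by apply: sum_bound (nl _ hn) _ (sum_Ndiff L) => c; apply: Ne.
  rewrite /Kbound; move: (nonlinear_const _ + _)%N (nonlinear_const _ + _)%N (_ + linear_const _)%N => x y z; clear; lia.
apply: (fin (nonlinear_const dL) dM.+1).
  rewrite /Kbound; move: (nonlinear_const _ + _)%N (nonlinear_const _ + _)%N (_ + linear_const _)%N => x y z; clear; lia.
under eq_bigr do rewrite mulnC.
by apply: sum_bound (nl _ hn) _ (sum_Ndiff M) => c; apply: Ne.
Qed.

(** For odd [p], [m] is odd and [(m - 3) (m - 5) >= 0]; for [p = 2], [m != 3] and
    [(m - 2) (m - 4) >= 0]. *)
Lemma key_linear : powerfree p M -> powerfree p L -> L`_1 != 0 -> M`_1 != 0 -> (q ^ 3 <= 4 * I + Kbound dL dM * q ^ 2)%N.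
Proof.
move=> pM pL L1 M1.
have form (A : {poly k}) : powerfree p A -> A`_1 != 0 -> exists m, [/\ (size A).-1 = (p ^ m)%N,
    A`_(p ^ m) != 0 & forall x, A.[x] = lin p m (fun i => A`_(p ^ i)) x + A`_0].
  move=> pA A1; have lt : (1 < size A)%N by rewrite ltnNge; apply: contraNN A1 => h; rewrite nth_default.
  have sA : size A = (size A).-1.+1 by rewrite prednK // ltnW.
  have d0 : (0 < (size A).-1)%N by rewrite -ltnS -sA.
  have [m [ed eA]] := powerfree_form pp pA sA d0; exists m; split => //.
    by rewrite -ed -lead_coefE lead_coef_eq0 -size_poly_eq0 sA.
  move=> x; rewrite {1}eA hornerD hornerC horner_sum; congr (_ + _); apply: eq_bigr => i _.
  by rewrite hornerZ hornerXn.
have [mM [eM aM hM]] := form M pM M1; have [mL [eL aL hL]] := form L pL L1.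
have fp := fibre_pow pc hL hM.
have ls := @lin_sum k p L M mL mM _ _ _ _ pc hL hM.
have cM (n : nat) : (n <= p ^ mM)%N -> (curve_const n n <= linear_const dM)%N by rewrite -eM; apply: linear_const_le.
have cL (n : nat) : (n <= p ^ mL)%N -> (curve_const n n <= linear_const dL)%N by rewrite -eL; apply: linear_const_le.
have K0 : (64 + (linear_const dM + linear_const dL) <= Kbound dL dM)%N.
  by rewrite /Kbound leq_add2r -addnA leq_addr.
have Kq := leq_mul K0 (leqnn (q ^ 2)); rewrite mulnDl in Kq.
have [p2|podd] := eqVneq p 2%N.
  have h s x : let m := #|[set y | psi L M s y == psi L M s x]| in (6 * m <= 8 + m * m)%N.
    have [j ->] := fp s; rewrite p2; case: j x => [|[|j]] x //.
    have : (4 <= 2 ^ j.+2)%N by rewrite (leq_pexp2l (m := 2) (n1 := 2)).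
    by move: (2 ^ j.+2)%N => m; clear; nia.
  have ft := fibres_total h.
  have nM := @moment2_two k p mM (fun i => M`_(p ^ i)) pc M1 aM p2.
  have nL := @moment2_two k p mL (fun i => L`_(p ^ i)) pc L1 aL p2.
  have hC : (4 * moment2 p mM (fun i => (M`_(p ^ i))%R) + 4 * moment2 p mL (fun i => (L`_(p ^ i))%R) <= 18 * q + (linear_const dM + linear_const dL))%N.
    have b1 := cM _ (leqnn _); have b2 := cL _ (leqnn _); move: nM nL b1 b2; clear; lia.
  have := ls _ hC; rewrite mulnDl -mulnA -expnS => hs.
  move: ft hs Kq; move: (q ^ 3)%N (q ^ 2)%N I (\sum_(c | _) _)%N (Kbound _ _) (linear_const _ + _)%N => a b i s K W; clear.
  by move: (W * b)%N (K * b)%N => u v; lia.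
have h s x : let m := #|[set y | psi L M s y == psi L M s x]| in (8 * m <= 15 + m * m)%N.
  have [j ->] := fp s; have : odd (p ^ j).
    by case: (even_prime pp) => [e|o]; [rewrite e in podd | rewrite oddX o orbT].
  move: (p ^ j)%N => m; case: m => [|[|[|[|[|m]]]]] // _; by clear; nia.
have ft := fibres_total h.
have nM := @moment2_odd k p mM (fun i => M`_(p ^ i)) pc M1 aM podd.
  have nL := @moment2_odd k p mL (fun i => L`_(p ^ i)) pc L1 aL podd.
have hC : (4 * moment2 p mM (fun i => (M`_(p ^ i))%R) + 4 * moment2 p mL (fun i => (L`_(p ^ i))%R) <= 26 * q + (linear_const dM + linear_const dL))%N.
  have b1 := cM _ (leq_subr 1 _); have b2 := cL _ (leq_subr 1 _); move: nM nL b1 b2; clear; lia.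
have := ls _ hC; rewrite mulnDl -mulnA -expnS => hs.
move: ft hs Kq; move: (q ^ 3)%N (q ^ 2)%N I (\sum_(c | _) _)%N (Kbound _ _) (linear_const _ + _)%N => a b i s K W; clear.
by move: (W * b)%N (K * b)%N => u v; lia.
Qed.
End Key.

(** * The image of the map *)

Import Order.TTheory Num.Theory.
Lemma card_image_phi (F0 F : finFieldType) (iota : {rmorphism F0 -> F}) (L M : {poly F0}) :
  (\sum_(s : F | s != 0%R) card_im (map_poly iota L) (map_poly iota M) s <= #|image_phi iota L M|)%N.
Proof.
set L1 := map_poly iota L; set M1 := map_poly iota M.
pose A := [set x : F * (F * F) | (x.1 != 0) && (x.2 \in [set psi L1 M1 x.1 t | t in {: F * F}])].
have -> : (\sum_(s : F | s != 0%R) card_im L1 M1 s = #|A|)%N.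
  rewrite card_fibres [RHS](bigID (fun s : F => s != 0)) /= [X in (_ + X)%N]big1 ?addn0.
    by apply: eq_bigr => s s0; apply: eq_card => v; rewrite !inE /= s0.
  by move=> s /negbTE s0; apply/eqP; rewrite cards_eq0; apply/eqP/setP => v; rewrite !inE /= s0.
pose r (x : F * (F * F)) : F * F * F := (x.1, x.2.1, x.2.2).
have ri : injective r by move=> [s [u v]] [s' [u' v']] [-> -> ->].
rewrite -(card_imset _ ri); apply/subset_leq_card/subsetP => _ /imsetP [[s v] hx ->].
move: hx; rewrite inE /= => /andP [_ /imsetP [[t1 t2] _ ->]].
by apply/imsetP; exists (s, t1, t2).
Qed.

Lemma powerfree_map (F0 F : fieldType) (iota : {rmorphism F0 -> F}) p (A : {poly F0}) :
  powerfree p (map_poly iota A) = powerfree p A.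
Proof.
have sz : size (map_poly iota A) = size A by exact: size_map_poly.
apply/forallP/forallP => h l.
  have lt : (l < size (map_poly iota A))%N by rewrite sz.
  by have := h (Ordinal lt); rewrite /= coef_map fmorph_eq0.
have lt : (l < size A)%N by rewrite -sz.
by have := h (Ordinal lt); rewrite /= coef_map fmorph_eq0.
Qed.

Lemma key_image (p : nat) (F0 F : finFieldType) (iota : {rmorphism F0 -> F}) (L M : {poly F0}) :
  p \in [pchar F0] -> (linearized p L -> linearized p M -> L^`().[0] * M^`().[0] != 0) ->
  (#|F| ^ 3 <= 4 * #|image_phi iota L M| + Kbound (size L).-1 (size M).-1 * #|F| ^ 2)%N.
Proof.
move=> pc0 lin; have pc := rmorph_pchar iota pc0; have pp := pcharf_prime pc0.
have := card_image_phi iota L M; set S := (\sum_(s | _) _)%N => hS.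
have key : (#|F| ^ 3 <= 4 * S + Kbound (size L).-1 (size M).-1 * #|F| ^ 2)%N.
  rewrite -(size_map_poly iota L) -(size_map_poly iota M).
  have [hN|] := boolP (~~ powerfree p M || ~~ powerfree p L).
    by apply: key_nonlinear pc _; rewrite !powerfree_map.
  rewrite negb_or !negbK => /andP [pM pL].
  have := lin (powerfree_linearized pp pL) (powerfree_linearized pp pM).
  rewrite !horner_coef0 !coef_deriv !mulr1n mulf_eq0 negb_or => /andP [L1 M1].
  by apply: key_linear pc _ _ _ _; rewrite ?powerfree_map // coef_map fmorph_eq0.
by apply: leq_trans key _; rewrite leq_add2r leq_mul2l.
Qed.

Theorem proposition3 (R : realType) (degL degM : nat) :
  exists A : R, 0 <= A /\
    forall (p : nat) (F0 : finFieldType) (charF0 : p \in [pchar F0])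
           (L M : {poly F0}),
      (size L).-1 = degL -> (size M).-1 = degM ->
      (linearized p L -> linearized p M -> L^`().[0] * M^`().[0] != 0) ->
      forall (F : finFieldType) (iota : {rmorphism F0 -> F}),
        (#|F|%:R ^+ 3) / 4 - A * (#|F|%:R `^ (5 / 2))
          <= #|image_phi iota L M|%:R :> R.
Proof.
exists (Kbound degL degM)%:R; split; first exact: ler0n.
move=> p F0 pc L M eL eM lin F iota.
have := key_image iota pc lin; rewrite eL eM; set E := #|image_phi iota L M|; set K := Kbound _ _ => h.
have q1 : 1 <= #|F|%:R :> R by rewrite ler1n ltnW // card_finNzRing_gt1.
have hR : (#|F|%:R ^+ 3 : R) <= 4 * E%:R + K%:R * #|F|%:R ^+ 2.
  by rewrite -!natrX -!natrM -natrD ler_nat.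
have h5 : #|F|%:R ^+ 2 <= #|F|%:R `^ (5 / 2) :> R.
  rewrite -powR_mulrn ?ler0n //; apply: (ler_powR q1).
  by rewrite ler_pdivlMr ?ltr0n // -natrM ler_nat.
have K0 : 0 <= K%:R :> R by exact: ler0n.
have q20 : 0 <= #|F|%:R ^+ 2 :> R by rewrite exprn_ge0 // ler0n.
have h6 := ler_wpM2l K0 h5.
have h7 : 0 <= K%:R * #|F|%:R ^+ 2 :> R by rewrite mulr_ge0.
move: hR h6 h7; move: (K%:R * _) (K%:R * _) (E%:R) (_ ^+ 3) => u v e c; lra.
Qed.
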